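(* Let $A(\Gamma)$ and $A(\Lambda)$ be right-angled Artin groups. Then $\Lambda$ is a minor of $\Gamma$ if and only if there exist a sequence of pearl deletions $\lbrace A(A_i)\rightarrow A(A_{i+1})\rbrace_{i=1}^{a-1}$, a sequence of identification homomorphisms $\lbrace A(B_j)\rightarrow A(B_{j+1})\rbrace_{j=1}^{b-1}$ and a sequence of abelianizing homomorphisms $\lbrace A(C_k)\rightarrow A(C_{k+1})\rbrace_{k=1}^{c-1}$ such that $A(\Gamma)\cong A(A_1)$, $A(A_a)\cong A(B_1)$, $A(B_b)\cong A(C_c)$ and $A(C_1)\cong A(\Lambda)$.
   Context: Basics. All graphs are finite, undirected and simple; $V(\Gamma)$, $E(\Gamma)$ are the vertex and edge sets. The right-angled Artin group (RAAG) with underlying graph $\Gamma$ is $A(\Gamma) = \langle v \in V(\Gamma) \mid [v,w]=1 \text{ whenever } \{v,w\}\in E(\Gamma)\rangle$. $C(x)$ is the centralizer of $x$, $\langle\langle \cdot \rangle\rangle$ the normal closure, $d(G)$ the minimal number of generators of $G$; $P_n$ and $C_n$ denote (for specific $n$) the path and the cycle on $n$ vertices, while $A_i,B_j,C_k$ in the claim denote arbitrary graphs. An ear is a graph that is a path or a cycle, with more than one vertex. The endpoints of an ear are the two degree $1$ vertices of a path, respectively one distinguished vertex of a cycle; all other vertices are inner. An ear RAAG is $A(\Gamma)$ with $\Gamma$ an ear. Pearl chains. Let $\Gamma$ be an ear. For $\Gamma$ not the $4$-cycle, an element $x\in A(\Gamma)$ satisfies (I) if $x\neq 1$, $C(x)$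 is non-abelian and $x$ generates the center of $C(x)$. Elements $x,y$ satisfying (I) are adjacent inner pearls if $[x,y]=1$ and there is $z\in A(\Gamma)$ with $[x,z]=1$, $[y,z]\neq 1$. A triple $(x,y,z)$ satisfies (E) if $y,z$ are adjacent inner pearls, $C(y)=\langle x,y,z\rangle$ and $A(\Gamma)/\langle\langle y\rangle\rangle$ splits as a free product with one factor isomorphic to $\mathbb{Z}$. A triple $(y,x,z)$ with middle element $x$ satisfies (T) if $d(A(\Gamma))\ge 5$, $x,y,z$ satisfy (I), $y,z\in C(x)$ and $y\langle x\rangle, z\langle x\rangle$ generate $C(x)/\langle x\rangle$. A pearl chain of $A(\Gamma)$ is a finite set of elements $\{p_1,\dots,p_n\}$, listed in order, such that: (i) if $\Gamma$ is the path on $2$ vertices: $n=2$ and neither $p_1\in\mathbb{Z}^2$ nor $p_2\langle p_1\rangle\in \mathbb{Z}^2/\langle p_1\rangle$ is of the form $ku$ with $k$ an integer, $|k|\ge 2$; (ii) if $\Gamma$ is the $3$-cycle: $n=3$, $A(\Gamma)/\langle p_3\rangle\cong\mathbb{Z}^2$ and $p_1\langle p_3\rangle, p_2\langle p_3\rangle$ satisfy in this quotient the condition of (i); (iii) if $\Gamma$ is the path on $3$ vertices: $n=3$, $C(p_2)$ is non-abelian, $p_2$ generates its center and $C(p_2)=\langle p_1,p_2,p_3\rangle$; (iv) if $\Gamma$ is the $4$-cycle: $n=4$ and, indices modulo $4$, each $C(p_i)$ is non-abelian, $C(p_i)=\langle p_{i-1},p_i,p_{i+1}\rangle$ and $A(\Gamma)/\langle\langle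 p_i\rangle\rangle$ is a RAAG with $d(A(\Gamma))=d(A(\Gamma)/\langle\langle p_i\rangle\rangle)+1$; (v) if $\Gamma$ is any other path: $(p_1,p_2,p_3)$ and $(p_n,p_{n-1},p_{n-2})$ satisfy (E), and $(p_{i-1},p_i,p_{i+1})$ satisfies (T) for $3\le i\le n-2$; (vi) if $\Gamma$ is any other cycle: $(p_{i-1},p_i,p_{i+1})$ satisfies (T) for all $i$, indices modulo $n$. Elements of a pearl chain are called pearls; $p_j$ corresponds to the $j$-th vertex of $\Gamma$ when the vertices are listed consecutively along the ear ($p_1,p_n$ correspond to the endpoints of a path, $p_1$ to the endpoint of a cycle). An ear RAAG together with a pearl chain is a decorated ear RAAG. Loose ear decompositions of RAAGs. A loose ear decomposition of $A(\Gamma)$ consists of decorated ear RAAGs $(A(\Gamma_i),\{p_{i,1},\dots,p_{i,n_i}\})$, $1\le i\le m$, and an iterated amalgamated product $G_m\cong A(\Gamma)$, where $G_1=A(\Gamma_1)$ and $G_{k+1}$ is obtained from the free product $G_k * A(\Gamma_{k+1})$ by imposing either no relation, or the relation $p_{k+1,1}=p_{i_1,j_1}$, or (for $\Gamma_{k+1}$ a path) the two relations $p_{k+1,1}=p_{i_1,j_1}$ and $p_{k+1,n_{k+1}}=p_{i_2,j_2}$ with two distinct pearls of $G_k$, where $i_1,i_2\le k$. The images of the $p_{i,j}$ in $A(\Gamma)$ are the pearls of the decomposition. They correspond to the vertices of $\Gamma$, and two pearls are adjacent if the corresponding vertices are adjacent. Minors and homomorphisms. A graph $X$ is a minor of a graph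 $Y$ if there are $S\subseteq V(Y)$ and a function $f:S\to V(X)$ such that for every $x\in V(X)$ the preimage $f^{-1}(x)$ induces a connected (in particular nonempty) subgraph of $Y$, and there is an edge of $Y$ between $f^{-1}(x)$ and $f^{-1}(x')$ whenever there is an edge between $x,x'$ in $X$. Relative to a chosen loose ear decomposition of a RAAG $A(\Delta)$: a pearl deletion is the projection $A(\Delta)\to A(\Delta)/\langle\langle p\rangle\rangle$ with $p$ a pearl; an identification homomorphism is the projection $A(\Delta)\to A(\Delta)/\langle\langle pq^{-1}\rangle\rangle$ with $p,q$ adjacent pearls; an abelianizing homomorphism is the projection $A(\Delta)\to A(\Delta)/\langle\langle [p,q]\rangle\rangle$ with $p,q$ non-adjacent pearls. In each case the quotient is identified with the RAAG that is the target of the homomorphism.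
   Formalization: Loose ear decompositions may also use a single vertex (the group Z decorated by a generator) as a piece; with ears of more than one vertex only, the claim fails, e.g. for Γ a single edge and Λ two isolated vertices. *)

(* Defs.v *)
From HB Require Import structures.
From mathcomp Require Import all_boot all_order all_algebra.
From mathcomp Require Import boolp classical_sets.

Set Implicit Arguments.
Unset Strict Implicit.
Unset Printing Implicit Defensive.

Local Open Scope classical_set_scope.
Local Open Scope quotient_scope.
Local Open Scope group_scope.

Record simple_graph := SimpleGraph {
  vertex :> finType;
  edge : rel vertex;
  edge_sym : symmetric edge;
  edge_irrefl : irreflexive edge }.

Definition path_edge n : rel 'I_n :=
  fun i j => (j == i.+1 :> nat) || (i == j.+1 :> nat).

Fact path_edge_sym n : symmetric (@path_edge n).
Proof. by move=> i j; rewrite /path_edge orbC. Qed.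

Fact path_edge_irrefl n : irreflexive (@path_edge n).
Proof. by move=> i; rewrite /path_edge orbb ltn_eqF. Qed.

Definition path_graph n := SimpleGraph (@path_edge_sym n) (@path_edge_irrefl n).

(* The test [i != j] only matters for [n = 1]; cycles are used for [3 <= n]. *)
Definition cycle_edge n : rel 'I_n :=
  fun i j => (i != j) &&
    ((j == i.+1 %% n :> nat) || (i == j.+1 %% n :> nat)).

Fact cycle_edge_sym n : symmetric (@cycle_edge n).
Proof. by move=> i j; rewrite /cycle_edge orbC eq_sym. Qed.

Fact cycle_edge_irrefl n : irreflexive (@cycle_edge n).
Proof. by move=> i; rewrite /cycle_edge eqxx. Qed.

Definition cycle_graph n :=
  SimpleGraph (@cycle_edge_sym n) (@cycle_edge_irrefl n).

Definition connected_in (Y : simple_graph) (A : {set Y}) : Prop :=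
  (exists y, y \in A) /\
  forall u v, u \in A -> v \in A ->
    connect [rel s t | [&& s \in A, t \in A & edge s t]] u v.

(* The partial function [f] encodes the map S -> V(X), where S is the set of
   vertices [y] with [f y <> None]. *)
Definition minor (X Y : simple_graph) : Prop :=
  exists f : Y -> option X,
    (forall x, connected_in [set y | f y == Some x]%SET) /\
    (forall x x', edge x x' ->
       exists y y', [/\ f y = Some x, f y' = Some x' & edge y y']).

Section GroupTheory.
Variable G : groupType.
Implicit Types (S C : set G) (x y : G).

Inductive gen S : set G :=
| gen_in x : S x -> gen S x
| gen_one : gen S 1
| gen_mul x y : gen S x -> gen S y -> gen S (x * y)
| gen_inv x : gen S x -> gen S x^-1.

Definition normal_closure S : set G :=
  gen [set y | exists2 s, S s & exists g, y = s ^ g].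

Definition centralizer x : set G := [set g | commute g x].

Definition nonabelian C : Prop :=
  exists g h, [/\ C g, C h & ~ commute g h].

Definition center_of C : set G :=
  [set g | C g /\ forall h, C h -> commute g h].

(* For a subgroup [C], [x] central in [C] and [S] contained in [C]: the images
   of the elements of [S] generate C / <x>, that is, every coset g<x> equals
   h<x> for some [h] in the subgroup generated by [S]. *)
Definition generate_mod C x S : Prop :=
  forall g, C g -> exists2 h, gen S h & gen [set x] (h^-1 * g).

Definition expgz x (k : int) : G :=
  match k with Posz n => x ^+ n | Negz n => x ^- n.+1 end.

(* "of the form ku with |k| >= 2", in multiplicative notation *)
Definition proper_multiple x : Prop :=
  exists u (k : int), (2 <= `|k|)%N /\ x = expgz u k.

Definition generated_by_n (n : nat) : Prop :=
  exists s : n.-tuple G, gen [set` s] = setT.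

(* d(G); the default value 0 is taken if [G] is not finitely generated. *)
Definition min_generators : nat :=
  xget 0%N [set n | generated_by_n n /\
                    forall m, generated_by_n m -> (n <= m)%N].

Definition nontrivial : Prop := exists x : G, x <> 1.

(* [G], written multiplicatively, is isomorphic to the additive group [V]. *)
Definition additive_iso (V : zmodType) : Prop :=
  exists f : V -> G, bijective f /\ forall u v, f (u + v)%R = f u * f v.

End GroupTheory.

Definition group_iso (G H : groupType) : Prop :=
  exists f : {multiplicative G -> H}, bijective f.

(* G / <<S>>, the quotient by the normal closure *)
Section Quotient.
Variables (G : groupType) (S : set G).
Implicit Types x y z g : G.

Let N := normal_closure S.

Fact normal_closureJ x g : N x -> N (x ^ g).
Proof.
elim=> {x} [x [s Ss [h ->]]||x y _ IHx _ IHy|x _ IHx].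
- by apply: gen_in; exists s => //; exists (h * g); rewrite conjgM.
- by rewrite conj1g; exact: gen_one.
- by rewrite conjMg; exact: gen_mul.
- by rewrite conjVg; exact: gen_inv.
Qed.

Definition coset_rel : rel G := fun x y => `[< normal_closure S (x^-1 * y) >].

Fact coset_rel_equiv : equiv_class_of coset_rel.
Proof.
have symm x y : coset_rel x y -> coset_rel y x.
  move=> /asboolP/gen_inv; rewrite invgM invgK => xy; exact/asboolP.
split.
- by move=> x; apply/asboolP; rewrite mulVg; exact: gen_one.
- by move=> x y; apply/idP/idP; exact: symm.
- move=> y x z /asboolP xy /asboolP yz; apply/asboolP.
  by have := gen_mul xy yz; rewrite -mulgA mulVKg.
Qed.

Canonical coset_equiv := EquivRelPack coset_rel_equiv.

Definition quotient_group := {eq_quot coset_equiv}.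
HB.instance Definition _ : EqQuotient _ coset_equiv quotient_group :=
  EqQuotient.on quotient_group.
HB.instance Definition _ := Choice.on quotient_group.

Definition quot_pi (x : G) : quotient_group := \pi_quotient_group x.

Fact quot_piP x y : quot_pi x = quot_pi y <-> N (x^-1 * y).
Proof.
by split=> [/(@eqquotP _ _ quotient_group)/asboolP|H] //;
  apply/(@eqquotP _ _ quotient_group)/asboolP.
Qed.

Definition quot_one : quotient_group := quot_pi 1.
Definition quot_inv (a : quotient_group) : quotient_group :=
  quot_pi (repr a)^-1.
Definition quot_mul (a b : quotient_group) : quotient_group :=
  quot_pi (repr a * repr b).

Fact quot_piV x : quot_pi x^-1 = quot_inv (quot_pi x).
Proof.
apply/quot_piP; rewrite invgK.
have /quot_piP : quot_pi (repr (quot_pi x)) = quot_pi x by exact: reprK.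
move: (repr _) => y /(@normal_closureJ _ x^-1).
by rewrite /conjg invgK !mulgA mulgK.
Qed.

Fact quot_piM x y : quot_pi (x * y) = quot_mul (quot_pi x) (quot_pi y).
Proof.
apply/esym/quot_piP.
have /quot_piP : quot_pi (repr (quot_pi x)) = quot_pi x by exact: reprK.
have /quot_piP : quot_pi (repr (quot_pi y)) = quot_pi y by exact: reprK.
move: (repr (quot_pi x)) (repr (quot_pi y)) => x' y' Ny.
move=> /(@normal_closureJ _ y') /gen_mul/(_ Ny).
by rewrite invgM /conjg -!mulgA mulVKg.
Qed.

Fact quot_mulA : associative quot_mul.
Proof.
move=> a b c; rewrite -[a]reprK -[b]reprK -[c]reprK.
by rewrite -!/(quot_pi _) -!quot_piM mulgA.
Qed.

Fact quot_mul1g : left_id quot_one quot_mul.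
Proof. by move=> a; rewrite -[a]reprK -!/(quot_pi _) -!quot_piM mul1g. Qed.

Fact quot_mulg1 : right_id quot_one quot_mul.
Proof. by move=> a; rewrite -[a]reprK -!/(quot_pi _) -!quot_piM mulg1. Qed.

Fact quot_mulVg : left_inverse quot_one quot_inv quot_mul.
Proof.
by move=> a; rewrite -[a]reprK -!/(quot_pi _) -quot_piV -!quot_piM mulVg.
Qed.

Fact quot_mulgV : right_inverse quot_one quot_inv quot_mul.
Proof.
by move=> a; rewrite -[a]reprK -!/(quot_pi _) -quot_piV -!quot_piM mulgV.
Qed.

HB.instance Definition _ := isGroup.Build quotient_group
  quot_mulA quot_mul1g quot_mulg1 quot_mulVg quot_mulgV.

HB.instance Definition _ :=
  isMultiplicative.Build G quotient_group quot_pi quot_piM.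

End Quotient.

(* The free group on [X]: words in the letters (x, true) = x and
   (x, false) = x^-1, up to insertion and removal of cancelling pairs. *)
Section FreeGroup.
Variable X : choiceType.

Definition word := seq (X * bool).

Inductive word_eq : word -> word -> Prop :=
| word_eq_refl w : word_eq w w
| word_eq_sym w w' : word_eq w w' -> word_eq w' w
| word_eq_trans w w' w'' : word_eq w w' -> word_eq w' w'' -> word_eq w w''
| word_eq_cancel u v x b :
    word_eq (u ++ [:: (x, b); (x, ~~ b)] ++ v) (u ++ v).

Definition word_rel : rel word := fun w w' => `[< word_eq w w' >].

Fact word_rel_equiv : equiv_class_of word_rel.
Proof.
split.
- by move=> w; apply/asboolP; exact: word_eq_refl.
- by move=> w w'; apply/asboolP/asboolP; exact: word_eq_sym.
- move=> w' w w'' /asboolP H /asboolP H'; apply/asboolP.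
  exact: word_eq_trans H H'.
Qed.

Canonical word_equiv := EquivRelPack word_rel_equiv.

Definition free_group := {eq_quot word_equiv}.
HB.instance Definition _ : EqQuotient _ word_equiv free_group :=
  EqQuotient.on free_group.
HB.instance Definition _ := Choice.on free_group.

Definition free_pi (w : word) : free_group := \pi_free_group w.

Fact free_piP w w' : free_pi w = free_pi w' <-> word_eq w w'.
Proof.
by split=> [/(@eqquotP _ _ free_group)/asboolP|H] //;
  apply/(@eqquotP _ _ free_group)/asboolP.
Qed.

Definition word_inv (w : word) : word := rev [seq (l.1, ~~ l.2) | l <- w].

Fact word_eq_cat w1 w1' w2 w2' :
  word_eq w1 w1' -> word_eq w2 w2' -> word_eq (w1 ++ w2) (w1' ++ w2').
Proof.
move=> H1 H2; apply: (@word_eq_trans _ (w1' ++ w2)).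
  elim: H1 {H2} => [w|w w' _|w w' w'' _ IH1 _ IH2|u v x b].
  - exact: word_eq_refl.
  - exact: word_eq_sym.
  - exact: word_eq_trans IH1 IH2.
  - by rewrite -!catA; exact: (word_eq_cancel u (v ++ w2)).
elim: H2 => [w|w w' _|w w' w'' _ IH1 _ IH2|u v x b].
- exact: word_eq_refl.
- exact: word_eq_sym.
- exact: word_eq_trans IH1 IH2.
- rewrite (catA w1' u v) (catA w1' u); exact: word_eq_cancel.
Qed.

Fact word_eq_inv w w' : word_eq w w' -> word_eq (word_inv w) (word_inv w').
Proof.
elim=> {w w'} [w|w w' _|w w' w'' _ IH1 _ IH2|u v x b].
- exact: word_eq_refl.
- exact: word_eq_sym.
- exact: word_eq_trans IH1 IH2.
- rewrite /word_inv !map_cat !rev_cat -catA /= negbK.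
  exact: (word_eq_cancel _ _ x b).
Qed.

Fact word_mulVg w : word_eq (word_inv w ++ w) [::].
Proof.
elim: w => [|[x b] w IH]; first exact: word_eq_refl.
rewrite /word_inv /= rev_cons -cats1 -catA /=.
apply: word_eq_trans IH.
by have := word_eq_cancel (word_inv w) w x (~~ b); rewrite negbK.
Qed.

Fact word_invK : involutive word_inv.
Proof.
move=> w; rewrite /word_inv map_rev revK -map_comp -[RHS]map_id.
by apply: eq_map => -[x b] /=; rewrite negbK.
Qed.

Definition free_one : free_group := free_pi [::].
Definition free_inv (a : free_group) : free_group := free_pi (word_inv (repr a)).
Definition free_mul (a b : free_group) : free_group :=
  free_pi (repr a ++ repr b).

Fact free_reprP w : word_eq (repr (free_pi w)) w.
Proof. by apply/free_piP; exact: reprK. Qed.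

Fact free_piV w : free_pi (word_inv w) = free_inv (free_pi w).
Proof. by apply/esym/free_piP/word_eq_inv/free_reprP. Qed.

Fact free_piM w w' : free_pi (w ++ w') = free_mul (free_pi w) (free_pi w').
Proof. by apply/esym/free_piP/word_eq_cat; exact: free_reprP. Qed.

Fact free_mulA : associative free_mul.
Proof.
move=> a b c; rewrite -[a]reprK -[b]reprK -[c]reprK.
by rewrite -!/(free_pi _) -!free_piM catA.
Qed.

Fact free_mul1g : left_id free_one free_mul.
Proof. by move=> a; rewrite -[a]reprK -!/(free_pi _) -free_piM. Qed.

Fact free_mulg1 : right_id free_one free_mul.
Proof. by move=> a; rewrite -[a]reprK -!/(free_pi _) -free_piM cats0. Qed.

Fact free_mulVg : left_inverse free_one free_inv free_mul.
Proof.
move=> a; rewrite -[a]reprK -!/(free_pi _) -free_piV -free_piM.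
by apply/free_piP; exact: word_mulVg.
Qed.

Fact free_mulgV : right_inverse free_one free_inv free_mul.
Proof.
move=> a; rewrite -[a]reprK -!/(free_pi _) -free_piV -free_piM.
by apply/free_piP; rewrite -{1}[repr a]word_invK; exact: word_mulVg.
Qed.

HB.instance Definition _ := isGroup.Build free_group
  free_mulA free_mul1g free_mulg1 free_mulVg free_mulgV.

Definition free_gen (x : X) : free_group := free_pi [:: (x, true)].

End FreeGroup.

Section RAAG.
Variable X : simple_graph.

Definition raag_relators : set (free_group X) :=
  [set r | exists v w : X, edge v w /\ r = [~ free_gen v, free_gen w]].

(* A(X) *)
Definition raag : groupType := quotient_group raag_relators.

End RAAG.

(* The free product of [G] and [H], presented by the disjoint union of their
   elements subject to the multiplication tables of [G] and [H]. *)
Section FreeProduct.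
Variables G H : groupType.

Notation inlg a := (free_gen (inl a : G + H)).
Notation inrg a := (free_gen (inr a : G + H)).

Definition free_product_relators : set (free_group (G + H)%type) :=
  [set r | (exists a b : G, r = inlg a * inlg b * (inlg (a * b))^-1) \/
           (exists a b : H, r = inrg a * inrg b * (inrg (a * b))^-1)].

Definition free_product : groupType := quotient_group free_product_relators.

Definition fp_inl (a : G) : free_product := quot_pi _ (inlg a).
Definition fp_inr (b : H) : free_product := quot_pi _ (inrg b).

End FreeProduct.

(* Pearl chains in an ear RAAG A(X), which [G] stands for. *)
Section PearlChains.
Variable G : groupType.
Implicit Types (x y z : G) (ps : seq G).

Definition cond_I x : Prop :=
  [/\ x <> 1, nonabelian (centralizer x)
    & center_of (centralizer x) = gen [set x]].

Definition adjacent_inner_pearls x y : Prop :=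
  [/\ cond_I x, cond_I y, commute x y
    & exists z, commute x z /\ ~ commute y z].

Definition cond_E x y z : Prop :=
  [/\ adjacent_inner_pearls y z,
      centralizer y = gen [set x; y; z]
    & exists H K : groupType,
        [/\ nontrivial H, additive_iso K int
          & group_iso (quotient_group [set y]) (free_product H K)]].

(* The triple (y, x, z), with [x] in the middle. *)
Definition cond_T y x z : Prop :=
  [/\ 5 <= min_generators G,
      [/\ cond_I x, cond_I y & cond_I z],
      centralizer x y /\ centralizer x z
    & generate_mod (centralizer x) x [set y; z]]%N.

(* The ambient group is Z^2, so that <p1> = <<p1>>. *)
Definition chain_Z2 (p1 p2 : G) : Prop :=
  ~ proper_multiple p1 /\ ~ proper_multiple (quot_pi [set p1] p2).

End PearlChains.

(* The pearl p_j is [nth 1 ps j.-1]; there is one pearl for each of the [n]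
   vertices. *)
Definition path_pearl_chain (n : nat) (G : groupType) (ps : seq G) : Prop :=
  let p j := nth 1 ps j.-1 in
  size ps = n /\
  match n with
  | 2 => chain_Z2 (p 1%N) (p 2)
  | 3 => [/\ nonabelian (centralizer (p 2)),
             center_of (centralizer (p 2)) = gen [set p 2]
           & centralizer (p 2) = gen [set p 1%N; p 2; p 3]]
  | _ => [/\ cond_E (p 1%N) (p 2) (p 3),
             cond_E (p n) (p n.-1) (p n.-2)
           & forall i, (3 <= i <= n - 2)%N ->
               cond_T (p i.-1) (p i) (p i.+1)]
  end.

Definition cycle_pearl_chain (n : nat) (G : groupType) (ps : seq G) : Prop :=
  let p j := nth 1 ps j.-1 in
  let pprev j := if j == 1%N then p n else p j.-1 in
  let pnext j := if j == n then p 1%N else p j.+1 in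
  size ps = n /\
  match n with
  | 3 => additive_iso (quotient_group [set p 3]) (int * int)%type /\
         chain_Z2 (quot_pi [set p 3] (p 1%N)) (quot_pi [set p 3] (p 2))
  | 4 => forall i, (1 <= i <= 4)%N ->
         [/\ nonabelian (centralizer (p i)),
             centralizer (p i) = gen [set pprev i; p i; pnext i],
             exists X : simple_graph,
               group_iso (quotient_group [set p i]) (raag X)
           & min_generators G = (min_generators (quotient_group [set p i])).+1]
  | _ => forall i, (1 <= i <= n)%N -> cond_T (pprev i) (p i) (pnext i)
  end.

(* [Point] is not an ear: it is the building block for isolated vertices. *)
Inductive piece := Point | Path of nat | Cycle of nat.

Definition piece_graph (s : piece) : simple_graph :=
  match s with
  | Point => path_graph 1
  | Path n => path_graph n
  | Cycle n => cycle_graph n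
  end.

Definition is_path (s : piece) : bool := if s is Path _ then true else false.

(* [ps] decorates A(s): ears are paths and cycles with more than one vertex,
   and carry a pearl chain. A single vertex is decorated by a generator of Z;
   without it no graph having an isolated vertex would have a loose ear
   decomposition. *)
Definition decoration (s : piece) (ps : seq (raag (piece_graph s))) : Prop :=
  match s with
  | Point => exists p, ps = [:: p] /\ gen [set p] = setT
  | Path n => (2 <= n)%N /\ path_pearl_chain n ps
  | Cycle n => (3 <= n)%N /\ cycle_pearl_chain n ps
  end.

(* A decomposition of [G] is recorded by the list of its pieces, each with the
   list of the images in [G] of its pearls. *)
Definition ear_list (G : Type) := seq (piece * seq G).

Definition map_ears (G H : Type) (f : G -> H) (D : ear_list G) : ear_list H :=
  [seq (e.1, map f e.2) | e <- D].

Definition pearls (G : Type) (D : ear_list G) : seq G := flatten (unzip2 D).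

Definition consecutive (G : Type) (s : piece) (ps : seq G) : seq (G * G) :=
  if s is Cycle _ then zip ps (rot 1 ps) else zip ps (behead ps).

(* The vertices of the graph glued from the pieces are the pearls, and its edges
   are the edges of the pieces. *)
Definition adjacent_pearls (G : eqType) (D : ear_list G) (p q : G) : bool :=
  let E := flatten [seq consecutive e.1 e.2 | e <- D] in
  ((p, q) \in E) || ((q, p) \in E).

Section Attaching.
Variables (G H : groupType).

(* The relations imposed on G * H when a piece with pearls [ps] in [H] is
   attached to [G], whose pearls are listed in [P]. *)
Definition identify (p : H) (q : G) : free_product G H :=
  fp_inr G p * (fp_inl H q)^-1.

Definition attaching_relators (P : seq G) (s : piece) (ps : seq H)
    (R : set (free_product G H)) : Prop :=
  [\/ R = set0,
      exists2 q, q \in P & R = [set identify (head 1 ps) q]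
    | is_path s /\ exists q1 q2, [/\ q1 \in P, q2 \in P, q1 <> q2
        & R = [set identify (head 1 ps) q1; identify (last 1 ps) q2]]].

End Attaching.

Inductive iterated_gluing : forall G : groupType, ear_list G -> Prop :=
| gluing_first s (ps : seq (raag (piece_graph s))) :
    decoration ps -> iterated_gluing [:: (s, ps)]
| gluing_next (G : groupType) (D : ear_list G)
    s (ps : seq (raag (piece_graph s))) (R : set (free_product G _)) :
    iterated_gluing D -> decoration ps ->
    attaching_relators (pearls D) s ps R ->
    iterated_gluing (G := quotient_group R)
      (rcons (map_ears (fun a => quot_pi R (fp_inl _ a)) D)
             (s, [seq quot_pi R (fp_inr _ b) | b <- ps])).

Definition loose_ear_decomposition (X : simple_graph) (D : ear_list (raag X))
    : Prop :=
  exists (G : groupType) (D0 : ear_list G) (f : {multiplicative G -> raag X}),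
    [/\ iterated_gluing D0, bijective f & D = map_ears f D0].

(* [f] is the projection G -> G / <<r>>, the quotient being identified with [H]
   by means of an isomorphism. *)
Definition projection_along (G H : groupType) (r : G)
    (f : {multiplicative G -> H}) : Prop :=
  exists phi : {multiplicative quotient_group [set r] -> H},
    bijective phi /\ forall x, f x = phi (quot_pi [set r] x).

Section Homomorphisms.
Variables (X Y : simple_graph) (f : {multiplicative raag X -> raag Y}).

Definition pearl_deletion : Prop :=
  exists D, loose_ear_decomposition D /\
    exists2 p, p \in pearls D & projection_along p f.

Definition identification_hom : Prop :=
  exists D, loose_ear_decomposition D /\
    exists p q, [/\ p \in pearls D, q \in pearls D, adjacent_pearls D p q
      & projection_along (p * q^-1) f].

Definition abelianizing_hom : Prop :=
  exists D, loose_ear_decomposition D /\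
    exists p q, [/\ p \in pearls D, q \in pearls D, p <> q,
      ~~ adjacent_pearls D p q & projection_along [~ p, q] f].

End Homomorphisms.

(* Main.v *)
Require Import Defs.
From HB Require Import structures.
From mathcomp Require Import all_boot all_order all_algebra perm.
From mathcomp Require Import boolp classical_sets.
From mathcomp Require Import zify ring.

(* A class phi in H^1(A(X); F), F a finite field of odd characteristic, is a
   function on the vertices of X, and two classes have zero cup product (they
   lift together to the Heisenberg group) iff phi(u) psi(v) = phi(v) psi(u) on
   every edge uv. The graph can be recovered from this pair (vector space,
   relation): expanding the determinant of an isomorphism gives a bijection of
   vertices, and true twins are dealt with by cancelling the permutations that
   exchange two of them. Hence every isomorphism of RAAGs comes with an
   isomorphism of graphs.

   The pearls of a decorated ear RAAG play the role of the vertices in this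
   cohomological sense: consecutive pearls commute, and it remains to see that
   no nonzero class vanishes on all of them. This uses that in a RAAG on a graph
   without triangles and squares an element with nonabelian centralizer is
   conjugate to a power of a vertex, which follows from the action on the trees
   of the HNN extensions with a vertex as stable letter. The property survives
   the gluing of ears, and killing p, p q^-1 or [p, q] changes the graph by a
   vertex deletion, an edge contraction or an edge addition.

   Conversely every graph is obtained from isolated points by attaching paths
   with two vertices, so the vertices of any graph are the pearls of a loose ear
   decomposition. *)

Set Implicit Arguments.
Unset Strict Implicit.
Unset Printing Implicit Defensive.

(** * Groups given by generators and relators *)

(** The conditions on a pearl chain do not say that the pearls satisfy a presentation of the ear
    RAAG, and this is never proved. Only two facts are extracted from them: consecutive pearls
    commute, and a class that is zero on all pearls is zero. Over a finite field this suffices,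
    because an injective self-map of a finite set is bijective. Finiteness also allows
    cardinalities, powers of the order of the field, to replace dimensions; odd characteristic is
    what makes a sum equal to its own opposite vanish. The obstacle in the study of centralizers is
    the lack of normal forms for HNN extensions. It is avoided by embedding A(X) in a semidirect
    product of a free group with A(X), where the length of reduced words satisfies the four-point
    inequality of trees. Axes and translations are derived from this inequality; no tree is
    constructed. Quotients and amalgams are tractable because a Heisenberg lift may be changed by
    any class in its central coordinate, so it can be made trivial on relators on which classes take
    arbitrary values. *)

Section MultiplicativeOnGroups.
Local Open Scope group_scope.
Variables (G H : groupType) (f : {multiplicative G -> H}).

Lemma multf1 : f 1 = 1.
Proof. by apply: (mulgI (f 1)); rewrite -gmulfM !mulg1. Qed.

Lemma multfV : {morph f : x / x^-1}.
Proof. by move=> x; apply: (mulgI (f x)); rewrite -gmulfM !mulgV multf1. Qed.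

Lemma multfJ : {morph f : x y / x ^ y}.
Proof. by move=> x y; rewrite !gmulfM multfV. Qed.

Lemma multfR : {morph f : x y / [~ x, y]}.
Proof. by move=> x y; rewrite gmulfM multfV multfJ. Qed.

Lemma multfX n : {morph f : x / x ^+ n}.
Proof.
by move=> x; elim: n => [|n IH]; rewrite ?expg0 ?multf1 // !expgS gmulfM IH.
Qed.

End MultiplicativeOnGroups.

Section GroupGeneralities.
Local Open Scope group_scope.

Definition mk_mult (G H : groupType) (f : G -> H)
  (fM : {morph f : x y / x * y}) : {multiplicative G -> H} :=
  HB.pack f (isMultiplicative.Build G H f fM).

Lemma commuteJ (G : groupType) (x y g : G) :
  commute x y -> commute (x ^ g) (y ^ g).
Proof. by rewrite /commute -!conjMg => ->. Qed.

Lemma gen_sub (G : groupType) (S T : set G) :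
  (forall x, S x -> gen T x) -> forall x, gen S x -> gen T x.
Proof.
move=> ST x; elim=> {x} [x /ST //||x y _ Tx _ Ty|x _ Tx].
- exact: gen_one.
- exact: gen_mul.
- exact: gen_inv.
Qed.

Lemma gen_mono (G : groupType) (S T : set G) :
  (forall x, S x -> T x) -> forall x, gen S x -> gen T x.
Proof. by move=> ST; apply: gen_sub => x /ST; exact: gen_in. Qed.

Lemma gen_mult_eq (G H : groupType) (f g : {multiplicative G -> H}) (S : set G) :
  (forall x, S x -> f x = g x) -> forall x, gen S x -> f x = g x.
Proof.
move=> fg x; elim=> {x} [x /fg //||x y _ Ex _ Ey|x _ Ex].
- by rewrite !multf1.
- by rewrite !gmulfM Ex Ey.
- by rewrite !multfV Ex.
Qed.

Lemma gen_mult_eq1 (G H : groupType) (f : {multiplicative G -> H}) (S : set G) :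
  (forall x, S x -> f x = 1) -> forall x, gen S x -> f x = 1.
Proof.
move=> f1 x; elim=> {x} [x /f1 //||x y _ Ex _ Ey|x _ Ex].
- by rewrite multf1.
- by rewrite gmulfM Ex Ey mul1g.
- by rewrite multfV Ex invg1.
Qed.

Lemma normal_closure_in (G : groupType) (S : set G) s :
  S s -> normal_closure S s.
Proof. by move=> Ss; apply: gen_in; exists s => //; exists 1; rewrite conjg1. Qed.

Lemma quot_pi1 (G : groupType) (S : set G) x :
  quot_pi S x = 1 <-> normal_closure S x.
Proof.
rewrite -(multf1 (quot_pi S)); split.
  by move/esym/quot_piP; rewrite invg1 mul1g.
by move=> Nx; apply/esym/quot_piP; rewrite invg1 mul1g.
Qed.

Lemma quot_pi_rel (G : groupType) (S : set G) s : S s -> quot_pi S s = 1.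
Proof. by move=> Ss; apply/quot_pi1/normal_closure_in. Qed.

Lemma quot_pi_surj (G : groupType) (S : set G) (q : quotient_group S) :
  exists x, q = quot_pi S x.
Proof. by exists (repr q); rewrite -[LHS]reprK. Qed.

Lemma quot_lift (G H : groupType) (S : set G) (f : {multiplicative G -> H}) :
  (forall s, S s -> f s = 1) ->
  exists g : {multiplicative quotient_group S -> H},
    forall x, g (quot_pi S x) = f x.
Proof.
move=> fS.
have fN x : normal_closure S x -> f x = 1.
  apply: gen_mult_eq1 => y /= [s Ss [g ->]].
  by rewrite multfJ fS // conj1g.
pose h (q : quotient_group S) : H := f (repr q).
have hE x : h (quot_pi S x) = f x.
  have /quot_piP/fN : quot_pi S (repr (quot_pi S x)) = quot_pi S x by exact: reprK.
  rewrite gmulfM multfV => E; rewrite /h.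
  by apply: (mulgI (f (repr (quot_pi S x)))^-1); rewrite mulVg E.
have hM : {morph h : x y / x * y}.
  move=> a b; have [x ->] := quot_pi_surj a; have [y ->] := quot_pi_surj b.
  by rewrite -gmulfM !hE gmulfM.
by exists (mk_mult hM).
Qed.

Definition eval_letter (X : choiceType) (H : groupType) (m : X -> H)
  (l : X * bool) : H := if l.2 then m l.1 else (m l.1)^-1.

Definition eval_word (X : choiceType) (H : groupType) (m : X -> H)
  (w : word X) : H := \prod_(l <- w) eval_letter m l.

Lemma eval_word_eq (X : choiceType) (H : groupType) (m : X -> H) w w' :
  word_eq w w' -> eval_word m w = eval_word m w'.
Proof.
elim=> {w w'} // [w w' w'' _ -> _ -> //|u v x b].
rewrite /eval_word !big_cat /= !big_cons big_nil mulg1.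
by case: b; rewrite /eval_letter /= ?mulgV ?mulVg mul1g.
Qed.

Lemma free_lift (X : choiceType) (H : groupType) (m : X -> H) :
  exists g : {multiplicative free_group X -> H},
    (forall x, g (free_gen x) = m x) /\
    (forall w, g (free_pi w) = eval_word m w).
Proof.
pose h (q : free_group X) : H := eval_word m (repr q).
have hE w : h (free_pi w) = eval_word m w.
  exact/eval_word_eq/free_reprP.
have hM : {morph h : x y / x * y}.
  by move=> a b; rewrite {1}/h (eval_word_eq _ (free_reprP _)) /eval_word big_cat.
exists (mk_mult hM); split=> [x|w]; last exact: hE.
by have := hE [:: (x, true)]; rewrite /eval_word big_seq1.
Qed.

Lemma free_genV (X : choiceType) (x : X) :
  (free_gen x)^-1 = free_pi [:: (x, false)].
Proof. by rewrite -[LHS]/(free_inv _) -free_piV. Qed.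

Lemma free_pi_cons (X : choiceType) (x : X) b w :
  free_pi ((x, b) :: w) = eval_letter (@free_gen X) (x, b) * free_pi w.
Proof.
rewrite -[(x, b) :: w]/([:: (x, b)] ++ w) [LHS]free_piM.
by rewrite /eval_letter; case: b => //=; rewrite free_genV.
Qed.

Lemma free_pi_eval (X : choiceType) (w : word X) :
  free_pi w = eval_word (@free_gen X) w.
Proof.
elim: w => [|[x b] w IH]; first by rewrite /eval_word big_nil.
by rewrite free_pi_cons IH /eval_word big_cons.
Qed.

Lemma free_group_gen (X : choiceType) (a : free_group X) :
  gen [set x | exists v, x = free_gen v] a.
Proof.
rewrite -[a]reprK -/(free_pi _); elim: (repr a) => [|[x b] w IH].
  exact: gen_one.
rewrite free_pi_cons; apply: gen_mul => //; case: b; rewrite /eval_letter /=.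
  by apply: gen_in; exists x.
by apply: gen_inv; apply: gen_in; exists x.
Qed.

End GroupGeneralities.

Section RaagGeneralities.
Local Open Scope group_scope.
Variable X : simple_graph.

Definition raag_gen (x : X) : raag X := quot_pi (@raag_relators X) (free_gen x).

Lemma raag_gen_comm x y : edge x y -> commute (raag_gen x) (raag_gen y).
Proof.
move=> xy; apply/commgP/eqP.
rewrite -multfR; apply: quot_pi_rel; by exists x, y.
Qed.

Lemma raag_generated (a : raag X) : gen [set x | exists v, x = raag_gen v] a.
Proof.
have [b ->] := quot_pi_surj a.
elim: (free_group_gen b) => {b} [_ [v ->]||x y _ Ex _ Ey|x _ Ex].
- by apply: gen_in; exists v.
- rewrite multf1; exact: gen_one.
- rewrite gmulfM; exact: gen_mul.
- rewrite multfV; exact: gen_inv.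
Qed.

Lemma raag_ext (H : groupType) (f g : {multiplicative raag X -> H}) :
  (forall x, f (raag_gen x) = g (raag_gen x)) -> f =1 g.
Proof.
by move=> fg a; apply: gen_mult_eq (raag_generated a) => _ [v ->].
Qed.

Lemma raag_lift_ex (H : groupType) (m : X -> H) :
  (forall x y, edge x y -> commute (m x) (m y)) ->
  exists g : {multiplicative raag X -> H}, forall x, g (raag_gen x) = m x.
Proof.
move=> mC; have [f [fE _]] := free_lift m.
have [|g gE] := @quot_lift _ _ (@raag_relators X) f.
  move=> _ [x [y [xy ->]]]; rewrite multfR !fE.
  by apply/eqP/commgP/mC.
by exists g => x; rewrite gE fE.
Qed.

Definition raag_lift (H : groupType) (m : X -> H)
  (mC : forall x y, edge x y -> commute (m x) (m y)) :
  {multiplicative raag X -> H} := projT1 (cid (raag_lift_ex mC)).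

Lemma raag_liftE (H : groupType) (m : X -> H)
  (mC : forall x y, edge x y -> commute (m x) (m y)) x :
  raag_lift mC (raag_gen x) = m x.
Proof. by rewrite /raag_lift; case: cid. Qed.

End RaagGeneralities.

Section FreeProductGeneralities.
Local Open Scope group_scope.
Variables G H : groupType.

Lemma fp_inlM : {morph @fp_inl G H : x y / x * y }.
Proof.
move=> a b; rewrite /fp_inl -gmulfM; apply/esym.
rewrite -[LHS]mulg1 -(mulVg (quot_pi (@free_product_relators G H)
  (free_gen (inl (a * b))))) mulgA -[RHS]mul1g; congr (_ * _).
by rewrite -multfV -gmulfM; apply: quot_pi_rel; left; exists a, b.
Qed.

Lemma fp_inrM : {morph @fp_inr G H : x y / x * y }.
Proof.
move=> a b; rewrite /fp_inr -gmulfM; apply/esym.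
rewrite -[LHS]mulg1 -(mulVg (quot_pi (@free_product_relators G H)
  (free_gen (inr (a * b))))) mulgA -[RHS]mul1g; congr (_ * _).
by rewrite -multfV -gmulfM; apply: quot_pi_rel; right; exists a, b.
Qed.

HB.instance Definition _ :=
  isMultiplicative.Build G (free_product G H) (@fp_inl G H) fp_inlM.
HB.instance Definition _ :=
  isMultiplicative.Build H (free_product G H) (@fp_inr G H) fp_inrM.

Lemma free_product_lift (K : groupType)
    (f : {multiplicative G -> K}) (g : {multiplicative H -> K}) :
  exists h : {multiplicative free_product G H -> K},
    (forall a, h (fp_inl H a) = f a) /\ (forall b, h (fp_inr G b) = g b).
Proof.
have [k [kE _]] := free_lift (fun x : (G + H)%type =>
  match x with inl a => f a | inr b => g b end).
have [|h hE] := @quot_lift _ _ (@free_product_relators G H) k.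
  by move=> s [[a [b ->]]|[a [b ->]]];
    rewrite !gmulfM multfV !kE gmulfM mulgV.
by exists h; split=> x; rewrite hE kE.
Qed.

End FreeProductGeneralities.

(** * Reduced words in free groups *)

Section ReducedWords.
Local Open Scope group_scope.
Variable X : choiceType.
Implicit Types (l : X * bool) (w u : word X) (a b : free_group X).

Definition linv l : X * bool := (l.1, ~~ l.2).

Lemma linvK : involutive linv.
Proof. by case=> x b; rewrite /linv /= negbK. Qed.

Definition noncancel l l' := l' != linv l.

Lemma noncancel_sym l l' : noncancel l l' = noncancel l' l.
Proof. by rewrite /noncancel -(inj_eq (inv_inj linvK)) linvK eq_sym. Qed.

Definition reduced w := sorted noncancel w.

Definition push l w :=
  if w is l' :: w' then if l' == linv l then w' else l :: w else [:: l].

Definition reduce w : word X := foldr push [::] w.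

Lemma reduced_push l w : reduced w -> reduced (push l w).
Proof.
case: w => [//|l' w] /=; case: ifP => [_ /path_sorted //|E P].
by rewrite /= /noncancel E.
Qed.

Lemma reduced_reduce w : reduced (reduce w).
Proof. by elim: w => //= l w; exact: reduced_push. Qed.

Lemma reduce_id w : reduced w -> reduce w = w.
Proof.
elim: w => //= l w IH P; rewrite IH; last exact: path_sorted P.
by case: w P {IH} => //= l' w /andP [/negbTE -> _].
Qed.

(** Van der Waerden's argument: pushing a letter permutes the reduced words, the inverse being the
    push of the inverse letter. Hence [reduce] is invariant under [word_eq], and no confluence
    argument is needed. *)
Lemma pushK l w : reduced w -> push (linv l) (push l w) = w.
Proof.
case: w => [|l' w] /=; first by rewrite linvK eqxx.
case: eqP => [->|_] P; last by rewrite /= linvK eqxx.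
case: w P => [|l'' w] //= /andP [].
by rewrite /noncancel linvK => /negbTE ->.
Qed.

Lemma reduce_cat w w' : reduce (w ++ w') = foldr push (reduce w') w.
Proof. by rewrite /reduce foldr_cat. Qed.

Lemma reduce_eq w w' : word_eq w w' -> reduce w = reduce w'.
Proof.
elim=> {w w'} // [w w' w'' _ -> _ -> //|u v x b].
rewrite !reduce_cat; congr foldr; rewrite /= -/(reduce v).
have := @pushK (x, ~~ b) (reduce v) (reduced_reduce v).
by rewrite /linv /= negbK.
Qed.

Lemma word_eq_cons l w w' : word_eq w w' -> word_eq (l :: w) (l :: w').
Proof. by move=> E; apply: (word_eq_cat (word_eq_refl [:: l]) E). Qed.

Lemma word_eq_reduce w : word_eq (reduce w) w.
Proof.
elim: w => [|l w IH] /=; first exact: word_eq_refl.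
apply: word_eq_trans (word_eq_cons l IH).
case: (reduce w) => [|l' w'] /=; first exact: word_eq_refl.
case: eqP => [->|_]; last exact: word_eq_refl.
apply: word_eq_sym; case: l => x b; exact: (word_eq_cancel [::]).
Qed.

Definition norm a : word X := reduce (repr a).

Lemma norm_pi w : norm (free_pi w) = reduce w.
Proof. exact/reduce_eq/free_reprP. Qed.

Lemma normK a : free_pi (norm a) = a.
Proof.
by rewrite -[RHS]reprK; apply/free_piP/word_eq_reduce.
Qed.

Lemma reduced_norm a : reduced (norm a).
Proof. exact: reduced_reduce. Qed.

Definition flen a := size (norm a).

Lemma norm1 : norm 1 = [::].
Proof. by rewrite -[1]/(free_pi [::]) norm_pi. Qed.

Lemma flen_eq0 a : flen a = 0 -> a = 1.
Proof. by rewrite -{2}[a]normK => /eqP/nilP ->. Qed.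

(** For reduced words this is the Gromov product at the root of the Cayley tree: the length shared
    by the paths to the two vertices. *)
Fixpoint lcp (u w : word X) : nat :=
  match u, w with
  | l :: u', l' :: w' => if l == l' then (lcp u' w').+1 else 0
  | _, _ => 0
  end.

Lemma lcp_sym u w : lcp u w = lcp w u.
Proof.
elim: u w => [|l u IH] [|l' w] //=; rewrite eq_sym.
by case: ifP => // _; rewrite IH.
Qed.

Lemma lcp_ultra u v w : minn (lcp u v) (lcp v w) <= lcp u w.
Proof.
elim: u v w => [|l u IH] [|l' v] [|l'' w] //=; rewrite ?minn0 ?min0n //.
case: eqP => [->|_]; rewrite ?min0n //.
case: eqP => _; rewrite ?minn0 //.
by rewrite minnSS ltnS.
Qed.

Lemma reduced_word_inv w : reduced w -> reduced (word_inv w).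
Proof.
rewrite /reduced /word_inv rev_sorted sorted_map.
apply: sub_sorted => l l' /=.
by rewrite noncancel_sym /noncancel -!/(linv _) (inj_eq (inv_inj linvK)).
Qed.

(** Cancellation in the middle removes exactly the common prefix and stops at the first pair of
    different letters. *)
Lemma size_reduce_inv_cat u w : reduced u -> reduced w ->
  size (reduce (word_inv u ++ w)) + 2 * lcp u w = size u + size w.
Proof.
elim: u w => [|l u IH] w Ru Rw.
  by rewrite /word_inv /= reduce_id // muln0 addn0 add0n.
have Ri : reduced (word_inv (l :: u)) by exact: reduced_word_inv.
case: w Rw => [|l' w] Rw; first by rewrite cats0 reduce_id //= size_rev size_map.
have E : word_inv (l :: u) = rcons (word_inv u) (linv l).
  by rewrite /word_inv /= rev_cons.
rewrite /=; case: eqP => [El|/eqP nl].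
  rewrite -El in Rw *.
  have -> : reduce (word_inv (l :: u) ++ l :: w) = reduce (word_inv u ++ w).
    rewrite E; apply: reduce_eq; rewrite cat_rcons.
    case: (l) => x b; have := word_eq_cancel (word_inv u) w x (~~ b).
    by rewrite negbK.
  by have := IH w (path_sorted Ru) (path_sorted Rw); rewrite /=; lia.
rewrite reduce_id ?muln0 ?addn0 ?size_cat ?size_rev ?size_map //.
rewrite /reduced E cat_rcons; rewrite /reduced E in Ri.
move: Ri; case: (word_inv u) => [|a s] /=.
  by rewrite /noncancel linvK eq_sym nl.
by rewrite rcons_path cat_path /= => /andP [-> ->]; rewrite /noncancel linvK eq_sym nl.
Qed.

Lemma flen_dist a b :
  flen (a^-1 * b) + 2 * lcp (norm a) (norm b) = flen a + flen b.
Proof.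
rewrite -(size_reduce_inv_cat (reduced_norm a) (reduced_norm b)).
congr (size _ + _); rewrite -norm_pi; congr norm.
by rewrite free_piM free_piV !normK.
Qed.

(** The four-point condition characteristic of trees. Through [flen_dist] it becomes a statement on
    common prefixes, which follows from four instances of the ultrametric inequality [lcp_ultra]. *)
Lemma flen_dist4 a b c e :
  flen (a^-1 * b) + flen (c^-1 * e) <=
  maxn (flen (a^-1 * c) + flen (b^-1 * e)) (flen (a^-1 * e) + flen (b^-1 * c)).
Proof.
have := (flen_dist a b, flen_dist c e, flen_dist a c, flen_dist b e,
  flen_dist a e, flen_dist b c).
case=> [[[[[]]]]].
set A := norm a; set B := norm b; set C := norm c; set E := norm e.
have := (lcp_ultra A C B, lcp_ultra A E B, lcp_ultra C A E, lcp_ultra C B E).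
case=> [[[]]]; rewrite (lcp_sym C B) (lcp_sym E B) (lcp_sym C A).
lia.
Qed.

End ReducedWords.

(** * Trees *)

Section LengthFunction.
Local Open Scope group_scope.
Variables (G : groupType) (len : G -> nat).
Hypothesis len1 : len 1 = 0.
Hypothesis lenV : forall a, len a^-1 = len a.
Hypothesis len4 : forall a b c e,
  len (a^-1 * b) + len (c^-1 * e) <=
  maxn (len (a^-1 * c) + len (b^-1 * e)) (len (a^-1 * e) + len (b^-1 * c)).

Lemma len_sym a b : len (a^-1 * b) = len (b^-1 * a).
Proof. by rewrite -lenV invgM invgK. Qed.

Lemma len_triangle a b c : len (a^-1 * b) <= len (a^-1 * c) + len (c^-1 * b).
Proof.
have := len4 a b c c; rewrite mulVg len1 addn0.
by rewrite (len_sym b c) maxnn.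
Qed.

Lemma expgV_mul (x : G) i j : i <= j -> (x ^+ i)^-1 * x ^+ j = x ^+ (j - i).
Proof. by move=> ij; rewrite -{1}(subnKC ij) expgnDr mulKg. Qed.

Section Axis.
Variable x : G.
Hypothesis x_gt0 : 0 < len x.
Hypothesis lenxx : len (x * x) = (2 * len x)%N.
Let m := len x.

(** The hypothesis on [x * x] means that the base point lies on the axis of [x]. Two four-point
    inequalities among 1 and the powers [k], [k.+1], [k.+2] then force every further step to count
    in full. *)
Lemma len_expg k : len (x ^+ k) = (k * m)%N.
Proof.
suff: len (x ^+ k) = (k * m)%N /\ len (x ^+ k.+1) = (k.+1 * m)%N by case.
elim: k => [|k [IH1 IH2]]; first by rewrite len1 expg1 mul1n.
split=> //.
have := len4 1 (x ^+ k.+1) (x ^+ k) (x ^+ k.+2).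
have := len4 1 (x ^+ k.+2) (x ^+ k) (x ^+ k.+1).
rewrite !invg1 !mul1g ![len ((x ^+ k.+2)^-1 * _)]len_sym.
rewrite ![len ((x ^+ k.+1)^-1 * x ^+ k)]len_sym.
rewrite !expgV_mul ?leqnSn //; last by apply: leqW.
have -> : k.+1 - k = 1%N by lia.
have -> : k.+2 - k = 2%N by lia.
have -> : k.+2 - k.+1 = 1%N by lia.
rewrite expg1 expg2 lenxx IH1 IH2 -/m !mulSn; move: x_gt0; rewrite -/m.
by set K := (k * m)%N; lia.
Qed.

(** The ray from [g] through the points [g * x ^+ k] may first approach the base point, but for a
    length of at most [len g]; from then on each step adds [m]. *)
Lemma len_mul_expg g k k' : commute x g -> len g < (k * m)%N -> k <= k' ->
  len (g * x ^+ k') = (len (g * x ^+ k) + (k' - k) * m)%N.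
Proof.
move=> xg gk kk'.
have cg j : len (g^-1 * (g * x ^+ j)) = (j * m)%N by rewrite mulKg len_expg.
have gg i j : i <= j -> len ((g * x ^+ i)^-1 * (g * x ^+ j)) = ((j - i) * m)%N.
  by move=> ij; rewrite invgM -mulgA mulKg expgV_mul // len_expg.
have := len_triangle g (g * x ^+ k) 1; rewrite cg invg1 mulg1 lenV mul1g.
have := len4 g (g * x ^+ k') 1 (g * x ^+ k).
have := len4 g (g * x ^+ k) 1 (g * x ^+ k').
rewrite invg1 !mul1g !mulg1 (len_sym (g * x ^+ k') (g * x ^+ k)) !gg // !cg !lenV.
have : (k' * m = k * m + (k' - k) * m)%N by rewrite -mulnDl subnKC.
by move: gk; set p := (k * m)%N; set q := (k' * m)%N; set r := (_ * m)%N; lia.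
Qed.

(** A Busemann function of the axis: [t] is the signed amount by which [g] shifts its far end. The
    equality is required for large [k] only, since near the base point a length is not a signed
    distance. *)
Definition translates g (t : int) := exists K, forall k, K <= k ->
  ((len (g * x ^+ k))%:Z = (k * m)%:Z + t)%R.

Lemma translates_ex g : commute x g -> exists t, translates g t.
Proof.
move=> xg; pose K := (len g).+1.
have gK : len g < (K * m)%N by rewrite /K; nia.
exists ((len (g * x ^+ K))%:Z - (K * m)%:Z)%R; exists K => k Kk.
rewrite (len_mul_expg xg gK Kk).
have : (k * m = K * m + (k - K) * m)%N by rewrite -mulnDl subnKC.
by set p := (k * m)%N; set q := (K * m)%N; set r := (_ * m)%N; lia.
Qed.

Lemma translates_uniq g s t : translates g s -> translates g t -> s = t.
Proof.
case=> K1 H1 [K2 H2]; have := H1 (maxn K1 K2) (leq_maxl _ _).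
by rewrite (H2 (maxn K1 K2) (leq_maxr _ _)); lia.
Qed.

Lemma translates1 : translates 1 0.
Proof. by exists 0 => k _; rewrite mul1g len_expg; lia. Qed.

(** Shifts along the axis add up, by the four-point condition for 1, [y], [y * x ^+ j] and
    [y * z * x ^+ k], with [j] and [k] beyond the thresholds of [y] and [z]. *)
Lemma translatesM y z s t : commute x y -> commute x z ->
  translates y s -> translates z t -> translates (y * z) (s + t)%R.
Proof.
move=> xy xz [K1 H1] [K2 H2]; pose j := (K1 + len y).+1.
exists (j + K2)%N => k jk.
have kE : ((k - j) * m + j * m = k * m)%N by rewrite -mulnDl subnK //; lia.
have E2 : (y * x ^+ j)^-1 * (y * z * x ^+ k) = z * x ^+ (k - j).
  rewrite invgM -!mulgA mulKg -expgV_mul; last by lia.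
  rewrite !mulgA; congr (_ * _).
  exact: esym (commuteV (commuteX j (commute_sym xz))).
have E3 : y^-1 * (y * z * x ^+ k) = z * x ^+ k by rewrite -!mulgA mulKg.
have jm : len y < (j * m)%N by move: x_gt0; rewrite -/m /j; nia.
have := H1 j; have := H2 k; have := H2 (k - j)%N.
have := len4 y (y * z * x ^+ k) 1 (y * x ^+ j).
have := len4 y (y * x ^+ j) 1 (y * z * x ^+ k).
rewrite invg1 !mul1g !mulg1 (len_sym (y * z * x ^+ k)) E2 E3 mulKg len_expg !lenV.
have /[swap] := @len_triangle y (y * x ^+ j) 1.
rewrite invg1 mulg1 mul1g lenV mulKg len_expg.
have -> : (K2 <= k - j) by lia.
have -> : (K2 <= k) by lia.
have -> : (K1 <= j) by rewrite /j; lia.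
move=> T A B /(_ isT) C /(_ isT) D /(_ isT) E; move: T A B C D E jm kE.
set p := ((k - j) * m)%N; set q := (j * m)%N; set r := (k * m)%N.
set a := len _; set b := len _; set c := len _; set d := len _; set e := len _.
lia.
Qed.

(* The centralizer of a hyperbolic isometry of a tree acts on its axis by
   translations, so commutators fix points far out on the axis. *)
Lemma commg_centralizer_elliptic y z : commute x y -> commute x z ->
  exists h, len ([~ y, z] ^ h) = 0.
Proof.
move=> xy xz; set c := [~ y, z].
have xc : commute x c.
  by rewrite /c /commg /conjg; do !apply: commuteM => //; exact: commuteV.
have [s ys] := translates_ex xy; have [t zt] := translates_ex xz.
have [u cu] := translates_ex xc; have [v cv] := translates_ex (commuteV xc).
have xzy : commute x (z * y) by exact: commuteM.
have u0 : u = 0%R.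
  have := translatesM xzy xc (translatesM xz xy zt ys) cu.
  rewrite -commgC => /translates_uniq/(_ (translatesM xy xz ys zt)); lia.
have v0 : v = 0%R.
  have := translatesM xc (commuteV xc) cu cv.
  rewrite mulgV => /translates_uniq/(_ translates1); lia.
case: cu => K1; case: cv => K2; rewrite {}u0 {}v0 => H2 H1.
(* At this [k] neither [c] nor its inverse shifts the far end. Among the points [x ^+ k],
   [c * x ^+ k], 1 and [x ^+ (k + k)] both cross sums therefore equal the distance of the last two,
   so the distance of the first two is zero. *)
pose k := (K1 + K2)%N; exists (x ^+ k).
have -> : c ^ x ^+ k = (x ^+ k)^-1 * (c * x ^+ k) by [].
have := len4 (x ^+ k) (c * x ^+ k) 1 (x ^+ (k + k)).
have -> : (c * x ^+ k)^-1 * x ^+ (k + k) = c^-1 * x ^+ k.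
  have cx : commute (x ^+ k) c^-1.
    exact: commuteV (commute_sym (commuteX k (commute_sym xc))).
  by rewrite invgM (expgnDr x k k) -mulgA [c^-1 * (_ * _)]mulgA -cx -mulgA mulKg.
have -> : (x ^+ k)^-1 * 1 = (x ^+ k)^-1 by rewrite mulg1.
rewrite mulg1 !lenV invg1 mul1g expgV_mul ?leq_addr // addnK !len_expg.
have := H1 k; have := H2 k; rewrite mulnDl leq_addr leq_addl.
move=> /(_ isT) A /(_ isT) B; move: A B; set p := (k * m)%N.
set a := len _; set b := len _; set d := len _; lia.
Qed.

End Axis.
End LengthFunction.

(** * The semidirect product of a group with the free group on its underlying set *)

Section Affine.
Local Open Scope group_scope.
Variable A : groupType.
Implicit Types (a b c : A) (f g : free_group A).

Lemma act_ex b : exists g : {multiplicative free_group A -> free_group A},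
  forall w, g (free_pi w) = free_pi [seq (l.1 ^ b^-1, l.2) | l <- w].
Proof.
have [g [_ gE]] := free_lift (fun x : A => free_gen (x ^ b^-1)).
exists g => w; rewrite gE free_pi_eval /eval_word big_map.
by apply: eq_bigr => -[].
Qed.

Definition act b : {multiplicative free_group A -> free_group A} :=
  projT1 (cid (act_ex b)).

Lemma act_pi b w :
  act b (free_pi w) = free_pi [seq (l.1 ^ b^-1, l.2) | l <- w].
Proof. by rewrite /act; case: cid. Qed.

Lemma act_gen b a : act b (free_gen a) = free_gen (a ^ b^-1).
Proof. exact: act_pi. Qed.

Lemma actM b c f : act (b * c) f = act b (act c f).
Proof.
rewrite -[f]reprK -/(free_pi _) !act_pi -map_comp; congr free_pi.
by apply: eq_map => -[x e] /=; rewrite invgM conjgM.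
Qed.

Lemma act1 f : act 1 f = f.
Proof.
rewrite -[f]reprK -/(free_pi _) act_pi; congr free_pi.
by rewrite -[RHS]map_id; apply: eq_map => -[x e] /=; rewrite invg1 conjg1.
Qed.

Lemma norm_act b f :
  norm (act b f) = [seq (l.1 ^ b^-1, l.2) | l <- norm f].
Proof.
rewrite -{1}[f]normK act_pi norm_pi reduce_id //.
have := reduced_norm f; rewrite /reduced sorted_map; apply: sub_sorted.
move=> [x e] [y e']; rewrite /noncancel /linv /= !xpair_eqE.
by rewrite (inj_eq (@conjg_inj _ _)).
Qed.

Lemma flen_act b f : flen (act b f) = flen f.
Proof. by rewrite /flen norm_act size_map. Qed.

(** [b] acts on the free basis by conjugation. The pairs [(f, b)] act on the Cayley tree of the free
    group by the affine maps sending [w] to [f * act b w], whence the name. *)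
Definition affine : Type := (free_group A * A)%type.
HB.instance Definition _ := Choice.on affine.

Definition affine_mul (u v : affine) : affine := (u.1 * act u.2 v.1, u.2 * v.2).
Definition affine_one : affine := (1, 1).
Definition affine_inv (u : affine) : affine := (act u.2^-1 u.1^-1, u.2^-1).

Fact affine_mulA : associative affine_mul.
Proof. by move=> u v w; rewrite /affine_mul /= gmulfM actM !mulgA. Qed.
Fact affine_mul1 : left_id affine_one affine_mul.
Proof. by case=> f a; rewrite /affine_mul /= act1 !mul1g. Qed.
Fact affine_mulr1 : right_id affine_one affine_mul.
Proof. by case=> f a; rewrite /affine_mul /= multf1 !mulg1. Qed.
Fact affine_mulV : left_inverse affine_one affine_inv affine_mul.
Proof. by case=> f a; rewrite /affine_mul /= -gmulfM !mulVg multf1. Qed.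
Fact affine_mulrV : right_inverse affine_one affine_inv affine_mul.
Proof. by case=> f a; rewrite /affine_mul /= -actM !mulgV act1 mulgV. Qed.

HB.instance Definition _ := isGroup.Build affine
  affine_mulA affine_mul1 affine_mulr1 affine_mulV affine_mulrV.

Lemma affineM1 (u v : affine) : (u * v).1 = u.1 * act u.2 v.1.
Proof. by []. Qed.
Lemma affineM2 (u v : affine) : (u * v).2 = u.2 * v.2.
Proof. by []. Qed.
Lemma affineV1 (u : affine) : u^-1.1 = act u.2^-1 u.1^-1.
Proof. by []. Qed.
Lemma affineV2 (u : affine) : u^-1.2 = u.2^-1.
Proof. by []. Qed.

(** Each free generator is read as the element that names it. This map will be a left inverse of
    [tree_map], and takes the place of a normal form theorem for HNN extensions. *)
Lemma affine_eval_ex : exists g : {multiplicative affine -> A},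
  (forall b, g (1, b) = b) /\ forall a, g (free_gen a, 1) = a.
Proof.
have [e [eE eW]] := free_lift (fun a : A => a).
have eact b f : e (act b f) = e f ^ b^-1.
  rewrite -[f]reprK -/(free_pi _) act_pi !eW /eval_word big_map conjg_prod.
  by apply: eq_bigr => -[x []] _; rewrite /eval_letter /= ?conjVg.
have eM : {morph (fun u : affine => e u.1 * u.2) : u v / u * v}.
  move=> u v; rewrite affineM1 affineM2 gmulfM eact /conjg invgK -!mulgA.
  by rewrite mulKg.
by exists (mk_mult eM); split=> a /=; rewrite ?multf1 ?mul1g ?eE ?mulg1.
Qed.

End Affine.

(** * Parabolic subgroups *)

Section Retractions.
Import mathcomp.boot.finset.
Local Open Scope group_scope.
Variable X : simple_graph.
Implicit Types (S T : {set X}) (a b x y : raag X) (v w : X).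

Lemma retract_comm S v w : edge v w ->
  commute (if v \in S then raag_gen v else 1) (if w \in S then raag_gen w else 1).
Proof.
by move=> vw; do 2![case: ifP => _]; rewrite /commute ?mul1g ?mulg1 // raag_gen_comm.
Qed.

Definition retract S : {multiplicative raag X -> raag X} :=
  raag_lift (@retract_comm S).

Lemma retract_gen S v :
  retract S (raag_gen v) = if v \in S then raag_gen v else 1.
Proof. exact: raag_liftE. Qed.

(* The subgroup generated by the vertices in [S], as the set of fixed points of
   the retraction that kills the other vertices. *)
Definition parabolic S : set (raag X) := [set a | retract S a = a].

Lemma parabolicM S a b : parabolic S a -> parabolic S b -> parabolic S (a * b).
Proof. by rewrite /parabolic /= gmulfM => -> ->. Qed.

Lemma parabolicV S a : parabolic S a -> parabolic S a^-1.
Proof. by rewrite /parabolic /= multfV => ->. Qed.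

Lemma parabolic_gen S v : v \in S -> parabolic S (raag_gen v).
Proof. by rewrite /parabolic /= retract_gen => ->. Qed.

Lemma parabolicT a : parabolic [set: X] a.
Proof.
by apply: (@raag_ext _ _ (retract [set: X]) idfun) => v; rewrite retract_gen inE.
Qed.

Lemma retractI S T a : retract S (retract T a) = retract (S :&: T) a.
Proof.
apply: (@raag_ext _ _ (retract S \o retract T)) => v /=.
rewrite !retract_gen inE; case: ifP; rewrite ?retract_gen ?andbT ?andbF //.
by rewrite multf1.
Qed.

Lemma retractP S a : parabolic S (retract S a).
Proof. by rewrite /parabolic /= retractI setIid. Qed.

Lemma parabolicI S T a : parabolic S a -> parabolic T a -> parabolic (S :&: T) a.
Proof. by rewrite /parabolic /= -retractI => Sa ->. Qed.

Lemma parabolicS S T a : S \subset T -> parabolic S a -> parabolic T a.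
Proof.
by move=> /setIidPr ST; rewrite /parabolic /= => Sa; rewrite -Sa retractI ST.
Qed.

Lemma retract_parabolic S T a : parabolic T a -> parabolic (S :&: T) (retract S a).
Proof. by move=> Ta; rewrite /parabolic /= retractI setIAC setIid -retractI Ta. Qed.

(** Retractions compose by intersecting their vertex sets. Hence vertices can be excluded one at a
    time, each by means of its own tree. *)
Lemma parabolic_bigcap S a : (forall v, v \notin S -> parabolic [set~ v] a) ->
  parabolic S a.
Proof.
move=> H; have -> : S = \bigcap_(v | v \notin S) [set~ v].
  apply/setP => u; apply/idP/bigcapP => [uS v vS|/(_ u)].
    by rewrite !inE; apply: contraNneq vS => <-.
  by rewrite !inE eqxx; case: (u \in S) => //= /(_ isT).
apply: (big_ind (fun T => parabolic T a)) => //; first exact: parabolicT.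
by move=> *; exact: parabolicI.
Qed.

Lemma parabolic_ind S (P : raag X -> Prop) : P 1 ->
  (forall a b, P a -> P b -> P (a * b)) -> (forall a, P a -> P a^-1) ->
  (forall v, v \in S -> P (raag_gen v)) -> forall a, parabolic S a -> P a.
Proof.
move=> P1 PM PV Pg a; rewrite /parabolic /= => <-.
elim: (raag_generated a) => {a} [_ [v ->]||x y _ Px _ Py|x _ Px].
- by rewrite retract_gen; case: ifP => // /Pg.
- by rewrite multf1.
- by rewrite gmulfM; exact: PM.
- by rewrite multfV; exact: PV.
Qed.

Lemma parabolic0 a : parabolic set0 a -> a = 1.
Proof.
move=> Sa; elim/parabolic_ind: a / Sa => [|a b -> ->|a ->|v] //.
- by rewrite mulg1.
- by rewrite invg1.
- by rewrite inE.
Qed.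

Lemma parabolic_commute S a b : parabolic S a ->
  (forall v, v \in S -> commute b (raag_gen v)) -> commute b a.
Proof.
move=> Sa bS; elim/parabolic_ind: a / Sa => [|a c|a|v] //.
- exact: commute1.
- exact: commuteM.
- exact: commuteV.
- exact: bS.
Qed.

Definition link v : {set X} := [set w | edge v w]%SET.
Definition star v : {set X} := (v |: link v)%SET.

End Retractions.

Section ReducedWordsMore.
Local Open Scope group_scope.
Variable X : choiceType.
Implicit Types (w : word X) (f : free_group X).

Lemma free_pi_cat w w' : free_pi (w ++ w') = free_pi w * free_pi w'.
Proof. exact: free_piM. Qed.

Lemma size_reduce w : size (reduce w) <= size w.
Proof.
elim: w => //= l w IH; apply: leq_trans (_ : (size (reduce w)).+1 <= _) => //.
by case: (reduce w) => //= l' w'; case: ifP => //= _; exact: leqW.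
Qed.

Lemma mem_reduce w : {subset reduce w <= w}.
Proof.
elim: w => //= l w IH l'.
have : {subset push l (reduce w) <= l :: reduce w}.
  case: (reduce w) => //= l1 w' x; case: ifP => // _ xw.
  by rewrite !inE xw !orbT.
by move=> H /H; rewrite !inE => /orP [->//|/IH ->]; rewrite orbT.
Qed.

Lemma normV f : norm f^-1 = word_inv (norm f).
Proof.
rewrite -[in LHS](normK f) -[(free_pi _)^-1]/(free_inv _) -free_piV norm_pi.
exact/reduce_id/reduced_word_inv/reduced_norm.
Qed.

Lemma flenV f : flen f^-1 = flen f.
Proof. by rewrite /flen normV size_rev size_map. Qed.

Definition letters_in (P : X * bool -> Prop) f : Prop :=
  forall l, l \in norm f -> P l.

Lemma letters_in_pi (P : X * bool -> Prop) w :
  (forall l, l \in w -> P l) -> letters_in P (free_pi w).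
Proof. by move=> H l; rewrite norm_pi => /mem_reduce/H. Qed.

Lemma letters_inM (P : X * bool -> Prop) f g :
  letters_in P f -> letters_in P g -> letters_in P (f * g).
Proof.
move=> Pf Pg; rewrite -[f]normK -[g]normK -free_pi_cat.
by apply: letters_in_pi => l; rewrite mem_cat => /orP [/Pf|/Pg].
Qed.

End ReducedWordsMore.

(** * The action on the tree of a vertex *)

Section Tree.
Import mathcomp.boot.finset.
Local Open Scope group_scope.
Variables (X : simple_graph) (v : X).
Implicit Types (a b g x y : raag X) (u : X).

Let tree_gen u : affine (raag X) :=
  if u == v then (free_gen (raag_gen v), 1) else (1, raag_gen u).

Fact tree_gen_comm u w : edge u w -> commute (tree_gen u) (tree_gen w).
Proof.
rewrite /tree_gen => uw; case: eqP => [Eu|_]; case: eqP => [Ew|_].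
- by rewrite Eu Ew edge_irrefl in uw.
- rewrite Eu in uw; congr pair => /=; last by rewrite mulg1 mul1g.
  rewrite act1 act_gen mulg1 mul1g; congr free_gen.
  apply/esym/conjg_fixP/commgP/commuteV.
  exact: raag_gen_comm.
- rewrite Ew in uw; congr pair => /=; last by rewrite mulg1 mul1g.
  rewrite act1 act_gen mulg1 mul1g; congr free_gen.
  apply/conjg_fixP/commgP/commuteV.
  by apply: raag_gen_comm; rewrite edge_sym.
- congr pair => /=; first by rewrite !multf1.
  exact: raag_gen_comm.
Qed.

(* A(X) acts on the Cayley tree of a free group through [tree_map]; the
   stabilizer of the root is the parabolic subgroup of the vertices other than
   [v] (this is the Bass-Serre tree of the HNN extension with stable letter
   [v]). *)
Definition tree_map : {multiplicative raag X -> affine (raag X)} :=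
  raag_lift tree_gen_comm.

Definition cocycle a : free_group (raag X) := (tree_map a).1.

Definition tlen a := flen (cocycle a).

Local Notation rho := (retract [set~ v]).

Lemma tree_map_genv : tree_map (raag_gen v) = (free_gen (raag_gen v), 1).
Proof. by rewrite raag_liftE /tree_gen eqxx. Qed.

Lemma tree_map2 a : (tree_map a).2 = rho a.
Proof.
have sM : {morph (fun u : affine (raag X) => u.2) : u w / u * w} by [].
apply: (@raag_ext _ _ (mk_mult sM \o tree_map) rho) => u /=.
rewrite raag_liftE retract_gen /tree_gen !inE.
by case: eqP.
Qed.

Lemma cocycleM a b : cocycle (a * b) = cocycle a * act (rho a) (cocycle b).
Proof. by rewrite /cocycle gmulfM affineM1 tree_map2. Qed.

Lemma cocycle1 : cocycle 1 = 1.
Proof. by rewrite /cocycle multf1. Qed.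

Lemma cocycleV a : cocycle a^-1 = act (rho a)^-1 (cocycle a)^-1.
Proof. by rewrite /cocycle multfV affineV1 tree_map2. Qed.

Lemma cocycle_parabolic a : parabolic [set~ v] a -> cocycle a = 1.
Proof.
move=> Sa; elim/parabolic_ind: a / Sa => [|a b Ea Eb|a Ea|u].
- exact: cocycle1.
- by rewrite cocycleM Ea Eb multf1 mulg1.
- by rewrite cocycleV Ea invg1 multf1.
- by rewrite !inE /cocycle raag_liftE /tree_gen => /negbTE ->.
Qed.

Lemma parabolic_cocycle a : cocycle a = 1 -> parabolic [set~ v] a.
Proof.
move=> ca; have [e [eb ea]] := affine_eval_ex (raag X).
have E : e (tree_map a) = a.
  apply: (@raag_ext _ _ (e \o tree_map) idfun) => u /=.
  by rewrite raag_liftE /tree_gen; case: eqP => [->|_]; rewrite ?ea ?eb.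
rewrite /parabolic /= -tree_map2 -[RHS]E.
by rewrite [in RHS](surjective_pairing (tree_map a)) -/(cocycle a) ca eb.
Qed.

Lemma tlen_eq0 a : tlen a = 0 -> parabolic [set~ v] a.
Proof. by move/flen_eq0/parabolic_cocycle. Qed.

Lemma tlen1 : tlen 1 = 0.
Proof. by rewrite /tlen cocycle1 /flen norm1. Qed.

Lemma tlenV a : tlen a^-1 = tlen a.
Proof. by rewrite /tlen cocycleV flen_act flenV. Qed.

Lemma tlen_dist a b : tlen (a^-1 * b) = flen ((cocycle a)^-1 * cocycle b).
Proof.
by rewrite /tlen cocycleM cocycleV multfV -gmulfM flen_act.
Qed.

Lemma tlen4 a b c e :
  tlen (a^-1 * b) + tlen (c^-1 * e) <=
  maxn (tlen (a^-1 * c) + tlen (b^-1 * e)) (tlen (a^-1 * e) + tlen (b^-1 * c)).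
Proof. by rewrite !tlen_dist; exact: flen_dist4. Qed.

(** The free basis is all of [raag X], but cocycles only involve these letters, the conjugates of
    [v] by the stabilizer of the root. *)
Definition tree_letter (l : raag X * bool) : Prop :=
  exists2 g, parabolic [set~ v] g & l.1 = raag_gen v ^ g^-1.

Lemma tree_letter_map l : tree_letter l ->
  tree_map (eval_letter (fun a => a) l) = (free_pi [:: l], 1).
Proof.
case: l => x e [g Sg /= ->].
have Eg : tree_map g = (1, g).
  by rewrite [LHS]surjective_pairing tree_map2 Sg -/(cocycle g) cocycle_parabolic.
have E : tree_map (raag_gen v ^ g^-1) = (free_gen (raag_gen v ^ g^-1), 1).
  rewrite multfJ multfV Eg tree_map_genv /conjg invgK [LHS]surjective_pairing.
  rewrite !(affineM1, affineM2, affineV1, affineV2) /= !mul1g mulgV.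
  by rewrite invg1 !multf1 mulg1 act_gen.
rewrite /eval_letter /=; case: e => //; rewrite multfV E.
rewrite [LHS]surjective_pairing affineV1 affineV2 /= invg1 act1.
by rewrite free_genV.
Qed.

Lemma cocycle_letters a : letters_in tree_letter (cocycle a).
Proof.
elim: (raag_generated a) => {a} [_ [u ->]||x y _ Px _ Py|x _ Px].
- rewrite /cocycle raag_liftE /tree_gen; case: eqP => _ /=.
    apply: letters_in_pi => l; rewrite inE => /eqP ->.
    by exists 1; rewrite ?invg1 ?conjg1 // /parabolic /= multf1.
  by move=> l; rewrite norm1.
- by move=> l; rewrite cocycle1 norm1.
- rewrite cocycleM; apply: letters_inM => // l; rewrite norm_act.
  case/mapP => l' /Py [g Sg E] ->; exists (rho x * g).
    by apply: parabolicM => //; exact: retractP.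
  by rewrite /= E invgM conjgM.
- move=> l; rewrite cocycleV norm_act normV.
  case/mapP => l'; rewrite mem_rev => /mapP [l'' /Px [g Sg E] ->] ->.
  exists ((rho x)^-1 * g).
    by apply: parabolicM => //; apply/parabolicV/retractP.
  by rewrite /= E invgM conjgM.
Qed.

(** If the two copies of [x] cancelled where they meet, conjugating [x] by the first letter of its
    cocycle would remove both the first and the last letter. Minimal length among the conjugates
    thus puts the root on the axis. *)
Lemma tlen_mulxx x : 0 < tlen x -> (forall g, tlen x <= tlen (x ^ g)) ->
  tlen (x * x) = (2 * tlen x)%N.
Proof.
move=> x_gt0 x_min; have := flen_dist (cocycle x)^-1 (act (rho x) (cocycle x)).
rewrite invgK -cocycleM flenV flen_act => E; rewrite [RHS]mul2n -addnn -E /tlen.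
suff -> : lcp (norm (cocycle x)^-1) (norm (act (rho x) (cocycle x))) = 0.
  by rewrite muln0 addn0.
move: x_gt0; rewrite /tlen /flen normV norm_act.
move=> {E}; have := @cocycle_letters x; have := x_min.
rewrite /letters_in /tlen /flen.
have := normK (cocycle x); move: (norm (cocycle x)) => n nE xm nl.
case: n nE xm nl => [//|l0 n] nE xm nl _.
case/lastP: n nE xm nl => [|n l1] nE xm nl.
  by rewrite /= /word_inv /= xpair_eqE; case: l0.2; rewrite andbF.
rewrite -rcons_cons /word_inv map_rcons rev_rcons rcons_cons /=.
case: eqP => // El.
have := xm (eval_letter (fun a => a) l0).
have l0l : tree_letter l0 by apply: nl; rewrite inE eqxx.
suff -> : cocycle (x ^ eval_letter (fun a => a) l0) = free_pi n.
  by rewrite norm_pi /= size_rcons => /leq_trans/(_ (size_reduce n)); rewrite ltnNge leqnSn.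
rewrite /cocycle multfJ tree_letter_map // /conjg.
rewrite affineM1 affineV1 affineV2 affineM1 tree_map2 -/(cocycle x) -nE.
rewrite invg1 !act1 act_pi /= -El -cats1 -[in LHS]/(linv l1).
have -> : (free_pi [:: l0])^-1 = free_pi [:: linv l0].
  by rewrite -[LHS]/(free_inv _) -free_piV.
rewrite -(free_pi_cat (l0 :: n ++ [:: l1])) -(free_pi_cat [:: linv l0]).
apply/free_piP => /=.
rewrite -catA /=; case: (l0) => p e; case: (l1) => p1 e1.
apply: (@word_eq_trans _ _ (n ++ [:: (p1, e1); linv (p1, e1)])).
  by have := word_eq_cancel [::] (n ++ [:: (p1, e1); linv (p1, e1)]) p (~~ e);
    rewrite negbK.
by have := word_eq_cancel n [::] p1 e1; rewrite /= cats0.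
Qed.

(** [b] fixes the root and its image under [y], hence the path between them letter by letter, since
    [act] preserves reduced words. The first letter is a conjugate of [v], and a letter fixed by
    [act b] commutes with [b]. *)
Lemma centralizer_tree b y : parabolic [set~ v] b -> commute b y ->
  ~ parabolic [set~ v] y -> exists g, commute b (raag_gen v ^ g).
Proof.
move=> Sb bY Sy.
have := cocycleM b y; rewrite bY cocycleM (cocycle_parabolic Sb) Sb multf1.
rewrite mul1g mulg1 => /(congr1 (@norm _)); rewrite norm_act.
have : norm (cocycle y) <> [::].
  by move=> E; apply/Sy/tlen_eq0; rewrite /tlen /flen E.
have := @cocycle_letters y; rewrite /letters_in.
case: (norm (cocycle y)) => [_ /(_ erefl) //|[x e] n] H _ /= [E _].
have [g _ /= xE] : tree_letter (x, e) by apply: H; rewrite inE eqxx.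
exists g^-1; rewrite -xE; apply/commgP; rewrite commg1_sym.
apply/commgP/commute_sym; rewrite -[b]invgK.
by apply/commute_sym/commuteV/commgP/conjg_fixP.
Qed.

End Tree.

(** * Centralizers in RAAGs *)

Section Heisenberg.
Local Open Scope ring_scope.
Variable F : comNzRingType.

(* (a, b, c) stands for the upper unitriangular matrix with first row 1, a, c
   and last column c, b, 1. *)
Definition heis : Type := (F * F * F)%type.
HB.instance Definition _ := Choice.on heis.

Definition heis_mul (u v : heis) : heis :=
  (u.1.1 + v.1.1, u.1.2 + v.1.2, u.2 + v.2 + u.1.1 * v.1.2).
Definition heis_one : heis := (0, 0, 0).
Definition heis_inv (u : heis) : heis :=
  (- u.1.1, - u.1.2, - u.2 + u.1.1 * u.1.2).

Fact heis_mulA : associative heis_mul.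
Proof.
by move=> [[a b] c] [[d e] f] [[g h] i]; rewrite /heis_mul /=; congr (_, _, _); ring.
Qed.
Fact heis_mul1 : left_id heis_one heis_mul.
Proof. by move=> [[a b] c]; rewrite /heis_mul /=; congr (_, _, _); ring. Qed.
Fact heis_mulr1 : right_id heis_one heis_mul.
Proof. by move=> [[a b] c]; rewrite /heis_mul /=; congr (_, _, _); ring. Qed.
Fact heis_mulV : left_inverse heis_one heis_inv heis_mul.
Proof. by move=> [[a b] c]; rewrite /heis_mul /=; congr (_, _, _); ring. Qed.
Fact heis_mulrV : right_inverse heis_one heis_inv heis_mul.
Proof. by move=> [[a b] c]; rewrite /heis_mul /=; congr (_, _, _); ring. Qed.

HB.instance Definition _ := isGroup.Build heis
  heis_mulA heis_mul1 heis_mulr1 heis_mulV heis_mulrV.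

Lemma heisM (u v : heis) : (u * v)%g = heis_mul u v. Proof. by []. Qed.
Lemma heisV (u : heis) : (u^-1)%g = heis_inv u. Proof. by []. Qed.

Lemma heis_commute (u v : heis) :
  commute u v <-> u.1.1 * v.1.2 = v.1.1 * u.1.2.
Proof.
case: u v => [[a b] c] [[d e] f]; rewrite /commute !heisM /heis_mul /=.
split=> [[_ _ H]|H]; last by congr (_, _, _); rewrite ?H; ring.
have -> : a * e = c + f + a * e - (c + f) by ring.
by rewrite H; ring.
Qed.

Lemma heis_commg (u v : heis) :
  [~ u, v]%g = (0, 0, u.1.1 * v.1.2 - v.1.1 * u.1.2).
Proof.
case: u v => [[a b] c] [[d e] f].
rewrite /commg /conjg !heisM !heisV /heis_mul /heis_inv /=.
by congr (_, _, _); ring.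
Qed.

Lemma heis_conj1 (u v : heis) : (u ^ v)%g.1 = u.1.
Proof.
case: u v => [[a b] c] [[d e] f].
by rewrite /conjg !heisM !heisV /heis_mul /heis_inv /=; congr (_, _); ring.
Qed.

End Heisenberg.

Section Centralizers.
Import mathcomp.boot.fintype mathcomp.boot.finset.
Local Open Scope group_scope.
Variable X : simple_graph.
Implicit Types (S T : {set X}) (a b g x y z : raag X) (v w : X).

(** If [v] and [w] are distinct and not adjacent, they can be sent to two non-commuting integral
    Heisenberg matrices and all other vertices to the identity. Conjugation does not change the
    coordinates that decide commutation. *)
Lemma raag_gen_conj_commute v w g :
  commute (raag_gen v) (raag_gen w ^ g) -> v = w \/ edge v w.
Proof.
move=> H; case: (eqVneq v w) => [|vw]; [by left|right].
apply: contraPT H => nvw.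
pose m u : heis int := if u == v then (1, 0, 0)%R else if u == w then (0, 1, 0)%R else (0, 0, 0)%R.
have mC u u' : edge u u' -> commute (m u) (m u').
  move=> uu'; apply/heis_commute; rewrite /m.
  case: (eqVneq u v) => [Eu|_]; case: (eqVneq u' v) => [Eu'|_];
    case: (eqVneq u w) => [Ew|_]; case: (eqVneq u' w) => [Ew'|_] //=;
    rewrite ?mulr0 ?mul0r //.
  - by move: nvw; rewrite -Eu -Ew' uu'.
  - by move: nvw; rewrite -Eu -Ew' uu'.
  - by move: nvw; rewrite edge_sym -Eu' -Ew uu'.
  - by move: nvw; rewrite edge_sym -Eu' -Ew uu'.
move=> /(gmulf_commute (raag_lift mC)); rewrite multfJ !raag_liftE.
rewrite /m eqxx eq_sym (negbTE vw) eqxx => /heis_commute.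
by rewrite heis_conj1.
Qed.

Lemma centralizer_gen_star v y : commute (raag_gen v) y -> parabolic (star v) y.
Proof.
move=> vy; apply: parabolic_bigcap => w; rewrite !inE negb_or => /andP [wv nvw].
apply: contrapT => nwy.
have [|g] := @centralizer_tree _ w _ _ _ vy nwy.
  by apply: parabolic_gen; rewrite !inE eq_sym.
by move=> /raag_gen_conj_commute [vw|]; [rewrite vw eqxx in wv|exact/negP].
Qed.

Lemma parabolic_conj S T g x :
  parabolic S x -> parabolic T (x ^ g) -> parabolic (S :&: T) (x ^ retract S g).
Proof.
by move=> Sx /(retract_parabolic S); rewrite multfJ Sx.
Qed.

(** Stands for the support of a cyclically reduced word; minimizing over all conjugates avoids a
    normal form. *)
Definition minimal_support S x : Prop :=
  parabolic S x /\ forall T g, parabolic T (x ^ g) -> #|S| <= #|T|.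

Lemma minimal_support_sub S x T g :
  minimal_support S x -> parabolic T (x ^ g) -> S \subset T.
Proof.
case=> Sx Smin /(parabolic_conj Sx)/Smin cST.
have /eqP <- : S :&: T == S by rewrite eqEcard subsetIl.
exact: subsetIr.
Qed.

Lemma minimal_support_ex S x : parabolic S x ->
  exists T g, [/\ T \subset S, parabolic S g & minimal_support T (x ^ g)].
Proof.
move=> Sx.
pose P n := `[< exists T g, parabolic T (x ^ g) /\ #|T| = n >].
have exP : exists n, P n.
  by exists #|S|; apply/asboolP; exists S, (1 : raag X); rewrite conjg1.
case: (ex_minnP exP) => n /asboolP [T [g [Tx Tn]]] nmin.
exists (S :&: T), (retract S g).
have STx := parabolic_conj Sx Tx; split; [exact: subsetIl|exact: retractP|].
split=> // T' h; rewrite -conjgM => T'x.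
apply: leq_trans (_ : n <= _); first by rewrite -Tn subset_leq_card // subsetIr.
by apply: nmin; apply/asboolP; exists T', (retract S g * h).
Qed.

Lemma minimal_support_star S x v g : minimal_support S x ->
  commute (raag_gen v) (x ^ g) -> S \subset star v.
Proof. by move=> Sx /centralizer_gen_star; exact: minimal_support_sub. Qed.

Definition clink S : {set X} := \bigcap_(v in S) link v.

(** Suppose [y] involves a vertex [v] outside. In the tree of [v], [x] fixes the root and [y] moves
    it, so a conjugate of [x] commutes with [v]. By minimality [S] lies in the star of [v], and [v]
    is in the common link after all. *)
Lemma centralizer_minimal S x y : minimal_support S x -> commute x y ->
  parabolic (S :|: clink S) y.
Proof.
move=> Sx xy; apply: parabolic_bigcap => v; rewrite !inE negb_or => /andP [vS vL].
apply: contrapT => nvy; have [Sx' _] := Sx.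
have [|g xg] := @centralizer_tree _ v _ _ _ xy nvy.
  apply: (parabolicS _ Sx'); apply/subsetP => u uS; rewrite !inE.
  by apply: contraNneq vS => <-.
have /(minimal_support_star Sx) sub : commute (raag_gen v) (x ^ g^-1).
  apply/commute_sym; rewrite -[raag_gen v](conjgK g).
  exact: commuteJ.
case/negP: vL; apply/bigcapP => u uS; rewrite !inE.
have := subsetP sub u uS; rewrite !inE => /orP [/eqP uv|].
  by rewrite -uv uS in vS.
by rewrite edge_sym.
Qed.

Definition is_join S : Prop :=
  exists T, [/\ T \subset S, T != set0, T != S
    & forall u w, u \in T -> w \in S :\: T -> edge u w].

(** For [v] in [S], no conjugate of [x] fixes the root in the tree of [v], so some conjugate of
    [[~ y, z]] does, and its minimal support [T] can be chosen in [S] without [v]. As [x]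
    centralizes the commutator, [S] is contained in the union of [T] and its common link. A nonempty
    [T] would make [S] a join. *)
Lemma centralizer_nonjoin S x y z : minimal_support S x -> S != set0 ->
  ~ is_join S -> parabolic S y -> parabolic S z ->
  commute x y -> commute x z -> commute y z.
Proof.
move=> Sx /set0Pn [v vS] nJ Sy Sz xy xz.
have [Sx' Smin] := Sx.
pose P n := `[< exists g, tlen v (x ^ g) = n >].
have exP : exists n, P n by exists (tlen v (x ^ 1)); apply/asboolP; exists 1.
case: (ex_minnP exP) => m /asboolP [g0 gm] mmin.
have [h kh] : exists h, parabolic [set~ v] ([~ y, z] ^ h).
  have [||||h hk] := @commg_centralizer_elliptic _ (tlen v) (tlen1 v) (tlenV v)
    (tlen4 v) (x ^ g0) _ _ (y ^ g0) (z ^ g0).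
  - rewrite lt0n; apply/eqP => /tlen_eq0/(minimal_support_sub Sx)/subsetP/(_ v vS).
    by rewrite !inE eqxx.
  - apply: tlen_mulxx => [|g].
      rewrite lt0n; apply/eqP => /tlen_eq0/(minimal_support_sub Sx)/subsetP.
      by move=> /(_ v vS); rewrite !inE eqxx.
    rewrite gm; apply: mmin; apply/asboolP; exists (g0 * g).
    by rewrite conjgM.
  - exact: commuteJ.
  - exact: commuteJ.
  by exists (g0 * h); rewrite conjgM conjRg; exact: tlen_eq0.
have Sk : parabolic S [~ y, z].
  by do ![apply: parabolicM|apply: parabolicV].
have [T [g [TS _ Tk]]] := minimal_support_ex (parabolic_conj Sk kh).
have vT : v \notin T.
  by apply/negP => /(subsetP TS); rewrite !inE eqxx andbF.
have TS' : T \subset S by apply: subset_trans TS (subsetIl _ _).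
apply/commgP/eqP; case: (eqVneq T set0) Tk => [->|T0] Tk.
  case: Tk => /parabolic0/eqP; rewrite !conjg_eq1 => /eqP //.
exfalso; apply: nJ; exists T; split=> //.
  by apply: contraNneq vT => ->.
move=> u w uT; rewrite inE => /andP [wT wS].
set h' := (retract S h) in Tk.
have xk : commute x [~ y, z].
  by do !apply: commuteM => //; apply: commuteV.
have kx : commute (([~ y, z] ^ h') ^ g) (x ^ (h' * g)).
  by rewrite conjgM; do 2!apply: commuteJ; exact: commute_sym.
have /(minimal_support_sub Sx)/subsetP/(_ w wS) := centralizer_minimal Tk kx.
rewrite inE (negbTE wT) => /bigcapP/(_ u uT).
by rewrite inE.
Qed.

End Centralizers.

(** * Elements with non-abelian centralizer when there are no triangles or squares *)

Section Classification.
Import mathcomp.boot.fintype mathcomp.boot.finset.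
Local Open Scope group_scope.
Variable X : simple_graph.
Implicit Types (S T : {set X}) (a b g x y z : raag X) (u v w : X).

Lemma parabolic_clique_commute S a b :
  (forall u w, u \in S -> w \in S -> u = w \/ edge u w) ->
  parabolic S a -> parabolic S b -> commute a b.
Proof.
move=> cl Sa Sb; apply: parabolic_commute Sb _ => v vS.
apply/commute_sym; apply: parabolic_commute Sa _ => w wS.
by case: (cl _ _ vS wS) => [->|/raag_gen_comm //]; exact: commute_refl.
Qed.

Lemma parabolic1_commute v a b :
  parabolic [set v] a -> parabolic [set v] b -> commute a b.
Proof.
by apply: parabolic_clique_commute => u w; rewrite !inE => /eqP -> /eqP ->; left.
Qed.

Lemma parabolic_join_commute S T a b :
  (forall u w, u \in S -> w \in T -> edge u w) ->
  parabolic S a -> parabolic T b -> commute a b.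
Proof.
move=> ST Sa Tb; apply: parabolic_commute Tb _ => v vT.
apply/commute_sym; apply: parabolic_commute Sa _ => w wS.
by apply: raag_gen_comm; rewrite edge_sym; exact: ST.
Qed.

Lemma parabolic_joinE S T a : [disjoint S & T] ->
  (forall u w, u \in S -> w \in T -> edge u w) ->
  parabolic (S :|: T) a -> a = retract S a * retract T a.
Proof.
move=> dST ST Sa; elim/parabolic_ind: a / Sa => [|a b Ea Eb|a Ea|v].
- by rewrite !multf1 mulg1.
- rewrite {1}Ea {1}Eb !gmulfM -!mulgA; congr (_ * _); rewrite !mulgA.
  congr (_ * _); apply/esym; apply: (parabolic_join_commute ST); exact: retractP.
- rewrite {1}Ea invgM !multfV; apply/esym/commuteV/commute_sym/commuteV.
  by apply/commute_sym; apply: (parabolic_join_commute ST); exact: retractP.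
- rewrite !retract_gen inE; case: (boolP (v \in S)) => /= [vS _|_ ->].
    by rewrite (disjointFr dST vS) mulg1.
  by rewrite mul1g.
Qed.

Lemma retract_commute S a b : commute a b -> commute (retract S a) (retract S b).
Proof. exact: gmulf_commute. Qed.

Lemma join_commute S T a b : [disjoint S & T] ->
  (forall u w, u \in S -> w \in T -> edge u w) ->
  parabolic (S :|: T) a -> parabolic (S :|: T) b ->
  commute (retract S a) (retract S b) -> commute (retract T a) (retract T b) ->
  commute a b.
Proof.
move=> dST ST Sa Sb cS cT.
rewrite (parabolic_joinE dST ST Sa) (parabolic_joinE dST ST Sb).
have cST c d : commute (retract S c) (retract T d).
  by apply: (parabolic_join_commute ST); exact: retractP.
apply: commuteM; apply: commute_sym; apply: commuteM.
- exact: commute_sym.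
- exact: cST.
- exact/commute_sym/cST.
- exact: commute_sym.
Qed.

Definition independent S : Prop := forall u w, u \in S -> w \in S -> ~~ edge u w.

Lemma independent_sub S T : T \subset S -> independent S -> independent T.
Proof. by move=> /subsetP TS iS u w /TS uS /TS; exact: iS. Qed.

Lemma independent_nonjoin S : independent S -> ~ is_join S.
Proof.
move=> iS [T [TS /set0Pn [u uT] TnS H]].
have [w wS wT] : exists2 w, w \in S & w \notin T.
  by apply/subsetPn; apply: contraNN TnS => ST; rewrite eqEsubset TS.
have /negP := iS u w (subsetP TS u uT) wS; apply.
by apply: H => //; rewrite inE wT.
Qed.

Lemma independent_centralizer S x y z : independent S -> x <> 1 ->
  parabolic S x -> parabolic S y -> parabolic S z ->
  commute x y -> commute x z -> commute y z.
Proof.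
move=> iS x1 Sx Sy Sz xy xz.
have [T [g [TS Sg Tx]]] := minimal_support_ex Sx.
have T0 : T != set0.
  apply/negP => /eqP T0; case: Tx; rewrite T0 => /parabolic0/eqP.
  by rewrite conjg_eq1 => /eqP.
have iT := independent_sub TS iS.
have inT b : parabolic S b -> commute x b -> parabolic T (b ^ g).
  move=> Sb xb; have := centralizer_minimal Tx (commuteJ g xb).
  have Sbg : parabolic S (b ^ g).
    by do ![apply: parabolicM => //|apply: parabolicV => //].
  move=> /(parabolicI Sbg); apply: parabolicS.
  rewrite setIUr subUset subsetIr /=; apply/subsetP => u; rewrite inE => /andP [uS].
  have [t tT] := set0Pn _ T0.
  move=> /bigcapP/(_ t tT); rewrite inE => tu.
  by have := iS t u (subsetP TS t tT) uS; rewrite tu.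
have : commute (y ^ g) (z ^ g).
  apply: (centralizer_nonjoin Tx T0 (independent_nonjoin iT)); try exact: commuteJ.
  - exact: inT.
  - exact: inT.
by move/(commuteJ g^-1); rewrite !conjgK.
Qed.

Definition triangle_free := forall u v w, edge u v -> edge v w -> ~~ @edge X u w.

Definition square_free := forall a b c d : X, a != c -> b != d ->
  edge a b -> edge b c -> edge c d -> ~~ edge d a.

Definition vertex_like x v g : Prop := minimal_support [set v] (x ^ g).

Lemma vertex_like_centralizer x v g : vertex_like x v g ->
  forall y, commute x y <-> parabolic (star v) (y ^ g).
Proof.
move=> xv y; split.
  move=> /(commuteJ g)/(centralizer_minimal xv); apply: parabolicS.
  apply/subsetP => u; rewrite !inE => /orP [->//|/bigcapP/(_ v)].
  by rewrite !inE eqxx => /(_ isT) ->; rewrite orbT.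
move=> vy; suff : commute (x ^ g) (y ^ g).
  by move=> /(commuteJ g^-1); rewrite !conjgK.
apply: parabolic_commute vy _ => w; rewrite !inE => wv; apply/commute_sym.
apply: parabolic_commute (proj1 xv) _ => u; rewrite !inE => /eqP ->.
case/orP: wv => [/eqP ->|]; first exact: commute_refl.
by rewrite edge_sym => /raag_gen_comm.
Qed.

Lemma set_other S v : v \in S -> S != [set v] -> exists2 w, w \in S & w != v.
Proof.
move=> vS; rewrite eqEsubset sub1set vS andbT => /subsetPn [w wS].
by rewrite inE; exists w.
Qed.

(** A conjugate of the centralizer lies in the parabolic of [T] and its common link. If [T] has
    several vertices, three shapes remain: a cone over an independent set, with empty common link;
    or no join, with common link empty or a single vertex. Each makes the centralizer abelian,
    factor by factor. *)
Theorem nonabelian_centralizer x : triangle_free -> square_free -> x <> 1 ->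
  nonabelian (centralizer x) ->
  exists v g, vertex_like x v g /\
    exists u w, [/\ edge v u, edge v w & u != w].
Proof.
move=> tf sf x1 [y [z [xy xz nyz]]].
have [T [g [_ _ Tx]]] := minimal_support_ex (parabolicT x).
have T0 : T != set0.
  apply/negP => /eqP T0; case: Tx; rewrite T0 => /parabolic0/eqP.
  by rewrite conjg_eq1 => /eqP.
have {}nyz : ~ commute (y ^ g) (z ^ g).
  by move=> /(commuteJ g^-1); rewrite !conjgK.
move: xy xz => /commute_sym/(commuteJ g) xy /commute_sym/(commuteJ g) xz.
have Ty := centralizer_minimal Tx xy; have Tz := centralizer_minimal Tx xz.
case/set0Pn: (T0) => v vT; case: (eqVneq T [set v]) => [Tv|nTv].
  exists v, g; rewrite /vertex_like -Tv; split=> //.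
  apply: contrapT => nuw; apply: nyz; apply: (parabolic_clique_commute _ Ty Tz).
  have cv u : u \in T :|: clink T -> u = v \/ edge v u.
    rewrite inE => /orP [|/bigcapP/(_ v vT)]; last by rewrite inE; right.
    by rewrite Tv inE => /eqP; left.
  move=> u w /cv [->|vu] /cv [->|vw]; first by left.
  - by right.
  - by right; rewrite edge_sym.
  - case: (eqVneq u w) => [|uw]; [by left|].
    by case: nuw; exists u, w.
exfalso; apply: nyz; move: (x ^ g) (y ^ g) (z ^ g) Tx xy xz Ty Tz.
move=> {x1 x}x {}y {}z Tx xy xz Ty Tz.
case: (pselect (is_join T)) => [jT|nj].
  (* Two vertices on each side of the join would form a square, so one side is a single vertex. *)
  have [u [uT cone]] : exists u, u \in T /\
      forall w, w \in T -> w != u -> edge u w.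
    case: jT => T1 [T1T /set0Pn [a aT1] T1nT J].
    have [b bT bT1] : exists2 w, w \in T & w \notin T1.
      by apply/subsetPn; apply: contraNN T1nT => ST; rewrite eqEsubset T1T.
    case: (eqVneq T1 [set a]) => [E|nE].
      exists a; rewrite (subsetP T1T a aT1); split=> // w wT wa.
      by apply: J; rewrite // inE wT E inE wa.
    have [c cT1 ca] := set_other aT1 nE.
    exists b; split=> // w wT wb; case: (boolP (w \in T1)) => [wT1|nwT1].
      by rewrite edge_sym; apply: J; rewrite // inE bT1.
    have E1 : edge a b by apply: J; rewrite // inE bT1.
    have E2 : edge b c by rewrite edge_sym; apply: J; rewrite // inE bT1.
    have E3 : edge c w by apply: J; rewrite // inE nwT1.
    have E4 : edge w a by rewrite edge_sym; apply: J; rewrite // inE nwT1.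
    have := sf a b c w; rewrite E1 E2 E3 E4 eq_sym ca eq_sym wb.
    by move=> /(_ isT isT isT isT isT).
  set S := T :\ u; have TE : T = [set u] :|: S by rewrite /S setD1K.
  have dS : [disjoint [set u] & S] by rewrite disjoints1 !inE eqxx.
  have jS p w : p \in [set u] -> w \in S -> edge p w.
    by rewrite !inE => /eqP -> /andP [wu wT]; exact: cone.
  have [w0 w0T w0u] : exists2 w, w \in T & w != u.
    case: (eqVneq T [set u]) => [E|]; last exact: set_other.
    by move: nTv vT; rewrite E !inE => /eqP H /eqP vu; case: H; rewrite vu.
  have w0S : w0 \in S by rewrite !inE w0u.
  have U0 : clink T = set0.
    apply/setP => w; rewrite !inE; apply/negP => /bigcapP wT.
    have := wT u uT; have := wT w0 w0T; rewrite !inE => w0w uw.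
    by have := tf u w0 w (cone _ w0T w0u) w0w; rewrite uw.
  rewrite U0 setU0 in Ty Tz.
  have iS : independent S.
    move=> p q; rewrite !inE => /andP [pu pT] /andP [qu qT].
    apply/negP => pq.
    by have := tf u p q (cone p pT pu) pq; rewrite (cone q qT qu).
  rewrite TE in Ty Tz; apply: (join_commute dS jS Ty Tz).
    by apply: parabolic1_commute; exact: retractP.
  have Sx : parabolic ([set u] :|: S) x by rewrite -TE; case: Tx.
  apply: (@independent_centralizer S (retract S x)) => //;
    try exact: retractP; try exact: retract_commute.
  move=> Sx1; have : parabolic [set u] (x ^ 1).
    rewrite conjg1 (parabolic_joinE dS jS Sx) Sx1 mulg1; exact: retractP.
  move=> /(minimal_support_sub Tx)/subsetP/(_ w0 w0T); rewrite inE.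
  by rewrite (negbTE w0u).
case: (set_0Vmem (clink T)) => [U0|[u uU]].
  rewrite U0 setU0 in Ty Tz.
  exact: (centralizer_nonjoin Tx).
have [w wT wv] := set_other vT nTv.
have uT t : t \in T -> edge u t.
  by move=> tT; have /bigcapP/(_ t tT) := uU; rewrite inE edge_sym.
have UE : clink T = [set u].
  apply/setP => t; rewrite [RHS]inE; apply/idP/idP => [/bigcapP tT|/eqP -> //].
  apply: contraT => tu.
  have vt : edge v t by have := tT v vT; rewrite inE.
  have wt : edge w t by have := tT w wT; rewrite inE.
  have := sf v t w u; rewrite eq_sym wv tu vt (edge_sym t w) wt.
  by rewrite (edge_sym w u) !uT // => /(_ isT isT isT isT isT).
have dU : [disjoint [set u] & T].
  by rewrite disjoints1; apply/negP => /uT; rewrite edge_irrefl.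
have jU p t : p \in [set u] -> t \in T -> edge p t.
  by rewrite inE => /eqP ->; exact: uT.
rewrite UE setUC in Ty Tz; apply: (join_commute dU jU Ty Tz).
  by apply: parabolic1_commute; exact: retractP.
have xT : retract T x = x by case: Tx.
apply: (centralizer_nonjoin Tx) => //; try exact: retractP.
  by rewrite -xT; exact: retract_commute.
by rewrite -xT; exact: retract_commute.
Qed.

End Classification.

(** * Recovering a graph from its parallelism relation *)

Section TwinFreePermutation.
Import mathcomp.boot.fintype mathcomp.boot.finset GRing.Theory.
Local Open Scope ring_scope.
Variables (F : fieldType) (n : nat) (E1 E2 : rel 'I_n) (A : 'M[F]_n).
Hypothesis F2 : (2%:R : F) != 0.
Hypothesis E2_sym : symmetric E2.
Hypothesis E2_irrefl : irreflexive E2.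
Let n1 i := #|[pred k | ~~ E1 i k]|.
Let n2 i := #|[pred k | ~~ E2 i k]|.
Hypothesis n12 : (\sum_i n1 i = \sum_i n2 i)%N.
Hypothesis detA : \det A != 0.
Hypothesis A_le : forall i j, A i j != 0 -> (n1 i <= n2 j)%N.
Hypothesis A_dom : forall i j k l, A i j != 0 -> n1 i = n2 j -> A i k != 0 ->
  l != j -> ~~ E2 j l -> ~~ E2 k l.
Hypothesis A_minor : forall i i' j k, i != i' -> ~~ E1 i i' -> E2 j k ->
  A i j * A i' k = A i k * A i' j.

Let cl j : {set 'I_n} := [set k | (k == j) || E2 j k]%SET.

(** Two indices not adjacent for [E1] whose images are true twins for [E2]. The determinant terms of
    permutations having such a pair cancel under [swap]. *)
Let bad_pair (s : 'S_n) (p : 'I_n * 'I_n) :=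
  [&& p.1 != p.2, ~~ E1 p.1 p.2 & cl (s p.1) == cl (s p.2)].

Let bad (s : 'S_n) := [exists p, bad_pair s p].

Let swap (s : 'S_n) : 'S_n :=
  if [pick p | bad_pair s p] is Some p then (tperm p.1 p.2 * s)%g else s.

Let term (s : 'S_n) := (-1) ^+ s * \prod_i A i (s i).

Lemma cl_swap s i : cl (swap s i) = cl (s i).
Proof.
rewrite /swap; case: pickP => // -[p q] /and3P [/= _ _ /eqP E].
by rewrite permM; case: tpermP => // ->.
Qed.

Lemma bad_pair_swap s : bad_pair (swap s) =1 bad_pair s.
Proof. by move=> p; rewrite /bad_pair !cl_swap. Qed.

(** The chosen pair depends only on the sets [cl (s i)], which the exchange of twins preserves; so
    the second application undoes the first. *)
Lemma swapK : involutive swap.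
Proof.
move=> s; rewrite {1}/swap (eq_pick (bad_pair_swap s)) /swap.
by case: pickP => // p _; rewrite mulgA tperm2 mul1g.
Qed.

Lemma term_swap s : bad s -> term (swap s) = - term s.
Proof.
move=> /existsP [p0 bp0]; rewrite /swap; case: pickP => [[i i'] /and3P [/= ii' nE /eqP E]|]; last first.
  by move=> /(_ p0); rewrite bp0.
rewrite /term odd_permM odd_tperm ii' /= signrN mulNr; congr (- (_ * _)).
have jk : E2 (s i) (s i').
  have : s i' \in cl (s i) by rewrite E !inE eqxx.
  by rewrite !inE (inj_eq perm_inj) eq_sym (negbTE ii').
rewrite (bigD1 i) //= (bigD1 i') 1?eq_sym //= [RHS](bigD1 i) //= [in RHS](bigD1 i') 1?eq_sym //=.
rewrite !permM tpermL tpermR !mulrA (A_minor ii' nE jk); congr (_ * _).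
apply: eq_bigr => k /andP [ki ki']; rewrite permM tpermD //; first by rewrite eq_sym.
by rewrite eq_sym.
Qed.

Lemma good_perm : exists s : 'S_n, ~~ bad s /\ forall i, A i (s i) != 0.
Proof.
have bad_swap s : bad (swap s) = bad s.
  by rewrite /bad; apply: eq_existsb => p; rewrite bad_pair_swap.
have bad0 : \sum_(s | bad s) term s = 0.
  have E : \sum_(s | bad s) term s = - \sum_(s | bad s) term s.
    rewrite {1}(reindex_inj (inv_inj swapK)) /= (eq_bigl _ _ bad_swap).
    by rewrite -sumrN; apply: eq_bigr => s; exact: term_swap.
  apply/eqP; move/eqP: E; rewrite -addr_eq0 -mulr2n -mulr_natl mulf_eq0.
  by rewrite (negbTE F2).
move: detA; rewrite /determinant (bigID bad) /= bad0 add0r => nz.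
have [s bs ts] : exists2 s, ~~ bad s & term s != 0.
  apply: contrapT => H; case/negP: nz; apply/eqP/big1 => s bs.
  by apply/eqP; apply: contrapT => /negP ts; apply: H; exists s.
exists s; split=> // i; apply: contraNneq ts => Ai.
by rewrite /term (bigD1 i) //= Ai mul0r mulr0.
Qed.

(** The inequalities [A_le] along [s] add up to an equality, so each is an equality and [A_dom]
    applies. If a non-adjacent pair had adjacent images, [A_minor] would make the two off-diagonal
    entries nonzero as well; then [A_dom], used for both rows, would make the images true twins and
    the pair bad. *)
Lemma nonadjacency_perm : exists s : 'S_n,
  forall i i', ~~ E1 i i' -> ~~ E2 (s i) (s i').
Proof.
have [s [bs As]] := good_perm; exists s => i i' nE; apply/negP => jk.
have ns k : n1 k = n2 (s k).
  have le k' : true -> (n1 k' <= n2 (s k') ?= iff (n1 k' == n2 (s k')))%N.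
    by move=> _; split=> //; exact: A_le.
  have := leqif_sum le; rewrite n12 (reindex_inj (@perm_inj _ s)) /= => -[_].
  by rewrite eqxx => /esym/forallP/(_ k)/eqP.
case: (eqVneq i i') => [ii'|ii']; first by rewrite ii' E2_irrefl in jk.
have := A_minor ii' nE jk => Em.
have : A i (s i') * A i' (s i) != 0 by rewrite -Em mulf_neq0.
rewrite mulf_eq0 negb_or => /andP [Aij' Ai'j].
case/existsP: bs; exists (i, i'); rewrite /bad_pair /= ii' nE /=.
have d1 l := A_dom (l := l) (As i) (ns i) Aij'.
have d2 l := A_dom (l := l) (As i') (ns i') Ai'j.
apply/eqP/setP => l; rewrite !inE.
case: (eqVneq l (s i)) => [->|li] /=; first by rewrite E2_sym jk orbT.
case: (eqVneq l (s i')) => [->|li'] /=; first by rewrite jk.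
by apply/idP/idP; apply: contraLR; [exact: d2|exact: d1].
Qed.

End TwinFreePermutation.

(** * Counting the functions parallel to a given one *)

Section ParallelFunctions.
Import mathcomp.boot.fintype mathcomp.boot.finset GRing.Theory.
Local Open Scope ring_scope.
Variables (F : finFieldType) (Z : simple_graph).
Implicit Types (f g : {ffun Z -> F}) (x y z k s : Z).

Definition parallel f g : bool :=
  [forall x, forall y, edge x y ==> (f x * g y == f y * g x)].

Lemma parallelP f g :
  reflect (forall x y, edge x y -> f x * g y = f y * g x) (parallel f g).
Proof.
apply: (iffP forallP) => H x; last first.
  by apply/forallP => y; apply/implyP => /H ->.
by move=> y xy; move/forallP: (H x) => /(_ y); rewrite xy => /eqP.
Qed.

Definition delta x : {ffun Z -> F} := [ffun z => (z == x)%:R].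

Definition conodes x := #|[pred z | ~~ @edge Z x z]|.

Definition vanishing x : {set {ffun Z -> F}} :=
  [set g : {ffun Z -> F} | [forall z, edge x z ==> (g z == 0)]]%SET.

Lemma vanishingP x g :
  reflect (forall z, edge x z -> g z = 0) (g \in vanishing x).
Proof.
rewrite inE; apply: (iffP forallP) => H z; last by apply/implyP => /H ->.
by move=> xz; have := H z; rewrite xz => /eqP.
Qed.

Lemma card_vanishing x : #|vanishing x| = (#|F| ^ conodes x)%N.
Proof.
rewrite -(card_pffun_on (0 : F) [pred z | ~~ edge x z] F).
apply: eq_card => g; apply/vanishingP/pffun_onP => [H|[H _] z xz].
  split=> [|//]; apply/subsetP => z; rewrite !inE.
  by apply: contra => /H ->.
by apply/eqP; apply: contraTT xz => gz; have := subsetP H z; rewrite !inE; apply.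
Qed.

Definition parallels f : {set {ffun Z -> F}} := [set g | parallel f g]%SET.

Lemma parallels_delta x : parallels (delta x) = vanishing x.
Proof.
apply/setP => g; rewrite [LHS]inE; apply/parallelP/vanishingP => [H z xz|H y z].
  have := H x z xz; rewrite !ffunE eqxx mul1r => ->.
  by case: eqP xz => [->|]; rewrite ?edge_irrefl // mul0r.
rewrite !ffunE => yz; case: (eqVneq y x) => [E|_]; case: (eqVneq z x) => [E'|_].
- by rewrite E E' edge_irrefl in yz.
- by rewrite mul0r mul1r H // -E.
- by rewrite mul0r mul1r H // -E' edge_sym.
- by rewrite !mul0r.
Qed.

Definition cut y g : {ffun Z -> F} := [ffun z => if edge y z then 0 else g z].

(** At a neighbour [z] of [y] the relation [f y * g z = f z * g y] recovers the erased value [g z]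
    from [g y]. *)
Lemma cut_inj f y : f y != 0 -> {in parallels f &, injective (cut y)}.
Proof.
move=> fy g h; rewrite !inE => /parallelP fg /parallelP fh /ffunP E.
have gh z : ~~ edge y z -> g z = h z.
  by move=> yz; have := E z; rewrite !ffunE (negbTE yz).
apply/ffunP => z; case: (boolP (edge y z)) => [yz|/gh //].
apply: (mulfI fy); rewrite fg // fh // gh // edge_irrefl //.
Qed.

Lemma cut_vanishing f y : cut y @: parallels f \subset vanishing y.
Proof.
apply/subsetP => _ /imsetP [g _ ->]; apply/vanishingP => z yz.
by rewrite ffunE yz.
Qed.

Lemma card_parallels f y : f y != 0 -> (#|parallels f| <= #|vanishing y|)%N.
Proof.
move=> fy; rewrite -(card_in_imset (cut_inj fy)).
exact/subset_leq_card/cut_vanishing.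
Qed.

(** Equal cardinals make [cut y] onto, so the function [delta k] is the cut of some [g] parallel to
    [f]. This [g] is itself concentrated at [k], and an edge between [s] and [k] would then give
    [f s = 0]. *)
Lemma parallels_dominates f y s k : f y != 0 -> #|parallels f| = #|vanishing y| ->
  f s != 0 -> k != y -> ~~ edge y k -> ~~ edge s k.
Proof.
move=> fy E fs ky nyk; apply/negP => sk.
have /eqP EI : cut y @: parallels f == vanishing y.
  by rewrite eqEcard cut_vanishing (card_in_imset (cut_inj fy)) E leqnn.
have : delta k \in vanishing y.
  apply/vanishingP => z yz; rewrite ffunE.
  by case: eqP yz => // ->; rewrite (negbTE nyk).
rewrite -EI => /imsetP [g]; rewrite inE => /parallelP fg /ffunP gk.
have g0 z : z != k -> g z = 0.
  move=> zk; have := gk z; rewrite !ffunE (negbTE zk).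
  case: ifP => // yz _; apply: (mulfI fy); rewrite fg //.
  have := gk y; rewrite !ffunE edge_irrefl eq_sym (negbTE ky) => <-.
  by rewrite !mulr0.
have gk1 : g k = 1 by have := gk k; rewrite !ffunE eqxx (negbTE nyk).
have := fg s k sk; rewrite gk1 mulr1 g0 ?mulr0; first by move/eqP: fs.
by apply: contraTneq sk => ->; rewrite edge_irrefl.
Qed.

End ParallelFunctions.

Section ParallelIsomorphism.
Import mathcomp.boot.fintype mathcomp.boot.finset GRing.Theory.
Local Open Scope ring_scope.
Variable F : finFieldType.
Implicit Types X Y : simple_graph.

Definition flinear X Y (phi : {ffun X -> F} -> {ffun Y -> F}) : Prop :=
  forall a (f g : {ffun X -> F}), phi [ffun x => a * f x + g x] =
                [ffun y => a * phi f y + phi g y].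

Lemma flinear_delta X Y (phi : {ffun X -> F} -> {ffun Y -> F}) :
  flinear phi -> forall f y, phi f y = \sum_x f x * phi (delta F x) y.
Proof.
move=> lin f y.
have phi0 : phi [ffun => 0] = [ffun => 0].
  have := lin (-1) [ffun => 0] [ffun => 0].
  have -> : [ffun x => -1 * [ffun => 0] x + [ffun => 0] x] = [ffun => 0] :> {ffun X -> F}.
    by apply/ffunP => x; rewrite !ffunE mulr0 addr0.
  by move=> E; apply/ffunP => z; rewrite E !ffunE mulN1r addNr.
have H (r : seq X) : phi [ffun z => \sum_(x <- r) f x * delta F x z] y =
    \sum_(x <- r) f x * phi (delta F x) y.
  elim: r => [|x r IH].
    rewrite big_nil -[RHS](ffunE (fun=> 0) y) -phi0; congr (phi _ _).
    by apply/ffunP => z; rewrite !ffunE big_nil.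
  rewrite big_cons -IH.
  have := lin (f x) (delta F x) [ffun z => \sum_(x <- r) f x * delta F x z].
  move=> /ffunP/(_ y); rewrite [RHS]ffunE => <-; congr (phi _ _).
  by apply/ffunP => z; rewrite !ffunE big_cons ffunE.
rewrite -H; congr (phi _ _); apply/ffunP => z; rewrite ffunE (bigD1 z) //= big1.
  by rewrite ffunE eqxx mulr1 addr0.
by move=> x xz; rewrite ffunE eq_sym (negbTE xz) mulr0.
Qed.

Variables (X Y : simple_graph) (phi : {ffun X -> F} -> {ffun Y -> F})
  (psi : {ffun Y -> F} -> {ffun X -> F}).
Hypotheses (phiK : cancel phi psi) (psiK : cancel psi phi).
Hypothesis phi_par : forall f g, parallel f g = parallel (phi f) (phi g).

Lemma card_parallels_iso f : #|parallels (phi f)| = #|parallels f|.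
Proof.
rewrite -(card_imset _ (can_inj phiK)); apply: eq_card => g; rewrite inE.
apply/idP/imsetP => [H|[h]]; last by rewrite inE phi_par => fh ->.
by exists (psi g); rewrite ?psiK // inE phi_par psiK.
Qed.

Lemma card_F_gt1 : (1 < #|F|)%N.
Proof. exact: finalg.card_finNzRing_gt1. Qed.

Lemma conodes_le x y : phi (delta F x) y != 0 -> (conodes x <= conodes y)%N.
Proof.
move=> nz; have := card_parallels nz.
by rewrite card_parallels_iso parallels_delta !card_vanishing leq_exp2l // card_F_gt1.
Qed.

Lemma card_vertices_iso : #|X| = #|Y|.
Proof.
apply/eqP; rewrite -(eqn_exp2l _ _ card_F_gt1) -!card_ffun.
by apply/eqP/bij_eq_card; exists psi.
Qed.

End ParallelIsomorphism.

Section TransitionMatrix.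
Import mathcomp.boot.fintype mathcomp.boot.finset GRing.Theory.
Local Open Scope ring_scope.
Variables (F : finFieldType) (X Y : simple_graph).
Variables (phi : {ffun X -> F} -> {ffun Y -> F})
  (psi : {ffun Y -> F} -> {ffun X -> F}).
Hypotheses (phi_lin : flinear phi) (psi_lin : flinear psi).
Hypotheses (phiK : cancel phi psi) (psiK : cancel psi phi).
Hypothesis phi_par : forall f g, parallel f g = parallel (phi f) (phi g).

Definition cardXY := card_vertices_iso phiK psiK.
Definition vX (i : 'I_#|X|) : X := enum_val i.
Definition vY (i : 'I_#|X|) : Y := enum_val (cast_ord cardXY i).

Lemma vX_bij : bijective vX.
Proof. by exists enum_rank => x; rewrite /vX ?enum_valK ?enum_rankK. Qed.

Lemma vY_bij : bijective vY.
Proof.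
exists (fun y => cast_ord (esym cardXY) (enum_rank y)) => y.
  by rewrite /vY enum_valK cast_ordK.
by rewrite /vY cast_ordKV enum_rankK.
Qed.

Definition transition : 'M[F]_#|X| :=
  \matrix_(i, j) phi (delta F (vX i)) (vY j).

Lemma det_transition : \det transition != 0.
Proof.
pose B : 'M[F]_#|X| := \matrix_(i, j) psi (delta F (vY i)) (vX j).
suff AB : transition *m B = 1%:M.
  have /eqP := congr1 determinant AB; rewrite det_mulmx det1.
  by apply: contraTneq => ->; rewrite mul0r eq_sym oner_eq0.
apply/matrixP => i k; rewrite !mxE.
rewrite (eq_bigr (fun j => phi (delta F (vX i)) (vY j) *
  psi (delta F (vY j)) (vX k))) => [|j _]; last by rewrite !mxE.
have /= <- := reindex _ (onW_bij predT vY_bij) (op := +%R)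
  (F := fun y => phi (delta F (vX i)) y * psi (delta F y) (vX k)).
rewrite -flinear_delta // phiK ffunE (inj_eq (bij_inj vX_bij)) eq_sym.
by [].
Qed.

(** A nonzero term of the determinant is a matching of vertices along which [conodes_le] holds.
    Applied to [phi] and to [psi], this gives the equality of sums required by
    [nonadjacency_perm]. *)
Lemma sum_conodes_le : (\sum_(x : X) conodes x <= \sum_(y : Y) conodes y)%N.
Proof.
have [s sA] : exists s : 'S_#|X|, forall i, transition i (s i) != 0.
  apply: contrapT => H; have /negP := det_transition; apply; apply/eqP.
  apply: big1 => s _; have [i Ai] : exists i, transition i (s i) = 0.
    apply: contrapT => nAi; apply: H; exists s => i; apply/eqP => Ai.
    by apply: nAi; exists i.
  by rewrite (bigD1 i) //= Ai mul0r mulr0.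
rewrite (reindex _ (onW_bij predT vX_bij)) (reindex _ (onW_bij predT vY_bij)) /=.
rewrite [leqRHS](reindex_inj (@perm_inj _ s)) /=.
apply: leq_sum => i _; apply: (conodes_le phiK psiK phi_par).
by have := sA i; rewrite mxE.
Qed.

End TransitionMatrix.

Section Rigidity.
Import mathcomp.boot.fintype mathcomp.boot.finset GRing.Theory.
Local Open Scope ring_scope.
Variable F : finFieldType.
Hypothesis F2 : (2%:R : F) != 0.
Variables (X Y : simple_graph) (phi : {ffun X -> F} -> {ffun Y -> F})
  (psi : {ffun Y -> F} -> {ffun X -> F}).
Hypotheses (phi_lin : flinear phi) (psi_lin : flinear psi).
Hypotheses (phiK : cancel phi psi) (psiK : cancel psi phi).
Hypothesis phi_par : forall f g, parallel f g = parallel (phi f) (phi g).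

Lemma card_conodes_reindex (Z : simple_graph) n (v : 'I_n -> Z) i :
  bijective v -> #|[pred k | ~~ edge (v i) (v k)]| = conodes (v i).
Proof.
move=> vB; rewrite /conodes -(card_image (bij_inj vB)); apply/esym/eq_card => z.
rewrite !inE; apply/idP/imageP => [H|[k]]; last by rewrite inE => H ->.
by have [w _ vK] := vB; exists (w z); rewrite ?inE vK.
Qed.

Lemma parallel_rigidity : exists sigma : X -> Y,
  bijective sigma /\
  forall x x', edge (sigma x) (sigma x') -> edge x x'.
Proof.
have psi_par f g : parallel f g = parallel (psi f) (psi g).
  by rewrite phi_par !psiK.
set u := @vX X; set v := vY phiK psiK.
have uB : bijective u := @vX_bij X.
have vB : bijective v := vY_bij phiK psiK.
have uv : (\sum_x conodes (u x) = \sum_y conodes (v y))%N.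
  have := reindex _ (onW_bij predT uB) (op := addn) (F := @conodes X).
  have := reindex _ (onW_bij predT vB) (op := addn) (F := @conodes Y).
  move=> /= <- <-; apply/eqP; rewrite eqn_leq.
  by rewrite (sum_conodes_le psi_lin phiK psiK) // (sum_conodes_le phi_lin psiK phiK).
have [||||||||s sE] := @nonadjacency_perm F _ (fun i j => edge (u i) (u j))
  (fun i j => edge (v i) (v j)) (transition phiK psiK).
- exact: F2.
- by move=> i j; exact: edge_sym.
- by move=> i; exact: edge_irrefl.
- rewrite (eq_bigr (fun i => conodes (u i))) => [|i _]; last first.
    exact: card_conodes_reindex.
  by rewrite uv; apply: eq_bigr => i _; rewrite card_conodes_reindex.
- exact: det_transition.
- move=> i j; rewrite mxE !card_conodes_reindex //.
  exact: (conodes_le phiK psiK phi_par).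
- move=> i j k l; rewrite !mxE !card_conodes_reindex // => nz E nz' lj.
  apply: (parallels_dominates nz _ nz'); last by rewrite (inj_eq (bij_inj vB)).
  by rewrite (card_parallels_iso phiK psiK phi_par) parallels_delta !card_vanishing -E.
- move=> i i' j k ii' nE jk; rewrite !mxE.
  have : parallel (delta F (u i)) (delta F (u i')).
    have H x y : edge x y -> (x == u i)%:R * (y == u i')%:R = 0 :> F.
      case: eqP => [->|_]; last by rewrite mul0r.
      by case: eqP => [->|_]; rewrite ?mulr0 // (negbTE nE).
    apply/parallelP => x y xy; rewrite !ffunE H // [RHS]mulrC.
    by rewrite mulrC H // edge_sym.
  rewrite phi_par => /parallelP; exact.
have [u' uK u'K] := uB.
exists (v \o s \o u'); split.
  apply: bij_comp; first by apply: bij_comp => //; exact: injF_bij perm_inj.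
  by exists u.
move=> x x'; rewrite /= -{2}(u'K x) -{2}(u'K x'); apply: contraTT => /sE.
by [].
Qed.

End Rigidity.

(** * Cohomology of degree 1 and cup products *)

Section Cohomology.
Import GRing.Theory.
Local Open Scope ring_scope.
Variable F : fieldType.
Implicit Types G H K : groupType.

Definition is_hom G (phi : G -> F) : Prop :=
  forall a b, phi (a * b)%g = phi a + phi b.

(* The cup product of [phi] and [psi] is zero: [phi] and [psi] are the
   off-diagonal coordinates of a homomorphism to the Heisenberg group. *)
Definition cup_trivial_by G (phi psi h : G -> F) : Prop :=
  forall a b, h (a * b)%g = h a + h b + phi a * psi b.

Definition cup_trivial G (phi psi : G -> F) : Prop :=
  exists h, cup_trivial_by phi psi h.

(* Degree 1 cohomology and the kernel of the cup product are those of the RAAG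
   on [Z], in the coordinates given by the elements [pi z]. *)
Definition coh G (Z : simple_graph) (pi : Z -> G) : Prop :=
  [/\ forall f : Z -> F, exists2 phi, is_hom phi & forall z, phi (pi z) = f z,
      forall phi, is_hom phi -> (forall z, phi (pi z) = 0) -> forall a, phi a = 0
    & forall phi psi, is_hom phi -> is_hom psi ->
        cup_trivial phi psi <->
        forall u v, edge u v -> phi (pi u) * psi (pi v) = phi (pi v) * psi (pi u)].

Section HomFacts.
Variables (G : groupType) (phi : G -> F).
Hypothesis hom : is_hom phi.

Lemma hom1 : phi 1%g = 0.
Proof. by apply: (addrI (phi 1%g)); rewrite -hom mulg1 addr0. Qed.

Lemma homV a : phi a^-1%g = - phi a.
Proof. by apply: (addrI (phi a)); rewrite -hom mulgV hom1 addrN. Qed.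

Lemma homJ a b : phi (a ^ b)%g = phi a.
Proof. by rewrite !hom homV addrC addrK. Qed.

Lemma homR a b : phi [~ a, b]%g = 0.
Proof. by rewrite hom homV homJ addNr. Qed.

Lemma hom_gen0 (S : set G) :
  (forall x, S x -> phi x = 0) -> forall x, gen S x -> phi x = 0.
Proof.
move=> S0 x; elim=> {x} [x /S0 //||x y _ Ex _ Ey|x _ Ex].
- exact: hom1.
- by rewrite hom Ex Ey addr0.
- by rewrite homV Ex oppr0.
Qed.

Lemma hom_comp H (f : {multiplicative H -> G}) : is_hom (phi \o f).
Proof. by move=> a b; rewrite /= gmulfM hom. Qed.

End HomFacts.

Lemma hom_lin G (phi psi : G -> F) (c : F) :
  is_hom phi -> is_hom psi -> is_hom (fun a => c * phi a + psi a).
Proof. by move=> hphi hpsi a b; rewrite hphi hpsi; ring. Qed.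

Lemma hom_sub G (phi psi : G -> F) :
  is_hom phi -> is_hom psi -> is_hom (fun a => phi a - psi a).
Proof. by move=> hphi hpsi a b; rewrite hphi hpsi; ring. Qed.

Lemma heis_of_cup G (phi psi h : G -> F) : is_hom phi -> is_hom psi ->
  cup_trivial_by phi psi h ->
  exists g : {multiplicative G -> heis F}, forall a, g a = (phi a, psi a, h a).
Proof.
move=> hphi hpsi hh.
have gM : {morph (fun a => (phi a, psi a, h a) : heis F) : x y / (x * y)%g}.
  by move=> a b; rewrite heisM /heis_mul /= hphi hpsi hh.
by exists (mk_mult gM).
Qed.

Lemma heis_hom1 G (g : {multiplicative G -> heis F}) : is_hom (fun a => (g a).1.1).
Proof. by move=> a b; rewrite gmulfM heisM. Qed.

Lemma heis_hom2 G (g : {multiplicative G -> heis F}) : is_hom (fun a => (g a).1.2).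
Proof. by move=> a b; rewrite gmulfM heisM. Qed.

Lemma heis_cup G (g : {multiplicative G -> heis F}) :
  cup_trivial_by (fun a => (g a).1.1) (fun a => (g a).1.2) (fun a => (g a).2).
Proof. by move=> a b; rewrite gmulfM heisM. Qed.

Lemma is_hom0 G : is_hom (fun _ : G => 0).
Proof. by move=> a b; ring. Qed.

Lemma heis_of_hom G (phi : G -> F) : is_hom phi ->
  exists g : {multiplicative G -> heis F}, forall a, g a = (phi a, 0, 0).
Proof.
by move=> hphi; apply: (heis_of_cup hphi (@is_hom0 G)) => a b; ring.
Qed.

(** The obstruction used throughout: a commuting pair with nonzero determinant excludes a Heisenberg
    lift. *)
Lemma cup_commute G (phi psi : G -> F) a b : is_hom phi -> is_hom psi ->
  cup_trivial phi psi -> commute a b -> phi a * psi b = phi b * psi a.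
Proof.
move=> hphi hpsi [h hh] /(congr1 h); rewrite !hh [h b + h a]addrC.
by move/addrI.
Qed.

Lemma raag_hom_ex (X : simple_graph) (f : X -> F) :
  exists2 phi : raag X -> F, is_hom phi & forall x, phi (raag_gen x) = f x.
Proof.
have mC x y : edge x y -> commute ((f x, 0, 0) : heis F) (f y, 0, 0).
  by move=> _; apply/heis_commute; rewrite /= !mulr0.
exists (fun a => (raag_lift mC a).1.1); first exact: heis_hom1.
by move=> x; rewrite raag_liftE.
Qed.

Lemma raag_hom0 (X : simple_graph) (phi : raag X -> F) : is_hom phi ->
  (forall x, phi (raag_gen x) = 0) -> forall a, phi a = 0.
Proof.
move=> hphi H a; apply: (hom_gen0 hphi _ (raag_generated a)).
by move=> _ [x ->].
Qed.

Lemma raag_hom_eq (X : simple_graph) (phi psi : raag X -> F) :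
  is_hom phi -> is_hom psi ->
  (forall x, phi (raag_gen x) = psi (raag_gen x)) -> forall a, phi a = psi a.
Proof.
move=> hphi hpsi H a; apply/eqP; rewrite -subr_eq0; apply/eqP.
apply: (raag_hom0 (hom_sub hphi hpsi)) => x; by rewrite H subrr.
Qed.

Lemma cup_trivial_ext G (phi psi phi' psi' : G -> F) :
  phi =1 phi' -> psi =1 psi' -> cup_trivial phi psi -> cup_trivial phi' psi'.
Proof. by move=> E E' [h H]; exists h => a b; rewrite H E E'. Qed.

Lemma coh_raag (X : simple_graph) : coh (@raag_gen X).
Proof.
split=> [f|phi hphi H|phi psi hphi hpsi]; first exact: raag_hom_ex.
  exact: raag_hom0.
split=> [cup u v /raag_gen_comm uv|H]; first exact: cup_commute.
have mC x y : edge x y -> commute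
    ((phi (raag_gen x), psi (raag_gen x), 0) : heis F)
    (phi (raag_gen y), psi (raag_gen y), 0).
  by move=> /H xy; apply/heis_commute; rewrite /= xy.
have := heis_cup (raag_lift mC) => cup.
apply: (@cup_trivial_ext _ _ _ _ _ _ _ (ex_intro _ _ cup)).
  apply: raag_hom_eq => //; first exact: heis_hom1.
  by move=> x; rewrite raag_liftE.
apply: raag_hom_eq => //; first exact: heis_hom2.
by move=> x; rewrite raag_liftE.
Qed.

Lemma cup_trivial_comp G H (f : {multiplicative G -> H}) (phi psi : H -> F) :
  cup_trivial phi psi -> cup_trivial (phi \o f) (psi \o f).
Proof. by move=> [h hh]; exists (h \o f) => a b; rewrite /= gmulfM hh. Qed.

Lemma mult_inverse G H (f : {multiplicative G -> H}) : bijective f ->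
  exists g : {multiplicative H -> G}, cancel f g /\ cancel g f.
Proof.
case=> g fK gK; have gM := can2_gmulfM fK gK.
by exists (mk_mult gM).
Qed.

Lemma coh_iso G H (f : {multiplicative G -> H}) (Z : simple_graph) (pi : Z -> G) :
  bijective f -> coh pi -> coh (f \o pi).
Proof.
move=> /mult_inverse [g [fK gK]] [c1 c2 c3]; split.
- move=> m; have [phi hphi phiE] := c1 m; exists (phi \o g).
    exact: hom_comp.
  by move=> z; rewrite /= fK.
- move=> phi hphi H0 a; rewrite -[a]gK.
  exact: (c2 (phi \o f) (hom_comp hphi f)).
- move=> phi psi hphi hpsi.
  rewrite -(c3 (phi \o f) (psi \o f)); try exact: hom_comp.
  split; first exact: cup_trivial_comp.
  move=> /(cup_trivial_comp g) cup; apply: (cup_trivial_ext _ _ cup) => a /=.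
    by rewrite gK.
  by rewrite gK.
Qed.

(* A homomorphism lifting the cup product can be corrected by any class, hence
   made to vanish on a relator at which the classes agree with a central one. *)
Lemma cup_trivial_correct G (phi psi h chi : G -> F) :
  is_hom chi -> cup_trivial_by phi psi h ->
  cup_trivial_by phi psi (fun a => h a + chi a).
Proof. by move=> hchi hh a b; rewrite hh hchi; ring. Qed.

End Cohomology.

Section CohomologyRigidity.
Import GRing.Theory.
Local Open Scope ring_scope.
Variable F : finFieldType.
Hypothesis F2 : (2%:R : F) != 0.

(** A class has coordinates with respect to either family of elements. The change of coordinates is
    linear and bijective, and zero cup product reads as parallelism on both sides. *)
Theorem coh_rigidity (G : groupType) (Z Z' : simple_graph)
    (pi : Z -> G) (pi' : Z' -> G) : coh F pi -> coh F pi' ->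
  exists sigma : Z -> Z', bijective sigma /\
    forall x x', edge (sigma x) (sigma x') -> edge x x'.
Proof.
have ext (T : simple_graph) (p : T -> G) : coh F p -> exists e : {ffun T -> F} -> G -> F,
    forall f, is_hom (e f) /\ forall z, e f (p z) = f z.
  move=> [c1 _ _]; exists (fun f => projT1 (cid2 (c1 f))) => f.
  by case: cid2.
move=> c c'; have [e eP] := ext _ _ c; have [e' eP'] := ext _ _ c'.
have uni (T : simple_graph) (p : T -> G) : coh F p -> forall phi psi : G -> F,
    is_hom phi -> is_hom psi -> (forall z, phi (p z) = psi (p z)) -> phi =1 psi.
  move=> [_ c2 _] phi psi hphi hpsi E a; apply/eqP; rewrite -subr_eq0; apply/eqP.
  by apply: (c2 _ (hom_sub hphi hpsi)) => z; rewrite E subrr.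
pose phi (f : {ffun Z -> F}) : {ffun Z' -> F} := [ffun z => e f (pi' z)].
pose psi (f : {ffun Z' -> F}) : {ffun Z -> F} := [ffun z => e' f (pi z)].
have phiE f : e' (phi f) =1 e f.
  apply: (uni _ _ c'); [exact: (eP' _).1|exact: (eP _).1|move=> z].
  by rewrite (eP' _).2 ffunE.
have psiE f : e (psi f) =1 e' f.
  apply: (uni _ _ c); [exact: (eP _).1|exact: (eP' _).1|move=> z].
  by rewrite (eP _).2 ffunE.
apply: (@parallel_rigidity F F2 _ _ phi psi).
- move=> a f g; apply/ffunP => z; rewrite !ffunE.
  have H : is_hom (fun x => a * e f x + e g x) by exact: hom_lin (eP f).1 (eP g).1.
  apply: (uni _ _ c _ _ (eP _).1 H) => w.
  by rewrite !(eP _).2 ffunE.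
- move=> a f g; apply/ffunP => z; rewrite !ffunE.
  have H : is_hom (fun x => a * e' f x + e' g x) by exact: hom_lin (eP' f).1 (eP' g).1.
  apply: (uni _ _ c' _ _ (eP' _).1 H) => w.
  by rewrite !(eP' _).2 ffunE.
- by move=> f; apply/ffunP => z; rewrite ffunE phiE (eP _).2.
- by move=> f; apply/ffunP => z; rewrite ffunE psiE (eP' _).2.
- move=> f g; case: c => _ _ c3; case: c' => _ _ c3'.
  have := c3 _ _ (eP f).1 (eP g).1; rewrite (c3' _ _ (eP f).1 (eP g).1) => E.
  apply/parallelP/parallelP => H.
    move=> u v uv; rewrite !ffunE; move: u v uv; apply/E => u v /H.
    by rewrite !(eP _).2.
  move=> u v uv; have := (E.1 _ u v uv); rewrite !(eP _).2; apply.
  by move=> u' v' /H; rewrite !ffunE.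
Qed.

End CohomologyRigidity.

(** * Deletion, contraction and edge addition, and the cohomology of the matching quotients *)

Section GraphOperations.
Variable Z : simple_graph.
Implicit Types (x y z : Z).

Definition del_edge z : rel {x : Z | x != z} := fun u v => edge (val u) (val v).

Fact del_edge_sym z : symmetric (@del_edge z).
Proof. by move=> u v; exact: edge_sym. Qed.

Fact del_edge_irrefl z : irreflexive (@del_edge z).
Proof. by move=> u; exact: edge_irrefl. Qed.

Definition del_graph z := SimpleGraph (@del_edge_sym z) (@del_edge_irrefl z).

(* The vertex [z] of the contraction stands for the merged pair [z], [z']. *)
Definition contract_edge z z' : rel {x : Z | x != z'} := fun u v => (u != v) &&
  [|| edge (val u) (val v), (val u == z) && edge z' (val v)
    | (val v == z) && edge z' (val u)].

Fact contract_edge_sym z z' : symmetric (@contract_edge z z').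
Proof.
move=> u v; rewrite /contract_edge eq_sym edge_sym; congr (_ && (_ || _)).
by rewrite orbC.
Qed.

Fact contract_edge_irrefl z z' : irreflexive (@contract_edge z z').
Proof. by move=> u; rewrite /contract_edge eqxx. Qed.

Definition contract_graph z z' :=
  SimpleGraph (@contract_edge_sym z z') (@contract_edge_irrefl z z').

Definition add_edge_rel z z' : rel Z := fun u v =>
  edge u v || (z != z') && ((u == z) && (v == z') || (u == z') && (v == z)).

Fact add_edge_sym z z' : symmetric (add_edge_rel z z').
Proof.
move=> u v; rewrite /add_edge_rel edge_sym; congr (_ || (_ && _)).
by rewrite orbC andbC (andbC (u == z)).
Qed.

Fact add_edge_irrefl z z' : irreflexive (add_edge_rel z z').
Proof.
move=> u; rewrite /add_edge_rel edge_irrefl /=; apply/negP => /andP [zz'].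
by case/orP=> /andP [/eqP E1 /eqP E2]; rewrite -E1 -E2 eqxx in zz'.
Qed.

Definition add_edge z z' := SimpleGraph (@add_edge_sym z z') (@add_edge_irrefl z z').

End GraphOperations.

Section QuotientCohomology.
Import GRing.Theory.
Local Open Scope ring_scope.
Variable F : fieldType.
Variables (G : groupType) (S : set G).

Lemma quot_hom_ex (phi : G -> F) : is_hom phi -> (forall s, S s -> phi s = 0) ->
  exists2 phi' : quotient_group S -> F, is_hom phi' &
    forall a, phi' (quot_pi S a) = phi a.
Proof.
move=> hphi H; have [g gE] := heis_of_hom hphi.
have [|k kE] := @quot_lift _ _ S g; first by move=> s /H E; rewrite gE E.
exists (fun a => (k a).1.1); first exact: heis_hom1.
by move=> a; rewrite kE gE.
Qed.

Lemma quot_hom_comp (phi : quotient_group S -> F) :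
  is_hom phi -> is_hom (phi \o quot_pi S).
Proof. by move=> hphi; apply: hom_comp. Qed.

Lemma quot_hom_eq (phi psi : quotient_group S -> F) :
  (forall a, phi (quot_pi S a) = psi (quot_pi S a)) -> phi =1 psi.
Proof. by move=> E q; have [a ->] := quot_pi_surj q. Qed.

(** A Heisenberg lift maps each relator to the centre, as both classes vanish there. The last
    hypothesis supplies a class with the opposite values on the relators; adding it makes the lift
    factor through the quotient. *)
Lemma quot_cup (phi psi : quotient_group S -> F) : is_hom phi -> is_hom psi ->
  (forall t : G -> F, exists2 chi : G -> F, is_hom chi & forall s, S s -> chi s = t s) ->
  cup_trivial phi psi <-> cup_trivial (phi \o quot_pi S) (psi \o quot_pi S).
Proof.
move=> hphi hpsi Schi; split; first exact: cup_trivial_comp.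
move=> [h hh]; have [chi hchi chiE] := Schi (fun s => - h s).
have [g gE] := heis_of_cup (quot_hom_comp hphi) (quot_hom_comp hpsi)
  (cup_trivial_correct hchi hh).
have [|k kE] := @quot_lift _ _ S g.
  move=> s Ss; rewrite gE /= quot_pi_rel // !hom1 // chiE //.
  by rewrite addrN.
apply: (cup_trivial_ext _ _ (ex_intro _ _ (heis_cup k))).
  by apply: quot_hom_eq => a; rewrite kE gE.
by apply: quot_hom_eq => a; rewrite kE gE.
Qed.

End QuotientCohomology.

Section CohomologyOfQuotients.
Import GRing.Theory.
Local Open Scope ring_scope.
Variables (F : fieldType) (G : groupType) (Z : simple_graph) (pi : Z -> G).
Hypothesis c : coh F pi.
Implicit Types z : Z.

Lemma pi_inj : injective pi.
Proof.
move=> z z' E; case: (eqVneq z z') => // zz'; case: c => c1 _ _.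
have [phi _ phiE] := c1 (fun w => (w == z)%:R).
have /eqP := phiE z'; rewrite -E phiE eqxx (eq_sym z') (negbTE zz').
by rewrite oner_eq0.
Qed.

Lemma coh_del z : coh F (fun x : del_graph z => quot_pi [set pi z] (pi (val x))).
Proof.
case: (c) => c1 c2 c3; split.
- move=> f; have [phi hphi phiE] := c1 (fun w =>
    if insub w is Some u then f u else 0).
  have [s ->|phi' hphi' E] := quot_hom_ex (S := [set pi z]) hphi.
    by rewrite phiE insubF // eqxx.
  by exists phi' => // x; rewrite E phiE valK.
- move=> phi hphi H q; have [a ->] := quot_pi_surj q.
  apply: (c2 _ (quot_hom_comp hphi)) => w /=.
  case: (eqVneq w z) => [->|wz]; first by rewrite quot_pi_rel // hom1.
  exact: (H (exist _ w wz)).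
- move=> phi psi hphi hpsi; rewrite quot_cup //; last first.
    move=> t; have [chi hchi chiE] := c1 (fun=> t (pi z)).
    by exists chi => // s ->.
  rewrite c3; try exact: quot_hom_comp.
  split=> H u v uv; first exact: H.
  rewrite /=; case: (eqVneq u z) => [->|uz].
    by rewrite !(quot_pi_rel (s := pi z)) // !hom1 // mul0r mulr0.
  case: (eqVneq v z) => [->|vz].
    by rewrite !(quot_pi_rel (s := pi z)) // !hom1 // mul0r mulr0.
  exact: (H (exist _ u uz) (exist _ v vz)).
Qed.

Lemma coh_contract z z' : z != z' -> coh F (fun x : contract_graph z z' =>
  quot_pi [set (pi z * (pi z')^-1)%g] (pi (val x))).
Proof.
move=> zz'; set r := (_ * _)%g; case: (c) => c1 c2 c3.
have Ezz' : quot_pi [set r] (pi z') = quot_pi [set r] (pi z).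
  by apply/esym/divg1_eq; rewrite -multfV -gmulfM; exact: quot_pi_rel.
split.
- move=> f; have [phi hphi phiE] := c1 (fun w =>
    f (insubd (exist _ z zz') w)).
  have [s ->|phi' hphi' E] := quot_hom_ex (S := [set r]) hphi.
    rewrite hphi homV // !phiE; apply/eqP; rewrite subr_eq0; apply/eqP; congr f.
    by apply: val_inj; rewrite !val_insubd zz' eqxx.
  by exists phi' => // x; rewrite E phiE valKd.
- move=> phi hphi H q; have [a ->] := quot_pi_surj q.
  apply: (c2 _ (quot_hom_comp hphi)) => w /=.
  case: (eqVneq w z') => [->|wz]; first by rewrite Ezz'; exact: (H (exist _ z zz')).
  exact: (H (exist _ w wz)).
- move=> phi psi hphi hpsi; rewrite quot_cup //; last first.
    move=> t; have [chi hchi chiE] := c1 (fun w => (w == z)%:R * t r).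
    exists chi => // s ->; rewrite /r hchi homV // !chiE eqxx eq_sym (negbTE zz').
    by rewrite mul1r mul0r subr0.
  rewrite c3; try exact: quot_hom_comp.
  split=> H u v uv.
    case/andP: uv => _ /or3P [uv|/andP [/eqP uz uv]|/andP [/eqP vz uv]].
    + exact: H.
    + by have := H _ _ uv; rewrite /= Ezz' uz.
    + by rewrite edge_sym in uv; have := H _ _ uv; rewrite /= Ezz' vz.
  rewrite /=; case: (eqVneq u z') => [Eu|uz]; case: (eqVneq v z') => [Ev|vz].
  + by rewrite Eu Ev edge_irrefl in uv.
  + rewrite Eu in uv *; rewrite Ezz'.
    case: (eqVneq v z) => [->|vz']; first by [].
    apply: (H (exist _ z zz') (exist _ v vz)); rewrite /= /contract_edge /=.
    rewrite -val_eqE /= eq_sym vz' eqxx uv /=; exact: orbT.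
  + rewrite Ev in uv *; rewrite Ezz'.
    case: (eqVneq u z) => [->|uz']; first by [].
    apply: (H (exist _ u uz) (exist _ z zz')); rewrite /= /contract_edge /=.
    by rewrite -val_eqE /= uz' eqxx (edge_sym z' u) uv !orbT.
  + apply: (H (exist _ u uz) (exist _ v vz)); rewrite /= /contract_edge /=.
    rewrite -val_eqE /= uv andbT.
    by apply: contraTneq uv => ->; rewrite edge_irrefl.
Qed.

Lemma coh_add z z' : z != z' -> coh F (fun x : add_edge z z' =>
  quot_pi [set [~ pi z, pi z']%g] (pi x)).
Proof.
move=> zz'; set r := [~ _, _]%g; case: (c) => c1 c2 c3; split.
- move=> f; have [phi hphi phiE] := c1 f.
  have [s ->|phi' hphi' E] := quot_hom_ex (S := [set r]) hphi.
    by rewrite homR.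
  by exists phi' => // x; rewrite E phiE.
- move=> phi hphi H q; have [a ->] := quot_pi_surj q.
  by apply: (c2 _ (quot_hom_comp hphi)) => w; exact: H.
- move=> phi psi hphi hpsi; split.
    move=> cup u v; case/orP=> [uv|uv].
      exact: ((c3 _ _ (quot_hom_comp hphi) (quot_hom_comp hpsi)).1
        (cup_trivial_comp _ cup)).
    have czz' : commute (quot_pi [set r] (pi z)) (quot_pi [set r] (pi z')).
      by apply/commgP/eqP; rewrite -multfR; apply: quot_pi_rel.
    apply: (cup_commute hphi hpsi cup).
    case/andP: uv => _ /orP [] /andP [/eqP -> /eqP ->].
      exact: czz'.
    exact: (commute_sym czz').
  move=> H; have [|h hh] := (c3 _ _ (quot_hom_comp hphi) (quot_hom_comp hpsi)).2.
    by move=> u v uv; apply: H; rewrite /= /add_edge_rel uv.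
  have [g gE] := heis_of_cup (quot_hom_comp hphi) (quot_hom_comp hpsi) hh.
  have [|k kE] := @quot_lift _ _ [set r] g.
    move=> s ->; rewrite multfR !gE heis_commg /=.
    by rewrite H ?subrr //= /add_edge_rel zz' !eqxx orbT.
  apply: (cup_trivial_ext _ _ (ex_intro _ _ (heis_cup k))).
    by apply: quot_hom_eq => a; rewrite kE gE.
  by apply: quot_hom_eq => a; rewrite kE gE.
Qed.

End CohomologyOfQuotients.

(** * Minors *)

Section MinorMaps.
Implicit Types X Y Z : simple_graph.

(* Connectedness of the fibres, phrased without paths: a property that spreads
   along the edges inside a fibre holds on all of it or nowhere. *)
Definition minor_map X Y (f : Y -> option X) : Prop :=
  [/\ forall x, exists y, f y = Some x,
      forall x u v, f u = Some x -> f v = Some x -> forall P : Y -> Prop,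
        P u -> (forall s t, f s = Some x -> f t = Some x -> edge s t -> P s -> P t) ->
        P v
    & forall x x', edge x x' ->
        exists y y', [/\ f y = Some x, f y' = Some x' & edge y y']].

Lemma minorP X Y : minor X Y <-> exists f : Y -> option X, minor_map f.
Proof.
split=> [[f [f1 f2]]|[f [f1 f2 f3]]]; exists f; split=> // x.
- by have [[y]] := f1 x; rewrite inE => /eqP; exists y.
- move=> u v fu fv P Pu Pst; have [_ /(_ u v)] := f1 x.
  rewrite !inE fu fv => /(_ (eqxx _) (eqxx _)) /connectP [p].
  elim: p u Pu {fu} => [|w p IH] u Pu /=; first by move=> _ ->.
  rewrite !inE => /andP [/and3P [/eqP fu /eqP fw uw] wp].
  by apply: IH wp; exact: Pst uw Pu.
- split; first by have [y fy] := f1 x; exists y; rewrite inE fy.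
  move=> u v; rewrite !inE => /eqP fu /eqP fv.
  apply: (f2 x u v fu fv (fun w => connect _ u w)) => // s t fs ft st us; apply: connect_trans us _.
  by apply: connect1; rewrite /= !inE fs ft eqxx.
Qed.

Lemma minor_trans X Y Z : minor X Y -> minor Y Z -> minor X Z.
Proof.
move=> /minorP [f [f1 f2 f3]] /minorP [g [g1 g2 g3]]; apply/minorP.
exists (fun z => obind f (g z)); split.
- by move=> x; have [y fy] := f1 x; have [z gz] := g1 y; exists z; rewrite gz.
- move=> x u v; case gu: (g u) => [a|] //=; case gv: (g v) => [b|] //= fa fb P Pu PS.
  suff H : forall z, g z = Some b -> P z by exact: H.
  (* The property that is spread along the fibre of [f] is to hold on a whole fibre of [g]. Between
     adjacent fibres one edge carries it over, and connectedness of the second fibre does the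
     rest. *)
  apply: (f2 x a b fa fb (fun y => forall z, g z = Some y -> P z)).
    move=> z gz; apply: (g2 a u z gu gz) Pu _ => s t gs gt; apply: PS.
      by rewrite gs.
    by rewrite gt.
  move=> s t fs ft st Ps z gz; have [p [q [gp gq pq]]] := g3 _ _ st.
  have Pq : P q by apply: (PS p q _ _ pq (Ps p gp)); rewrite ?gp ?gq.
  apply: (g2 t q z gq gz) Pq _ => r r' gr gr'; apply: PS.
    by rewrite gr.
  by rewrite gr'.
- move=> x x' /f3 [y [y' [fy fy' /g3 [z [z' [gz gz' zz']]]]]].
  by exists z, z'; rewrite gz gz'.
Qed.

Lemma minor_sub X Y (sigma : Y -> X) : bijective sigma ->
  (forall y y', edge (sigma y) (sigma y') -> edge y y') -> minor X Y.
Proof.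
case=> tau sK tK H; apply/minorP; exists (fun y => Some (sigma y)); split.
- by move=> x; exists (tau x); rewrite tK.
- move=> x u v [uE] [vE] P Pu _; have -> // : v = u.
  by apply: (can_inj sK); rewrite uE vE.
- move=> x x' xx'; exists (tau x), (tau x'); rewrite !tK; split=> //.
  by apply: H; rewrite !tK.
Qed.

Lemma minor_refl X : minor X X.
Proof. by apply: (@minor_sub X X id) => //; exists id. Qed.

Lemma minor_del Z (z : Z) : minor (del_graph z) Z.
Proof.
apply/minorP; exists (insub : Z -> option (del_graph z)); split.
- by move=> x; exists (val x); rewrite valK.
- move=> x u v; case: insubP => // u' _ <- [->]; case: insubP => // v' _ <- [->].
  by [].
- by move=> x x' xx'; exists (val x), (val x'); rewrite !valK.
Qed.

Lemma minor_contract Z (z z' : Z) : z != z' -> edge z z' ->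
  minor (contract_graph z z') Z.
Proof.
move=> zz' ezz'; pose z0 : contract_graph z z' := exist _ z zz'.
pose f y := insubd z0 y.
have fE y : val (f y) = if y == z' then z else y.
  by rewrite val_insubd; case: eqP.
apply/minorP; exists (fun y => Some (f y)); split.
- by move=> x; exists (val x); rewrite /f valKd.
- move=> x u v [fu] [fv] P Pu PS.
  have := congr1 val fu; have := congr1 val fv; rewrite !fE.
  case: (eqVneq u z') => [Eu|_]; case: (eqVneq v z') => [Ev|_].
  + by move=> _ _; have -> : v = u by rewrite Ev.
  + move=> vx zx; have vz : v = z by rewrite vx.
    by apply: (PS u) => //; rewrite ?fu ?fv // Eu vz edge_sym.
  + move=> zx ux; have uz : u = z by rewrite ux.
    by apply: (PS u) => //; rewrite ?fu ?fv // Ev uz.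
  + by move=> vx ux; have -> : v = u by rewrite vx.
- move=> x x' /andP [_ /or3P [xx'|/andP [/eqP xz zx']|/andP [/eqP xz zx']]].
  + by exists (val x), (val x'); rewrite /f !valKd.
  + exists z', (val x'); rewrite /f valKd; split=> //; congr Some.
    by apply: val_inj; rewrite fE eqxx xz.
  + exists (val x), z'; rewrite /f valKd edge_sym; split=> //; congr Some.
    by apply: val_inj; rewrite fE eqxx xz.
Qed.

Lemma minor_add Z (z z' : Z) : minor Z (add_edge z z').
Proof.
apply: (@minor_sub Z (add_edge z z') id); first by exists id.
by move=> y y' yy'; rewrite /= /add_edge_rel yy'.
Qed.

(** A bijection that reflects edges exhibits [Z'] as a spanning subgraph of [Z]. The opposite
    relation comes from exchanging the two families. *)
Lemma coh_minor (F : finFieldType) (G : groupType) Z Z' (pi : Z -> G) (pi' : Z' -> G) :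
  (2%:R : F)%R != 0%R -> coh F pi -> coh F pi' -> minor Z' Z.
Proof.
move=> F2 c c'; have [sigma [sB sE]] := coh_rigidity F2 c c'.
exact: minor_sub sB sE.
Qed.

End MinorMaps.

(** * Gluing *)

Section EarLists.
Implicit Types G H : groupType.

Definition links (G : Type) (D : ear_list G) : seq (G * G) :=
  flatten [seq consecutive e.1 e.2 | e <- D].

Definition map_pair (S T : Type) (f : S -> T) (p : S * S) : T * T := (f p.1, f p.2).

Lemma adjacent_pearlsE (G : eqType) (D : ear_list G) p q :
  adjacent_pearls D p q = ((p, q) \in links D) || ((q, p) \in links D).
Proof. by []. Qed.

Lemma pearls_rcons (G : Type) (D : ear_list G) e :
  pearls (rcons D e) = pearls D ++ e.2.
Proof. by rewrite /pearls /unzip2 map_rcons flatten_rcons. Qed.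

Lemma links_rcons (G : Type) (D : ear_list G) e :
  links (rcons D e) = links D ++ consecutive e.1 e.2.
Proof. by rewrite /links map_rcons flatten_rcons. Qed.

Lemma pearls_map (S T : Type) (f : S -> T) (D : ear_list S) :
  pearls (map_ears f D) = map f (pearls D).
Proof. by rewrite /pearls /map_ears /unzip2 map_flatten -!map_comp. Qed.

Lemma consecutive_map (S T : Type) (f : S -> T) s (ps : seq S) :
  consecutive s (map f ps) = map (map_pair f) (consecutive s ps).
Proof.
have Z (u v : seq S) : zip (map f u) (map f v) = map (map_pair f) (zip u v).
  by elim: u v => [|x u IH] [|y v] //=; rewrite IH.
by case: s => [|n|n] /=; rewrite -?map_rot ?behead_map Z.
Qed.

Lemma links_map (S T : Type) (f : S -> T) (D : ear_list S) :
  links (map_ears f D) = map (map_pair f) (links D).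
Proof.
rewrite /links /map_ears map_flatten -!map_comp; congr flatten.
by apply: eq_map => e /=; rewrite consecutive_map.
Qed.

End EarLists.

Section Gluing.
Import GRing.Theory.
Local Open Scope ring_scope.
Variable F : fieldType.
Implicit Types G H : groupType.

(* The analogue of [coh] for the graph whose vertices are the elements of [P]
   and whose edges are the pairs in [L]. *)
Definition coh_on G (P : seq G) (L : seq (G * G)) : Prop :=
  [/\ forall f : G -> F, exists2 phi, is_hom phi & forall p, p \in P -> phi p = f p,
      forall phi : G -> F, is_hom phi ->
        (forall p, p \in P -> phi p = 0) -> forall a, phi a = 0,
      forall phi psi : G -> F, is_hom phi -> is_hom psi ->
        cup_trivial phi psi <->
        forall l, l \in L -> phi l.1 * psi l.2 = phi l.2 * psi l.1
    & forall l, l \in L -> [/\ l.1 \in P, l.2 \in P & l.1 != l.2]].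

Section FreeProductCohomology.
Variables G H : groupType.

Lemma fp_hom_ex (phi : G -> F) (psi : H -> F) : is_hom phi -> is_hom psi ->
  exists2 chi : free_product G H -> F, is_hom chi &
    (forall a, chi (fp_inl H a) = phi a) /\ (forall b, chi (fp_inr G b) = psi b).
Proof.
move=> hphi hpsi; have [g gE] := heis_of_hom hphi; have [h hE] := heis_of_hom hpsi.
have [k [kl kr]] := free_product_lift g h.
exists (fun a => (k a).1.1); first exact: heis_hom1.
by split=> a; rewrite ?kl ?kr ?gE ?hE.
Qed.

Lemma fp_hom0 (phi : free_product G H -> F) : is_hom phi ->
  (forall a, phi (fp_inl H a) = 0) -> (forall b, phi (fp_inr G b) = 0) ->
  forall q, phi q = 0.
Proof.
move=> hphi Hl Hr q; have [a ->] := quot_pi_surj q.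
have hphi' := quot_hom_comp hphi.
apply: (hom_gen0 hphi' _ (free_group_gen a)) => _ [[v|v] ->]; [exact: Hl|exact: Hr].
Qed.

Lemma fp_hom_eq (phi psi : free_product G H -> F) : is_hom phi -> is_hom psi ->
  (forall a, phi (fp_inl H a) = psi (fp_inl H a)) ->
  (forall b, phi (fp_inr G b) = psi (fp_inr G b)) -> phi =1 psi.
Proof.
move=> hphi hpsi El Er q; apply/eqP; rewrite -subr_eq0; apply/eqP.
by apply: (fp_hom0 (hom_sub hphi hpsi)) => a; rewrite ?El ?Er subrr.
Qed.

Lemma fp_cup (phi psi : free_product G H -> F) : is_hom phi -> is_hom psi ->
  cup_trivial phi psi <->
  cup_trivial (phi \o @fp_inl G H) (psi \o @fp_inl G H) /\
  cup_trivial (phi \o @fp_inr G H) (psi \o @fp_inr G H).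
Proof.
move=> hphi hpsi; split=> [cup|[[h hh] [k hk]]].
  by split; exact: cup_trivial_comp.
have [g gE] := heis_of_cup (hom_comp hphi _) (hom_comp hpsi _) hh.
have [g' gE'] := heis_of_cup (hom_comp hphi _) (hom_comp hpsi _) hk.
have [e [el er]] := free_product_lift g g'.
apply: (cup_trivial_ext _ _ (ex_intro _ _ (heis_cup e))).
  apply: fp_hom_eq => // [|a|b]; first exact: heis_hom1.
    by rewrite el gE.
  by rewrite er gE'.
apply: fp_hom_eq => // [|a|b]; first exact: heis_hom2.
  by rewrite el gE.
by rewrite er gE'.
Qed.

End FreeProductCohomology.

Section Amalgam.
Variables (G H : groupType) (P : seq G) (L : seq (G * G)).
Variables (P' : seq H) (L' : seq (H * H)).
Hypotheses (cG : coh_on P L) (cH : coh_on P' L').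
Variable E : seq (H * G).
Hypotheses (uniqH : uniq (unzip1 E)) (uniqG : uniq (unzip2 E)).
Hypothesis EP : forall e, e \in E -> e.1 \in P' /\ e.2 \in P.
Let R : set (free_product G H) := [set r | exists2 e, e \in E & r = identify e.1 e.2]%classic.
Let iG (a : G) := quot_pi R (fp_inl H a).
Let iH (b : H) := quot_pi R (fp_inr G b).

Let fst_ex (t : H * G -> F) : exists f : H -> F, forall e, e \in E -> f e.1 = t e.
Proof.
elim: E uniqH => [|[x y] E' IH] /=; first by exists (fun=> 0).
case/andP=> xE /IH [f fE]; exists (fun z => if z == x then t (x, y) else f z).
move=> e; rewrite inE => /orP [/eqP -> /=|eE]; first by rewrite eqxx.
case: eqP => [ex|_]; last exact: fE.
by case/negP: xE; rewrite -ex; exact: (map_f fst).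
Qed.

Let snd_ex (t : H * G -> F) : exists f : G -> F, forall e, e \in E -> f e.2 = t e.
Proof.
elim: E uniqG => [|[x y] E' IH] /=; first by exists (fun=> 0).
case/andP=> xE /IH [f fE]; exists (fun z => if z == y then t (x, y) else f z).
move=> e; rewrite inE => /orP [/eqP -> /=|eE]; first by rewrite eqxx.
case: eqP => [ex|_]; last exact: fE.
by case/negP: xE; rewrite -ex; exact: (map_f snd).
Qed.

Lemma amalgam_glue e : e \in E -> iH e.1 = iG e.2.
Proof.
move=> eE; apply/divg1_eq; rewrite /iH /iG -multfV -gmulfM.
by apply: quot_pi_rel; exists e.
Qed.

Lemma amalgam_hom (phi : G -> F) (psi : H -> F) : is_hom phi -> is_hom psi ->
  (forall e, e \in E -> psi e.1 = phi e.2) ->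
  exists2 chi, is_hom chi &
    (forall a, chi (iG a) = phi a) /\ (forall b, chi (iH b) = psi b).
Proof.
move=> hphi hpsi eqE; have [chi hchi [cl cr]] := fp_hom_ex hphi hpsi.
have [s [e eE ->]|chi' hchi' chiE] := quot_hom_ex (S := R) hchi.
  by rewrite hchi homV // cl cr eqE // subrr.
by exists chi' => //; split=> a; rewrite chiE.
Qed.

Lemma amalgam_extl (f : G -> F) : exists2 chi, is_hom chi &
  forall p, p \in P -> chi (iG p) = f p.
Proof.
have [c1 _ _ _] := cG; have [d1 _ _ _] := cH.
have [phi hphi phiE] := c1 f.
have [g gE] := fst_ex (fun e => phi e.2); have [psi hpsi psiE] := d1 g.
have [|chi hchi [cl cr]] := amalgam_hom hphi hpsi.
  by move=> e eE; have [eP _] := EP eE; rewrite psiE // gE.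
by exists chi => // p pP; rewrite cl phiE.
Qed.

Lemma amalgam_extr (f : H -> F) : exists2 chi, is_hom chi &
  forall p, p \in P' -> chi (iH p) = f p.
Proof.
have [c1 _ _ _] := cG; have [d1 _ _ _] := cH.
have [psi hpsi psiE] := d1 f.
have [g gE] := snd_ex (fun e => psi e.1); have [phi hphi phiE] := c1 g.
have [|chi hchi [cl cr]] := amalgam_hom hphi hpsi.
  by move=> e eE; have [_ eP] := EP eE; rewrite phiE // gE.
by exists chi => // p pP; rewrite cr psiE.
Qed.

(** The glued elements are distinct on each side, so classes may be prescribed on them. This extends
    a class from either side across the amalgam and provides the correction required by [quot_cup].
    Glued elements occur twice in the list, which is harmless because [coh_on] only uses
    membership. *)
Lemma coh_on_amalgam :
  coh_on (map iG P ++ map iH P') (map (map_pair iG) L ++ map (map_pair iH) L').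
Proof.
have [c1 c2 c3 c4] := cG; have [d1 d2 d3 d4] := cH.
split.
- move=> f; have [phi hphi phiE] := c1 (f \o iG).
  have [psi hpsi psiE] := d1 (f \o iH).
  have [|chi hchi [cl cr]] := amalgam_hom hphi hpsi.
    by move=> e eE; have [? ?] := EP eE; rewrite psiE // phiE //= amalgam_glue.
  exists chi => // p; rewrite mem_cat => /orP [] /mapP [q qP ->].
    by rewrite cl phiE.
  by rewrite cr psiE.
- move=> phi hphi phi0 q; have [a ->] := quot_pi_surj q.
  have hphi' := quot_hom_comp hphi.
  apply: (fp_hom0 hphi') => x /=.
    apply: (c2 _ (hom_comp hphi' (@fp_inl G H))) => p pP; apply: phi0.
    by rewrite mem_cat (map_f iG pP).
  apply: (d2 _ (hom_comp hphi' (@fp_inr G H))) => p pP; apply: phi0.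
  by rewrite mem_cat (map_f iH pP) orbT.
- move=> phi psi hphi hpsi; rewrite quot_cup //; last first.
    move=> t; have [f fE] := fst_ex (fun e => t (identify e.1 e.2)).
    have [chi hchi chiE] := d1 f.
    have [chi' hchi' [cl cr]] := fp_hom_ex (@is_hom0 F G) hchi.
    exists chi' => // _ [e eE ->]; rewrite hchi' homV // cl cr subr0.
    by have [? _] := EP eE; rewrite chiE // fE.
  have hphi' := quot_hom_comp hphi; have hpsi' := quot_hom_comp hpsi.
  rewrite fp_cup //.
  rewrite (c3 _ _ (hom_comp hphi' (@fp_inl G H)) (hom_comp hpsi' (@fp_inl G H))).
  rewrite (d3 _ _ (hom_comp hphi' (@fp_inr G H)) (hom_comp hpsi' (@fp_inr G H))).
  split=> [[HL HR] l|Hl].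
    by rewrite mem_cat => /orP [] /mapP [l' /= l'L ->]; [exact: HL|exact: HR].
  split=> l lL.
    by apply: (Hl (map_pair iG l)); rewrite mem_cat (map_f (map_pair iG) lL).
  by apply: (Hl (map_pair iH l)); rewrite mem_cat (map_f (map_pair iH) lL) orbT.
- move=> l; rewrite mem_cat => /orP [] /mapP [l' l'L ->] /=.
    have [l1 l2 l12] := c4 _ l'L; rewrite !mem_cat !(map_f iG) //; split=> //.
    have [chi hchi chiE] := amalgam_extl (fun x => (x == l'.1)%:R).
    apply/eqP => /(congr1 chi); rewrite !chiE // eqxx eq_sym (negbTE l12).
    by move/eqP; rewrite oner_eq0.
  have [l1 l2 l12] := d4 _ l'L; rewrite !mem_cat !(map_f iH) ?orbT //; split=> //.
  have [chi hchi chiE] := amalgam_extr (fun x => (x == l'.1)%:R).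
  apply/eqP => /(congr1 chi); rewrite !chiE // eqxx eq_sym (negbTE l12).
  by move/eqP; rewrite oner_eq0.
Qed.

End Amalgam.
End Gluing.

(** * Pearl chains *)

Section IntegerPowers.
Import GRing.Theory.
Local Open Scope group_scope.
Variable G : groupType.
Implicit Types (x y : G) (k l : int).

Lemma expgzS x k : expgz x (k + 1)%R = expgz x k * x.
Proof.
case: k => [n|n].
  have -> : (Posz n + 1 = n.+1)%R by lia.
  by rewrite /= expgSr.
case: n => [|n].
  have -> : (Negz 0 + 1 = 0)%R by [].
  by rewrite /= expg1 mulVg.
have -> : (Negz n.+1 + 1 = Negz n)%R by rewrite !NegzE; lia.
by rewrite /= [in RHS]expgS invgM mulgVK.
Qed.

Lemma expgzD x k l : expgz x (k + l)%R = expgz x k * expgz x l.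
Proof.
have H (n : nat) j : expgz x (j + n%:Z)%R = expgz x j * expgz x n.
  elim: n => [|n IH]; first by rewrite addr0 mulg1.
  by rewrite -addn1 PoszD addrA !expgzS IH mulgA.
case: l => n; first exact: H.
have := H n.+1 (k + Negz n)%R; rewrite NegzE -addrA addNr addr0 => ->.
by rewrite -NegzE /= mulgK.
Qed.

Lemma expgzN x k : expgz x (- k)%R = (expgz x k)^-1.
Proof. by apply/esym/mulg1_eq; rewrite -expgzD addrN. Qed.

Lemma expgzM x k l : expgz x (k * l)%R = expgz (expgz x k) l.
Proof.
have H (n : nat) : expgz x (k * n%:Z)%R = expgz (expgz x k) n.
  elim: n => [|n IH]; first by rewrite mulr0.
  have -> : (n.+1%:Z = n%:Z + 1)%R by lia.
  by rewrite mulrDr mulr1 (expgzD x) IH expgzS.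
case: l => n; first exact: H.
by rewrite NegzE mulrN !expgzN H.
Qed.

Lemma expgz1 k : expgz (1 : G) k = 1.
Proof. by case: k => n /=; rewrite expg1n ?invg1. Qed.

Lemma commute_expgz x y k : commute x y -> commute x (expgz y k).
Proof.
by move=> xy; case: k => n /=; [exact: commuteX|exact/commuteV/commuteX].
Qed.

Lemma expgzMl x y k : commute x y -> expgz (x * y) k = expgz x k * expgz y k.
Proof.
by move=> xy; case: k => n /=; rewrite expgMn // invgM -!/(expgz _ (Negz n));
  exact/commute_sym/commuteV/commute_sym/commuteV/commuteX2.
Qed.

Lemma gen_expgz (S : set G) x k : gen S x -> gen S (expgz x k).
Proof.
move=> Sx; have H n : gen S (x ^+ n).
  by elim: n => [|n IH]; [exact: gen_one|rewrite expgS; exact: gen_mul].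
by case: k => n; [exact: H|exact/gen_inv/H].
Qed.

Lemma additive_expgz (f : int -> G) : (forall k l, f (k + l)%R = f k * f l) ->
  forall k, f k = expgz (f 1%R) k.
Proof.
move=> fD; have f0 : f 0%R = 1 by apply: (mulgI (f 0%R)); rewrite -fD addr0 mulg1.
have H (n : nat) : f n = expgz (f 1%R) n.
  by elim: n => [//|n IH]; rewrite -addn1 PoszD fD IH expgzS.
case=> n; first exact: H.
rewrite NegzE expgzN -H; apply/esym/mulg1_eq.
by rewrite -fD addrN.
Qed.

End IntegerPowers.

Lemma multf_expgz (G H : groupType) (f : {multiplicative G -> H}) x k :
  f (expgz x k) = expgz (f x) k.
Proof. by case: k => n /=; rewrite ?multfV multfX. Qed.

Section RankTwo.
Import GRing.Theory.
Local Open Scope group_scope.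
Variable Q : groupType.
Variables u v : Q.
Hypothesis uv : commute u v.
Hypothesis uv_gen : forall q, exists a b, q = expgz u a * expgz v b.

Let E a b := expgz u a * expgz v b.

Let uvX a b : commute (expgz u a) (expgz v b).
Proof. exact: commute_expgz (commute_sym (commute_expgz _ (commute_sym uv))). Qed.

Let ED a b c d : E a b * E c d = E (a + c)%R (b + d)%R.
Proof.
rewrite /E !expgzD -!mulgA; congr (_ * _); rewrite !mulgA; congr (_ * _).
exact/commute_sym/uvX.
Qed.

Let EX a b k : expgz (E a b) k = E (a * k)%R (b * k)%R.
Proof.
by rewrite /E !expgzM expgzMl.
Qed.

Lemma proper_multiple1 : proper_multiple (1 : Q).
Proof. by exists 1, (Posz 2); rewrite expgz1. Qed.

(** [p1] is a power with exponent the gcd of its coordinates, so this gcd is 1 and Bezout yields a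
    complement [r]. Modulo [p1] the element [p2] is a power of [r], whose exponent must be a unit.
    Exponent 0 is excluded too, since the identity is a proper multiple. *)
Lemma chain_Z2_gen (p1 p2 : Q) : chain_Z2 p1 p2 ->
  forall q, gen [set p1; p2] q.
Proof.
case=> np1 np2; have [a [b p1E]] := uv_gen p1.
have [d d0 [a' [b' [aE bE]]]] : exists2 d : int, gcdz a b = d &
    exists a' b', a = (a' * d)%R /\ b = (b' * d)%R.
  exists (gcdz a b) => //.
  have /dvdzP [a' aE] := dvdz_gcdl a b; have /dvdzP [b' bE] := dvdz_gcdr a b.
  by exists a', b'.
have p1d : p1 = expgz (E a' b') d by rewrite EX -aE -bE.
have d1 : d = 1%R.
  have dge : (0 <= d)%R by rewrite -d0.
  have : ~ (2 <= `|d|)%N by move=> d2; apply: np1; exists (E a' b'), d.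
  case: (eqVneq d 0%R) => [dd|]; last by lia.
  by case: np1; rewrite p1d dd; exact: proper_multiple1.
have [[s t] st] : exists st : int * int, (st.1 * a + st.2 * b)%R = 1%R.
  have [s [t st]] := Bezoutz a b; exists (s, t); by rewrite st d0 d1.
rewrite /= in st; set r := E (- t)%R s.
have uE : u = expgz p1 s * expgz r (- b)%R.
  rewrite p1E -/(E a b) !EX ED.
  have -> : (a * s + - t * - b = 1)%R by rewrite -st; ring.
  have -> : (b * s + s * - b = 0)%R by ring.
  by rewrite /E mulg1.
have vE : v = expgz p1 t * expgz r a.
  rewrite p1E -/(E a b) !EX ED.
  have -> : (a * t + - t * a = 0)%R by ring.
  have -> : (b * t + s * a = 1)%R by rewrite -st; ring.
  by rewrite /E mul1g.
have [c [e p2E]] := uv_gen p2.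
pose i := (s * c + t * e)%R; pose j := (a * e - b * c)%R.
have p2E' : p2 = expgz p1 i * expgz r j.
  rewrite p1E -/(E a b) !EX ED p2E -/(E c e) /i /j.
  congr E; rewrite -[LHS]mulr1 -st; ring.
have quotp2 : quot_pi [set p1] p2 = expgz (quot_pi [set p1] r) j.
  pose qp : {multiplicative Q -> quotient_group [set p1]} := quot_pi [set p1].
  have qp1 : qp p1 = 1 by exact: quot_pi_rel.
  rewrite -[LHS]/(qp p2) -[quot_pi _ r]/(qp r) p2E' gmulfM !multf_expgz qp1.
  by rewrite expgz1 mul1g.
have j1 : j = 1%R \/ j = (-1)%R.
  have : ~ (2 <= `|j|)%N by move=> j2; apply: np2; exists (quot_pi [set p1] r), j.
  case: (eqVneq j 0%R) => [jj|]; last by lia.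
  case: np2; rewrite quotp2 jj /= expg0.
  by exists 1, (Posz 2); rewrite expgz1.
have gp1 : gen [set p1; p2] p1 by apply: gen_in; left.
have gp2 : gen [set p1; p2] p2 by apply: gen_in; right.
have gr : gen [set p1; p2] r.
  have Er : expgz r j = (expgz p1 i)^-1 * p2 by rewrite p2E' mulKg.
  have grj : gen [set p1; p2] (expgz r j).
    by rewrite Er; apply: gen_mul => //; apply: gen_inv; exact: gen_expgz.
  by case: j1 grj => -> //= /gen_inv; rewrite invgK expg1.
move=> q; have [x [y ->]] := uv_gen q.
by apply: gen_mul; apply: gen_expgz; rewrite ?uE ?vE; apply: gen_mul; exact: gen_expgz.
Qed.

End RankTwo.

Section SpanningPearls.
Import mathcomp.boot.fintype mathcomp.boot.finset GRing.Theory.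
Local Open Scope ring_scope.
Variables (F : finFieldType) (X : simple_graph) (pi : X -> raag X).
Hypothesis pi_comm : forall x y, edge x y -> commute (pi x) (pi y).
Hypothesis pi_span : forall phi : raag X -> F, is_hom phi ->
  (forall x, phi (pi x) = 0) -> forall a, phi a = 0.

(* The endomorphism v |-> pi v acts on the finite set of classes of degree 1
   injectively, hence bijectively, and preserves the finite set of pairs with
   zero cup product, hence also reflects it. *)
Lemma coh_spanning : coh F pi.
Proof.
have ext (f : {ffun X -> F}) := cid2 (raag_hom_ex f).
pose e f := projT1 (ext f).
have he f : is_hom (e f) by rewrite /e; case: (ext f).
have eE f x : e f (raag_gen x) = f x by rewrite /e; case: (ext f).
pose T f : {ffun X -> F} := [ffun x => e f (pi x)].
have T_inj : injective T.
  move=> f g /ffunP E; apply/ffunP => x; rewrite -!eE; apply/eqP.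
  rewrite -subr_eq0; apply/eqP; apply: (pi_span (hom_sub (he f) (he g))) => y.
  by have := E y; rewrite !ffunE => ->; rewrite subrr.
have T_hom (phi : raag X -> F) (f : {ffun X -> F}) : is_hom phi -> (forall x, phi (raag_gen x) = f x) ->
    forall x, phi (pi x) = T f x.
  move=> hphi phiE x; rewrite ffunE; apply: raag_hom_eq => // y.
  by rewrite phiE eE.
have c3 (phi psi : raag X -> F) (hphi : is_hom phi) (hpsi : is_hom psi) :
    cup_trivial phi psi <-> parallel [ffun x => phi (raag_gen x)] [ffun x => psi (raag_gen x)].
  have [_ _ ->] := coh_raag F X => //.
  split=> [H|/parallelP H u v /H]; last by rewrite !ffunE.
  by apply/parallelP => u v /H; rewrite !ffunE.
have T_par f g : parallel f g -> parallel (T f) (T g).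
  move=> fg; have /(c3 _ _ (he f) (he g)) cup : parallel [ffun x => e f (raag_gen x)] [ffun x => e g (raag_gen x)].
    by apply/parallelP => u v uv; rewrite !ffunE !eE; apply: (parallelP _ _ fg).
  apply/parallelP => u v /pi_comm uv; rewrite !ffunE.
  exact: cup_commute uv.
pose CP : {set {ffun X -> F} * {ffun X -> F}} := [set p | parallel p.1 p.2]%SET.
pose TT (p : {ffun X -> F} * {ffun X -> F}) := (T p.1, T p.2).
have TT_inj : injective TT by move=> [f g] [f' g'] [/T_inj -> /T_inj ->].
have TCP : TT @: CP = CP.
  apply/eqP; rewrite eqEcard card_imset // leqnn andbT.
  apply/subsetP => q /imsetP [p]; rewrite inE => /T_par H ->.
  by rewrite inE.
have T_parE f g : parallel (T f) (T g) -> parallel f g.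
  move=> H; have : (T f, T g) \in TT @: CP by rewrite TCP inE.
  by case/imsetP => -[f' g']; rewrite inE => H' [/T_inj -> /T_inj ->].
split=> [f|phi hphi|phi psi hphi hpsi]; last first.
- split=> [cup u v /pi_comm|H]; first exact: cup_commute.
  have E1 := T_hom phi [ffun x => phi (raag_gen x)] hphi.
  have E2 := T_hom psi [ffun x => psi (raag_gen x)] hpsi.
  apply/(c3 _ _ hphi hpsi)/T_parE/parallelP => u v /H.
  by rewrite !E1 ?E2 // => x; rewrite ffunE.
- exact: pi_span.
- have [T' TK T'K] := injF_bij T_inj.
  exists (e (T' [ffun x => f x])) => // x.
  by have /ffunP/(_ x) := T'K [ffun x => f x]; rewrite !ffunE.
Qed.

End SpanningPearls.

(** * The vertex attached to an inner pearl *)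

Section InnerPearls.
Import mathcomp.boot.fintype mathcomp.boot.finset GRing.Theory.
Local Open Scope group_scope.
Variables (F : fieldType) (X : simple_graph).
Hypotheses (tf : triangle_free X) (sf : square_free X).
Implicit Types (x y z : raag X) (u v w : X) (phi : raag X -> F).

(* Up to a power prime to the characteristic, [x] is a conjugate of [v]. *)
Definition inner_pearl x v : Prop := exists2 g, vertex_like x v g &
  forall phi, is_hom phi -> phi x = 0%R <-> phi (raag_gen v) = 0%R.

Lemma parabolic_hom0 (S : {set X}) phi : is_hom phi ->
  (forall v, v \in S -> phi (raag_gen v) = 0%R) ->
  forall a, parabolic S a -> phi a = 0%R.
Proof.
move=> hphi S0 a Sa; elim/parabolic_ind: a / Sa => [|a b Ea Eb|a Ea|v /S0 //].
- exact: hom1.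
- by rewrite hphi Ea Eb addr0.
- by rewrite homV // Ea oppr0.
Qed.

Lemma dual_hom w : exists2 phi : raag X -> F, is_hom phi &
  forall v, phi (raag_gen v) = (v == w)%:R%R.
Proof. exact: (raag_hom_ex (fun v => (v == w)%:R%R : F)). Qed.

(** A conjugate of [v] is central in the centralizer of [x], hence a power of [x] by (I), so a class
    zero on [x] is zero on [v]. Conversely a conjugate of [x] lies in the parabolic of [v]. *)
Lemma cond_I_inner x : cond_I x -> exists v, inner_pearl x v /\
  exists u w, [/\ edge v u, edge v w & u != w].
Proof.
case=> x1 nab cen; have [v [g [xv deg]]] := nonabelian_centralizer tf sf x1 nab.
exists v; split=> //; exists g => // phi hphi.
have vc := vertex_like_centralizer xv.
split=> [x0|v0]; last first.
  rewrite -(homJ hphi x g); apply: (parabolic_hom0 hphi) (proj1 xv) => w.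
  by rewrite inE => /eqP ->.
have : center_of (centralizer x) (raag_gen v ^ g^-1).
  split.
    apply/commute_sym/vc; rewrite conjgKV; apply: parabolic_gen.
    by rewrite !inE eqxx.
  move=> y /commute_sym/vc vy; apply: commute_sym.
  rewrite -[y](conjgK g); apply: commuteJ; apply/commute_sym.
  apply: parabolic_commute vy _ => w; rewrite !inE => /orP [/eqP ->|].
    exact: commute_refl.
  exact: raag_gen_comm.
rewrite cen => gv; rewrite -(homJ hphi _ g^-1).
by apply: (hom_gen0 hphi _ gv) => _ ->.
Qed.

Lemma inner_centralizer0 x v phi : inner_pearl x v -> is_hom phi ->
  (forall y, centralizer x y -> phi y = 0%R) <->
  (forall w, w \in star v -> phi (raag_gen w) = 0%R).
Proof.
move=> [g xv _] hphi; have vc := vertex_like_centralizer xv; split=> H.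
  move=> w wv; rewrite -(homJ hphi _ g^-1); apply: H.
  apply/commute_sym/vc; rewrite conjgKV; exact: parabolic_gen.
move=> y /commute_sym/vc vy; rewrite -(homJ hphi y g).
exact: (parabolic_hom0 hphi H).
Qed.

Lemma inner_adjacent x v y u : inner_pearl x v -> inner_pearl y u ->
  centralizer x y -> u \in star v.
Proof.
move=> [g xv _] [_ _ yu] /commute_sym/(vertex_like_centralizer xv) vy.
have [phi hphi phiE] := dual_hom u; apply: contraT => uv.
have /(yu _ hphi)/eqP : phi y = 0%R.
  rewrite -(homJ hphi y g); apply: (parabolic_hom0 hphi) vy => w wv.
  by rewrite phiE; case: eqP uv => // <-; rewrite wv.
by rewrite phiE eqxx oner_eq0.
Qed.

(* If the classes vanishing on the listed pearls vanish on the centralizer of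
   [x], then each vertex in the star of [v] is one of their vertices. *)
Lemma inner_star_covered (S : raag X -> Prop) x v w : inner_pearl x v ->
  (forall phi, is_hom phi -> (forall s, S s -> phi s = 0%R) ->
    forall y, centralizer x y -> phi y = 0%R) ->
  w \in star v -> (forall s, S s -> exists u, inner_pearl s u) ->
  exists2 s, S s & inner_pearl s w.
Proof.
move=> xv cov wv inn; have [phi hphi phiE] := dual_hom w.
apply: contrapT => H.
have : phi (raag_gen w) = 0%R.
  apply: (inner_centralizer0 xv hphi).1 => // y; apply: cov => // s Ss.
  have [u su] := inn s Ss; have [_ _ /(_ _ hphi) E] := su; apply/E.
  by rewrite phiE; case: eqP => // uw; case: H; exists s; rewrite // -uw.
by rewrite phiE eqxx => /eqP; rewrite oner_eq0.
Qed.

(** With a common vertex, a conjugate of [y] would lie in the parabolic of [v], which is central in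
    the parabolic of the star of [v]; then [y] would commute with the witness [z]. *)
Lemma adjacent_inner_distinct x y v w : inner_pearl x v -> inner_pearl y w ->
  adjacent_inner_pearls x y -> v != w.
Proof.
move=> [g xv _] [h yw _] [_ _ xy [z [xz nyz]]]; apply/eqP => vw; apply: nyz.
have vc := vertex_like_centralizer xv.
have Sy := (vc _).1 xy; have Sz := (vc _).1 xz.
have : parabolic [set w] ((y ^ g) ^ (g^-1 * h)).
  by rewrite conjgM conjgK; case: yw.
move=> /(parabolic_conj Sy); set k := retract _ _ => Syk.
have Sk : parabolic (star v) k by exact: retractP.
have cv a b : parabolic [set v] a -> parabolic (star v) b -> commute a b.
  move=> Sa Sb; apply: parabolic_commute Sb _ => u; rewrite !inE => uv.
  apply/commute_sym; apply: parabolic_commute Sa _ => t; rewrite inE => /eqP ->.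
  case/orP: uv => [/eqP ->|]; first exact: commute_refl.
  by rewrite edge_sym => /raag_gen_comm.
have Svk : parabolic [set v] ((y ^ g) ^ k).
  by apply: parabolicS Syk; rewrite -vw; exact: subsetIr.
have ck := cv _ _ Svk Sk.
have Eyg : y ^ g = (y ^ g) ^ k.
  by rewrite -{1}[y ^ g](conjgK k); apply/conjg_fixP/commgP/commuteV.
have : commute (y ^ g) (z ^ g) by rewrite Eyg; exact: cv.
by move=> /(commuteJ g^-1); rewrite !conjgK.
Qed.

(* In a free product H * Z the class dual to Z has zero cup product with every
   class; in a RAAG a vertex with a neighbour obstructs this. *)
Lemma free_splitting_leaf x v (H K : groupType) : inner_pearl x v ->
  additive_iso K int -> group_iso (quotient_group [set x]%classic) (free_product H K) ->
  exists u, u != v /\ forall w, edge u w -> w = v.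
Proof.
move=> xv [k [kB kD]] [f fB].
apply: contrapT => nleaf.
have kE : forall m, k m = expgz (k 1%R) m := additive_expgz kD.
have K_lift (t : heis F) : exists m : {multiplicative K -> heis F}, m (k 1%R) = t.
  have [k' kK k'K] := kB.
  have mM : {morph (fun b => expgz t (k' b)) : a b / a * b}.
    by move=> a b; rewrite -{1}[a]k'K -{1}[b]k'K -kD kK expgzD.
  by exists (mk_mult mM); rewrite /= kK.
have K_eq (a b : K -> F) : is_hom a -> is_hom b -> a (k 1%R) = b (k 1%R) -> a =1 b.
  move=> ha hb ab q; have [k' _ k'K] := kB; rewrite -[q]k'K kE.
  apply/eqP; rewrite -subr_eq0; apply/eqP; apply: (hom_gen0 (hom_sub ha hb) (S := [set k 1%R]%classic)).
    by move=> _ ->; rewrite ab subrr.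
  by apply: gen_expgz; exact: gen_in.
(* [chi] will be the class that is 1 on the generator of [K] and 0 on [H]. Its pull-back [phi] is
   nonzero at some vertex [u], and [u] is not [v] because [phi] vanishes on [x]. *)
have [m mE] := K_lift (1, 0, 0)%R.
have [chi hchi [cl cr]] := fp_hom_ex (@is_hom0 F H) (heis_hom1 m).
pose phi := chi \o (f \o quot_pi [set x]%classic).
have hphi : is_hom phi by apply: hom_comp.
have phix : phi x = 0%R.
  by rewrite /phi /= quot_pi_rel // multf1 hom1.
have phiv : phi (raag_gen v) = 0%R by have [_ _ /(_ _ hphi)] := xv; move=> <-.
have [u phiu] : exists u, phi (raag_gen u) != 0%R.
  apply: contrapT => nu.
  have phi0 : forall a, phi a = 0%R.
    apply: (raag_hom0 hphi) => u; apply/eqP; apply: contrapT => /negP uu.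
    by apply: nu; exists u.
  have [f' _ f'K] := fB.
  have [a aE] := quot_pi_surj (f' (fp_inr H (k 1%R))).
  have := phi0 a; rewrite /phi /= -aE f'K cr mE => /eqP.
  by rewrite (oner_eq0 F).
have uv : u != v by apply: contraNneq phiu => ->; rewrite phiv.
have [w uw wv] : exists2 w, edge u w & w != v.
  apply: contrapT => nw; apply: nleaf; exists u; split=> // w uw.
  by apply/eqP; apply: contrapT => /negP wv; apply: nw; exists w.
(* Since [w] is not [v], this class vanishes on [x] and descends to the quotient. There its product
   with [chi] is zero, which the edge between [u] and [w] contradicts. *)
have [psi hpsi psiE] := dual_hom w.
have psix : psi x = 0%R.
  have [_ _ /(_ _ hpsi) E] := xv; apply/E.
  by rewrite psiE eq_sym (negbTE wv).
have [psi' hpsi' psi'E] := quot_hom_ex hpsi (S := [set x]%classic) (fun s sx => etrans (congr1 psi sx) psix).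
have [f' [fK f'K]] := mult_inverse fB.
have hpsi'' := hom_comp hpsi' f'.
have cup : cup_trivial chi (psi' \o f').
  apply/fp_cup => //; split.
    exists (fun=> 0%R) => a b /=; rewrite cl mul0r !addr0 //.
  have [e eE] := K_lift (1%R, psi' (f' (fp_inr H (k 1%R))), 0%R).
  apply: (cup_trivial_ext _ _ (ex_intro _ _ (heis_cup e))).
    apply: K_eq; [exact: heis_hom1|exact: (hom_comp hchi)|].
    by rewrite eE /= cr mE.
  apply: K_eq; [exact: heis_hom2|exact: (hom_comp hpsi'')|].
  by rewrite eE.
have cup2 : cup_trivial phi psi.
  have /= c2 := cup_trivial_comp (quot_pi [set x]%classic) (cup_trivial_comp f cup).
  apply: (cup_trivial_ext _ _ c2) => // a.
  by rewrite /= fK psi'E.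
have := cup_commute hphi hpsi cup2 (raag_gen_comm uw).
have uw' : u != w by apply: contraTneq uw => ->; rewrite edge_irrefl.
rewrite !psiE eqxx (negbTE uw') mulr1 mulr0 => /eqP.
by rewrite (negbTE phiu).
Qed.

End InnerPearls.

Section EarGraphs.
Implicit Type n : nat.

Lemma path_edgeE n (i j : 'I_n) :
  @edge (path_graph n) i j = (j == i.+1 :> nat) || (i == j.+1 :> nat).
Proof. by []. Qed.

Lemma path_triangle_free n : triangle_free (path_graph n).
Proof.
move=> u v w; rewrite !path_edgeE => /orP [] /eqP E1 /orP [] /eqP E2;
  apply/negP => /orP [] /eqP E3; lia.
Qed.

Lemma path_square_free n : square_free (path_graph n).
Proof.
move=> a b c d ac bd; rewrite !path_edgeE => /orP [] /eqP E1 /orP [] /eqP E2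
  /orP [] /eqP E3; apply/negP => /orP [] /eqP E4; move: ac bd;
  rewrite -!val_eqE /=; lia.
Qed.

Lemma cycle_edgeE n (i j : 'I_n) : 2 < n -> @edge (cycle_graph n) i j =
  [|| j == i.+1 :> nat, i == j.+1 :> nat, (i == 0 :> nat) && (j == n.-1 :> nat)
    | (j == 0 :> nat) && (i == n.-1 :> nat)].
Proof.
move=> n2; rewrite /edge /= /cycle_edge -val_eqE /=.
have S (k : 'I_n) : (k.+1 %% n = if k.+1 == n then 0 else k.+1)%N.
  have kn := ltn_ord k; case: eqP => [->|ne]; first exact: modnn.
  by rewrite modn_small //; lia.
rewrite !S; have := ltn_ord i; have := ltn_ord j.
by case: ifP => /eqP; case: ifP => /eqP; lia.
Qed.

Lemma cycle_neighbours n (i j : 'I_n) : 2 < n -> @edge (cycle_graph n) i j ->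
  j = (if i == 0 :> nat then n else i).-1 :> nat \/
  j = (if i.+1 == n then 0 else i.+1) :> nat.
Proof.
move=> n2; rewrite cycle_edgeE //; have := ltn_ord i; have := ltn_ord j.
by case: ifP => /eqP; case: ifP => /eqP; lia.
Qed.

Lemma cycle_triangle_free n : 3 < n -> triangle_free (cycle_graph n).
Proof.
move=> n3 u v w; have n2 : 2 < n by lia.
rewrite !cycle_edgeE //.
have := ltn_ord u; have := ltn_ord v; have := ltn_ord w; lia.
Qed.

Lemma cycle_square_free n : 4 < n -> square_free (cycle_graph n).
Proof.
move=> n3 a b c d; have n2 : 2 < n by lia.
rewrite !cycle_edgeE //.
rewrite -!val_eqE /=.
have := ltn_ord a; have := ltn_ord b; have := ltn_ord c; have := ltn_ord d; lia.
Qed.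

Lemma cycle_connected n (P : 'I_n -> Prop) : 2 < n -> (exists i, P i) ->
  (forall i j, P i -> @edge (cycle_graph n) i j -> P j) -> forall i, P i.
Proof.
move=> n2 [i0 Pi0] H.
have n0 : 0 < n by lia.
have up k (kn : k < n) : i0 <= k -> P (Ordinal kn).
  elim: k kn => [|k IH] kn i0k.
    by have -> : Ordinal kn = i0 by apply: val_inj => /=; lia.
  case: (eqVneq (i0 : nat) k.+1) => [E|ne].
    by have -> : Ordinal kn = i0 by apply: val_inj.
  have kn' : k < n by lia.
  apply: (H (Ordinal kn')); first by apply: IH; lia.
  by rewrite cycle_edgeE //= eqxx.
have P0 : P (Ordinal n0).
  have ln : n.-1 < n by lia.
  apply: (H (Ordinal ln)); first by apply: up; have := ltn_ord i0; lia.
  by rewrite cycle_edgeE //= !eqxx !orbT.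
move=> [k kn]; elim: k kn => [|k IH] kn.
  by have -> : Ordinal kn = Ordinal n0 by apply: val_inj.
have kn' : k < n by lia.
by apply: (H (Ordinal kn') _ (IH kn')); rewrite cycle_edgeE //= eqxx.
Qed.

Lemma path_interior_connected n (P : 'I_n -> Prop) :
  (exists2 i, P i & 0 < i < n.-1) ->
  (forall i j, P i -> @edge (path_graph n) i j -> 0 < j < n.-1 -> P j) ->
  forall i : 'I_n, 0 < i < n.-1 -> P i.
Proof.
move=> [i0 Pi0 i0n] H.
have up k (kn : k < n) : i0 <= k -> k < n.-1 -> P (Ordinal kn).
  elim: k kn => [|k IH] kn i0k kn1.
    by have -> : Ordinal kn = i0 by apply: val_inj => /=; lia.
  case: (eqVneq (i0 : nat) k.+1) => [E|ne].
    by have -> : Ordinal kn = i0 by apply: val_inj.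
  have kn' : k < n by lia.
  apply: (H (Ordinal kn')); first by apply: IH; lia.
    by rewrite path_edgeE /= eqxx.
  by rewrite /=; lia.
have down d (k : 'I_n) : (k + d)%N = i0 -> 0 < k -> P k.
  elim: d k => [|d IH] k E k0.
    by have -> : k = i0 by apply: val_inj => /=; lia.
  have kn' : k.+1 < n by have := ltn_ord i0; lia.
  apply: (H (Ordinal kn')); first by apply: IH => //=; lia.
    by rewrite path_edgeE /= eqxx orbT.
  by have := ltn_ord i0; lia.
move=> i /andP [i1 i2]; case: (leqP i0 i) => ii.
  by have := up i (ltn_ord i) ii i2; congr P; apply: val_inj.
by apply: (down (i0 - i)%N) => //; lia.
Qed.

End EarGraphs.

Section Decorations.
Import mathcomp.boot.fintype mathcomp.boot.finset GRing.Theory.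
Local Open Scope group_scope.
Variable F : finFieldType.

Definition pearl_at (G : groupType) n (ps : seq G) (i : 'I_n) : G := nth 1 ps i.

Lemma coh_point (ps : seq (raag (path_graph 1))) :
  (exists p, ps = [:: p] /\ gen [set p]%classic = classical_sets.setT) ->
  coh F (pearl_at ps : path_graph 1 -> _).
Proof.
move=> [p [-> pT]]; apply: coh_spanning => [x y|phi hphi H a].
  by rewrite !ord1 edge_irrefl.
have : gen [set p]%classic a by rewrite pT.
by apply: (hom_gen0 hphi) => _ ->; exact: (H ord0).
Qed.

Lemma commute_parabolicT (X : simple_graph) (a b : raag X) :
  (forall u w : X, u = w \/ edge u w) -> commute a b.
Proof.
move=> H; apply: (@parabolic_clique_commute X [set: X]) => //; exact: parabolicT.
Qed.

Lemma coh_path2 (ps : seq (raag (path_graph 2))) : path_pearl_chain 2 ps ->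
  coh F (pearl_at ps : path_graph 2 -> _).
Proof.
case=> _ /= ch.
have cl (u w : path_graph 2) : u = w \/ edge u w.
  rewrite path_edgeE; case: (eqVneq u w) => [|uw]; [by left|right].
  by move: uw; rewrite -val_eqE /=; have := ltn_ord u; have := ltn_ord w; lia.
apply: coh_spanning => [x y _|phi hphi H a]; first exact: commute_parabolicT.
have := @chain_Z2_gen _ (raag_gen (ord0 : path_graph 2)) (raag_gen (ord_max : path_graph 2)) _ _ _ _ ch a.
move=> G; apply: (hom_gen0 hphi _ (G _ _)).
- by move=> _ [->|->]; [exact: (H ord0)|exact: (H ord_max)].
- exact: commute_parabolicT.
- move=> q; elim: (raag_generated q) => {q} [_ [v ->]||x y _ [k [l ->]] _ [k' [l' ->]]|x _ [k [l ->]]].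
  + case: (eqVneq v ord0) => [->|v0]; first by exists 1%R, 0%R; rewrite /= expg1 expg0 mulg1.
    exists 0%R, 1%R; rewrite /= expg1 expg0 mul1g.
    have -> // : v = ord_max.
    by apply: val_inj; move: v0; rewrite -val_eqE /=; have := ltn_ord v; lia.
  + by exists 0%R, 0%R; rewrite /= !expg0 mulg1.
  + exists (k + k')%R, (l + l')%R; rewrite !expgzD -!mulgA; congr (_ * _).
    rewrite !mulgA; congr (_ * _); exact: commute_parabolicT.
  + exists (- k)%R, (- l)%R; rewrite !expgzN invgM; exact: commute_parabolicT.
Qed.

Lemma coh_cycle3 (ps : seq (raag (cycle_graph 3))) : cycle_pearl_chain 3 ps ->
  coh F (pearl_at ps : cycle_graph 3 -> _).
Proof.
case=> _ /= [[f [fB fD]] ch].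
have cl (u w : cycle_graph 3) : u = w \/ edge u w.
  rewrite cycle_edgeE //; case: (eqVneq u w) => [|uw]; [by left|right].
  by move: uw; rewrite -val_eqE /=; have := ltn_ord u; have := ltn_ord w; lia.
apply: coh_spanning => [x y _|phi hphi H a]; first exact: commute_parabolicT.
set p3 := nth 1 ps 2 in f fB fD ch.
have [phi' hphi' E] := quot_hom_ex hphi (S := [set p3]%classic)
  (fun s sx => etrans (congr1 phi sx) (H (Ordinal (isT : 2 < 3)))).
rewrite -E; apply: (hom_gen0 hphi' _ (chain_Z2_gen (u := f (1, 0)%R) (v := f (0, 1)%R) _ _ ch _)).
- move=> _ [->|->]; rewrite E; [exact: (H (Ordinal (isT : 0 < 3)))|exact: (H (Ordinal (isT : 1 < 3)))].
- by rewrite /commute -!fD; congr f.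
- move=> q; have [f' fK f'K] := fB; case E': (f' q) => [k l].
  exists k, l; rewrite -[q]f'K E'.
  have f1 := additive_expgz (f := fun m => f (m, 0)%R) (fun m m' => _).
  have f2 := additive_expgz (f := fun m => f (0, m)%R) (fun m m' => _).
  rewrite -f1 => [|m m']; last by rewrite -fD /= ; congr f; congr pair; rewrite addr0.
  rewrite -f2 => [|m m']; last by rewrite -fD /= ; congr f; congr pair; rewrite addr0.
  by rewrite -fD; congr f; congr pair; rewrite /= ?addr0 ?add0r.
Qed.

(** The vertex attached to a nontrivial [p2] has two neighbours, so it is the middle one and its
    star is the whole path. Hence [p2] is central and the three pearls generate. *)
Lemma coh_path3 (ps : seq (raag (path_graph 3))) : path_pearl_chain 3 ps ->
  coh F (pearl_at ps : path_graph 3 -> _).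
Proof.
case=> _ /= [nab _ cE].
set p1 := nth 1 ps 0 in cE; set p2 := nth 1 ps 1 in nab cE; set p3 := nth 1 ps 2 in cE.
have c1 : commute p1 p2.
  by have : centralizer p2 p1 by rewrite cE; apply: gen_in; left; left.
have c3 : commute p3 p2.
  by have : centralizer p2 p3 by rewrite cE; apply: gen_in; right.
apply: coh_spanning => [x y|phi hphi H a].
  rewrite path_edgeE /pearl_at; move: (ltn_ord x) (ltn_ord y).
  case: (nat_of_ord x) => [|[|[|i]]]; case: (nat_of_ord y) => [|[|[|j]]] //= _ _ _;
    rewrite -/p1 -/p2 -/p3 //; exact: commute_sym.
have cT : centralizer p2 a.
  case: (pselect (p2 = 1)) => [->|p21]; first exact: commute1.
  have [v [g [xv [u [w [vu vw uw]]]]]] :=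
    nonabelian_centralizer (@path_triangle_free 3) (@path_square_free 3) p21 nab.
  apply/commute_sym/(vertex_like_centralizer xv); apply: parabolicS (parabolicT _).
  apply/subsetP => t _; rewrite !inE; move: vu vw uw; rewrite !path_edgeE -!val_eqE /=.
  have := ltn_ord u; have := ltn_ord v; have := ltn_ord w; have := ltn_ord t; lia.
rewrite cE in cT; apply: (hom_gen0 hphi _ cT) => _ [[->|->]|->].
- exact: (H (Ordinal (isT : 0 < 3))).
- exact: (H (Ordinal (isT : 1 < 3))).
- exact: (H (Ordinal (isT : 2 < 3))).
Qed.

End Decorations.

Section LongDecorations.
Import mathcomp.boot.fintype mathcomp.boot.finset GRing.Theory.
Local Open Scope group_scope.
Variable F : finFieldType.

Lemma cond_T_cover (G : groupType) (x y z : G) (phi : G -> F) : is_hom phi ->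
  cond_T y x z -> phi x = 0%R -> phi y = 0%R -> phi z = 0%R ->
  forall a, centralizer x a -> phi a = 0%R.
Proof.
move=> hphi [_ _ _ gm] x0 y0 z0 a /gm [h gh gx].
have h0 : phi h = 0%R by apply: (hom_gen0 hphi _ gh) => _ [->|->].
have := hom_gen0 hphi _ gx; rewrite hphi homV // h0 oppr0 add0r; apply.
by move=> _ ->.
Qed.

(** The classification excludes squares, but this group is the product of the free groups on the
    even and on the odd vertices. An element with non-abelian centralizer lies in one factor. The
    pearls do not all lie in the same factor: the centralizer of the first one is generated by
    pearls and contains the other factor. The centralizers of one pearl from each factor then
    contain all vertices. *)
Lemma coh_cycle4 (ps : seq (raag (cycle_graph 4))) : cycle_pearl_chain 4 ps ->
  coh F (pearl_at ps : cycle_graph 4 -> _).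
Proof.
case=> _ /= ch.
pose o k (k4 : k < 4) : cycle_graph 4 := Ordinal k4.
pose od : cycle_graph 4 -> bool := fun v : 'I_4 => odd v.
pose S : {set cycle_graph 4} := [set v | ~~ od v]%SET.
pose T : {set cycle_graph 4} := [set v | od v]%SET.
have E u w : edge u w = (od u != od w).
  rewrite cycle_edgeE // /od; move: (ltn_ord u) (ltn_ord w).
  by case: (nat_of_ord u) => [|[|[|[|k]]]] //; case: (nat_of_ord w) => [|[|[|[|l]]]].
have iS : independent S.
  by move=> u w; rewrite !inE E => /negbTE -> /negbTE ->.
have iT : independent T by move=> u w; rewrite !inE E => -> ->.
have dST : [disjoint S & T].
  by apply/pred0P => u; rewrite /= !inE; case: (od u).
have jST u w : u \in S -> w \in T -> edge u w.
  by rewrite !inE E => /negbTE -> ->.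
have ST : S :|: T = [set: cycle_graph 4].
  by apply/setP => u; rewrite !inE; case: (od u).
have full a : parabolic (S :|: T) a by rewrite ST; exact: parabolicT.
have factor x : nonabelian (centralizer x) -> parabolic S x \/ parabolic T x.
  move=> [y [z [/commute_sym xy /commute_sym xz nyz]]].
  have xE := parabolic_joinE dST jST (full x).
  case: (pselect (retract S x = 1)) => [S1|S1].
    by right; rewrite xE S1 mul1g; exact: retractP.
  case: (pselect (retract T x = 1)) => [T1|T1].
    by left; rewrite xE T1 mulg1; exact: retractP.
  case: nyz; apply: (join_commute dST jST (full y) (full z)).
    by apply: (independent_centralizer iS S1); try exact: retractP; exact: retract_commute.
  by apply: (independent_centralizer iT T1); try exact: retractP; exact: retract_commute.
have centT x w : parabolic S x -> w \in T -> centralizer x (raag_gen w).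
  move=> Sx wT; apply/commute_sym.
  by apply: (parabolic_join_commute jST Sx); exact: parabolic_gen.
have centS x w : parabolic T x -> w \in S -> centralizer x (raag_gen w).
  move=> Tx wS; apply: (parabolic_join_commute jST _ Tx); exact: parabolic_gen.
have ch1 := ch 1%N isT; have ch2 := ch 2 isT; have ch3 := ch 3 isT; have ch4 := ch 4 isT.
rewrite /= in ch1 ch2 ch3 ch4.
set p1 := nth 1 ps 0 in ch1 ch2 ch3 ch4; set p2 := nth 1 ps 1 in ch1 ch2 ch3 ch4.
set p3 := nth 1 ps 2 in ch1 ch2 ch3 ch4; set p4 := nth 1 ps 3 in ch1 ch2 ch3 ch4.
move: ch1 ch2 ch3 ch4 => [n1 c1 _ _] [n2 c2 _ _] [n3 c3 _ _] [n4 c4 _ _].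
have cm (a b x : raag (cycle_graph 4)) : centralizer x = gen [set a; x; b]%classic -> commute a x /\ commute b x.
  move=> cx; have : centralizer x a by rewrite cx; apply: gen_in; left; left.
  have : centralizer x b by rewrite cx; apply: gen_in; right.
  by [].
have [c41 c21] := cm _ _ _ c1; have [c12 c32] := cm _ _ _ c2.
have [c23 c43] := cm _ _ _ c3; have [c34 c14] := cm _ _ _ c4.
apply: coh_spanning => [x y|phi hphi H a].
  rewrite cycle_edgeE // /pearl_at; move: (ltn_ord x) (ltn_ord y).
  by case: (nat_of_ord x) => [|[|[|[|i]]]]; case: (nat_of_ord y) => [|[|[|[|j]]]].
have h1 : phi p1 = 0%R by exact: (H (o 0 isT)).
have h2 : phi p2 = 0%R by exact: (H (o 1%N isT)).
have h3 : phi p3 = 0%R by exact: (H (o 2 isT)).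
have h4 : phi p4 = 0%R by exact: (H (o 3 isT)).
have cover x y z b : phi y = 0%R -> phi x = 0%R -> phi z = 0%R ->
    centralizer x = gen [set y; x; z]%classic -> centralizer x b -> phi b = 0%R.
  move=> y0 x0 z0 cx; rewrite cx => gb.
  by apply: (hom_gen0 hphi _ gb) => _ [[->|->]|->].
have cov1 b := cover p1 p4 p2 b h4 h1 h2 c1.
have cov2 b := cover p2 p1 p3 b h1 h2 h3 c2.
have cov3 b := cover p3 p2 p4 b h2 h3 h4 c3.
have cov4 b := cover p4 p3 p1 b h3 h4 h1 c4.
have covP P : [\/ P p1, P p2, P p3 | P p4] ->
    exists2 x, P x & forall b, centralizer x b -> phi b = 0%R.
  by case; [exists p1|exists p2|exists p3|exists p4].
have [gen1 gen3] : ~ parabolic S (raag_gen (o 1%N isT)) /\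
    ~ parabolic T (raag_gen (o 0 isT)).
  have gen_neq1 v : @raag_gen (cycle_graph 4) v <> 1.
    move=> v1; have [f hf fE] := @dual_hom F (cycle_graph 4) v.
    have := fE v; rewrite v1 hom1 // eqxx => /eqP.
    by rewrite eq_sym oner_eq0.
  by split; rewrite /parabolic /= retract_gen inE /= => /esym/gen_neq1.
have someT : [\/ parabolic T p1, parabolic T p2, parabolic T p3 | parabolic T p4].
  case: (factor _ n1) => [S1|]; last by constructor 1.
  case: (factor _ n2) => [S2|]; last by constructor 2.
  case: (factor _ n3) => [S3|]; last by constructor 3.
  case: (factor _ n4) => [S4|]; last by constructor 4.
  case: gen1; have := centT p1 (o 1%N isT) S1; rewrite inE => /(_ isT).
  rewrite c1; elim=> // {a} [_ [[->|->]|->] //||x y _ Sx _ Sy|x _ Sx].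
  - by rewrite /parabolic /= multf1.
  - exact: parabolicM.
  - exact: parabolicV.
have someS : [\/ parabolic S p1, parabolic S p2, parabolic S p3 | parabolic S p4].
  case: (factor _ n1) => [|S1]; first by constructor 1.
  case: (factor _ n2) => [|S2]; first by constructor 2.
  case: (factor _ n3) => [|S3]; first by constructor 3.
  case: (factor _ n4) => [|S4]; first by constructor 4.
  case: gen3; have := centS p1 (o 0 isT) S1; rewrite inE => /(_ isT).
  rewrite c1; elim=> // {a} [_ [[->|->]|->] //||x y _ Sx _ Sy|x _ Sx].
  - by rewrite /parabolic /= multf1.
  - exact: parabolicM.
  - exact: parabolicV.
have [x Tx xc] := covP _ someT; have [y Sy yc] := covP _ someS.
apply: (raag_hom0 hphi) => v; case: (boolP (v \in S)) => [vS|vS].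
  exact/xc/centS.
by apply/yc/centT => //; move: vS; rewrite !inE negbK.
Qed.

(** Three pearls span the classes on the centralizer of the middle one, which contains conjugates of
    all neighbours of its vertex. So the vertices attached to pearls are closed under adjacency, and
    the cycle is connected. *)
Lemma coh_long_cycle m (ps : seq (raag (cycle_graph m.+4.+1))) :
  cycle_pearl_chain m.+4.+1 ps -> coh F (pearl_at ps : cycle_graph m.+4.+1 -> _).
Proof.
case=> _ /= ch; set n := m.+4.+1 in ch *.
have n2 : 2 < n by [].
have tf := @cycle_triangle_free n isT; have sf := @cycle_square_free n isT.
have T (i : 'I_n) : exists j k : 'I_n,
    cond_T (pearl_at ps j) (pearl_at ps i) (pearl_at ps k) /\
    forall l : 'I_n, @edge (cycle_graph n) i l -> l = j \/ l = k.
  have := ch i.+1 (ltn_ord i) => /=.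
  have jn : ((if i == 0 :> nat then n else i).-1 < n)%N.
    by have := ltn_ord i; case: ifP; lia.
  have kn : ((if i.+1 == n then 0 else i.+1) < n)%N.
    by have := ltn_ord i; case: ifP; lia.
  move=> H; exists (Ordinal jn), (Ordinal kn); split.
    rewrite /pearl_at /=; move: H; rewrite eqSS; case: (nat_of_ord i) => [|i'] /=.
      by [].
    by case: ifP.
  move=> l /(cycle_neighbours n2) [E|E]; [left|right]; exact: val_inj.
pose q : cycle_graph n -> raag (cycle_graph n) := pearl_at ps.
have inn (i : 'I_n) : exists v, inner_pearl F (q i) v.
  have [j [k [[_ [cI _ _] _ _] _]]] := T i.
  by have [v [qv _]] := cond_I_inner F tf sf cI; exists v.
apply: coh_spanning => [x y|phi hphi H].
  move=> xy; have [j [k [[_ _ [cj ck] _] nb]]] := T x.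
  by apply/commute_sym; case: (nb y xy) => ->.
apply: (raag_hom0 hphi) => v.
suff [i [g _ qv]] : exists i, inner_pearl F (q i) v by apply/qv.
apply: (@cycle_connected n (fun v => exists i, inner_pearl F (q i) v)) => //.
  have [w qw] := inn ord0; by exists w, ord0.
move=> {}v w [i qv] vw; have [j [k [cT _]]] := T i.
have [|||s [l ->] qw] := @inner_star_covered F (cycle_graph n)
    (fun s => exists l, s = q l) (q i) v w qv.
- move=> psi hpsi psi0; apply: (cond_T_cover hpsi cT); apply: psi0.
  + by exists i.
  + by exists j.
  + by exists k.
- by rewrite !inE vw orbT.
- by move=> _ [l ->]; exact: inn.
by exists l.
Qed.

End LongDecorations.

Section LongPaths.
Import mathcomp.boot.fintype mathcomp.boot.finset GRing.Theory.
Local Open Scope group_scope.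
Variable F : finFieldType.

(** The end pearls are not known to satisfy (I) and have no vertex attached, so the argument for
    cycles breaks down at the pearls next to them. There the free splitting places the vertex next
    to an end of the path; it has one inner neighbour, which must belong to the adjacent inner
    pearl. *)
Lemma coh_long_path m (ps : seq (raag (path_graph m.+4))) :
  path_pearl_chain m.+4 ps -> coh F (pearl_at ps : path_graph m.+4 -> _).
Proof.
case=> _ /= [cE1 cE2 cT]; set n := m.+4 in cT *.
have tf := @path_triangle_free n; have sf := @path_square_free n.
pose q k := nth 1 ps k.
have chain k : 0 < k < n.-1 -> [/\ cond_I (q k), commute (q k.-1) (q k),
    commute (q k.+1) (q k)
  & forall phi : raag (path_graph n) -> F, is_hom phi ->
    phi (q k.-1) = 0%R -> phi (q k) = 0%R -> phi (q k.+1) = 0%R ->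
    forall a, centralizer (q k) a -> phi a = 0%R].
  move=> kn.
  have fromE (x y z : raag (path_graph n)) : cond_E x y z -> [/\ cond_I y, commute x y, commute z y
      & forall phi : raag (path_graph n) -> F, is_hom phi ->
        phi x = 0%R -> phi y = 0%R -> phi z = 0%R ->
        forall a, centralizer y a -> phi a = 0%R].
    case=> [[Iy _ yz _] cy _]; split=> //.
    - by have : centralizer y x by rewrite cy; apply: gen_in; left; left.
    - move=> phi hphi x0 y0 z0 a; rewrite cy => ga.
      by apply: (hom_gen0 hphi _ ga) => _ [[->|->]|->].
  case: (eqVneq k 1%N) kn => [-> _|k1 kn]; first exact: fromE cE1.
  case: (eqVneq k m.+2) => [->|k2].
    have [I c1 c2 cov] := fromE _ _ _ cE2; split=> // phi hphi x0 y0 z0 a.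
    exact: (cov phi hphi z0 y0 x0).
  (* [q] counts the pearls from 0, the chain condition from 1. *)
  have := cT k.+1; rewrite /= => T'.
  have T : cond_T (q k.-1) (q k) (q k.+1).
    by apply: T'; rewrite /n in kn *; lia.
  have [_ [Ik _ _] [c1 c2] _] := T; split=> // phi hphi x0 y0 z0.
  exact: cond_T_cover T y0 x0 z0.
have inn k : 0 < k < n.-1 -> exists2 v : 'I_n, inner_pearl F (q k) v & 0 < v < n.-1.
  case/chain => Ik _ _ _; have [v [qv [u [w [vu vw uw]]]]] := cond_I_inner F tf sf Ik.
  exists v => //; move: vu vw uw; rewrite !path_edgeE -val_eqE /=.
  have := ltn_ord u; have := ltn_ord v; have := ltn_ord w; clear; lia.
have leaf (x y z : raag (path_graph n)) (v : path_graph n) : cond_E x y z -> inner_pearl F y v ->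
    v = 1%N :> nat \/ v = m.+2 :> nat.
  move=> [_ _ [H [K [_ Kz Qi]]]] yv.
  have [u [uv uw]] := free_splitting_leaf yv Kz Qi.
  have uS (w : 'I_n) : @edge (path_graph n) u w -> w = v :> nat by move/uw => ->.
  case: (eqVneq (u : nat) 0) => [u0|u0].
    have := uS (Ordinal (isT : 1 < n)); rewrite path_edgeE u0 /= => <- //.
    by left.
  have un := ltn_ord u; have u1 : u.-1 < n by lia.
  have := uS (Ordinal u1); rewrite path_edgeE /=.
  have -> : (u == u.-1.+1 :> nat) by apply/eqP; lia.
  rewrite orbT => /(_ isT) vE.
  case: (eqVneq (u : nat) n.-1) => [uE|uE]; first by right; rewrite -vE uE.
  have u2 : u.+1 < n by lia.
  have := uS (Ordinal u2); rewrite path_edgeE /= eqxx => /(_ isT).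
  by rewrite -vE; lia.
have spread k v (w : 'I_n) : 0 < k < n.-1 -> inner_pearl F (q k) v ->
    @edge (path_graph n) v w -> 0 < w < n.-1 ->
    exists2 l, 0 < l < n.-1 & inner_pearl F (q l) w.
  move=> kn qv vw wn; have [_ c1 c2 cov] := chain k kn.
  have twin l : 0 < l < n.-1 -> centralizer (q k) (q l) ->
      (v = 1%N :> nat \/ v = m.+2 :> nat) ->
      (forall t, inner_pearl F (q l) t -> v != t) ->
      exists2 l, 0 < l < n.-1 & inner_pearl F (q l) w.
    move=> ln cl vE dist; have [t lt tn] := inn l ln; exists l => //.
    have tv := inner_adjacent qv lt cl; have vt := dist t lt.
    have -> // : w = t.
    apply: val_inj; move: vw wn tn tv vE vt; rewrite !inE path_edgeE path_edgeE -!val_eqE /=.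
    by rewrite /n; clear; lia.
  case: (eqVneq k 1%N) => [k1|k1].
    rewrite k1 in qv c2 twin; apply: (twin 2) => //; first exact: leaf cE1 qv.
    by move=> t qt; have [adj _ _] := cE1; exact: adjacent_inner_distinct qv qt adj.
  case: (eqVneq k m.+2) => [k2|k2].
    rewrite k2 in qv c1 twin; apply: (twin m.+1) => //.
    + by rewrite /n; lia.
    + exact: leaf cE2 qv.
    by move=> t qt; have [adj _ _] := cE2; exact: adjacent_inner_distinct qv qt adj.
  have ks : 0 < k.-1 < n.-1 /\ 0 < k.+1 < n.-1 by rewrite /n in kn *; lia.
  have [|||s [l ln ->] qw] := @inner_star_covered F (path_graph n)
      (fun s => exists2 l, 0 < l < n.-1 & s = q l) (q k) v w qv.
  - move=> psi hpsi psi0; apply: cov => //; apply: psi0.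
    + by exists k.-1 => //; case: ks.
    + by exists k.
    + by exists k.+1 => //; case: ks.
  - by rewrite !inE vw orbT.
  - by move=> _ [l /inn [t lt _] ->]; exists t.
  by exists l.
apply: coh_spanning => [x y|phi hphi H].
  have comm k : k.+1 < n -> commute (q k) (q k.+1).
    move=> kn; case: (posnP k) => [->|k0].
      by have [//|_ c _ _] := chain 1%N.
    by have [|_ _ c _] := chain k; [rewrite k0 /=; lia|exact: commute_sym].
  rewrite path_edgeE => /orP [] /eqP E; rewrite /pearl_at -!/(q _) E.
    by apply: comm; rewrite -E.
  by apply/commute_sym/comm; rewrite -E.
have q0 k : k < n -> phi (q k) = 0%R by move=> kn; exact: (H (Ordinal kn)).
have all_inner (v : 'I_n) : 0 < v < n.-1 ->
    exists2 l, 0 < l < n.-1 & inner_pearl F (q l) v.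
  apply: (@path_interior_connected n (fun v => exists2 l, 0 < l < n.-1 & inner_pearl F (q l) v)).
    have [//|u qu un] := inn 1%N; by exists u => //; exists 1%N.
  by move=> i j [l ln qi] ij jn; exact: spread ln qi ij jn.
have star0 (v w : 'I_n) : 0 < v < n.-1 -> w \in @star (path_graph n) v ->
    phi (raag_gen (w : path_graph n)) = 0%R.
  move=> /all_inner [l ln qv] wv.
  apply: (inner_centralizer0 qv hphi).1 => //; have [_ _ _ cov] := chain l ln.
  by apply: cov => //; apply: q0; lia.
apply: (raag_hom0 hphi) => v; have vn := ltn_ord v.
case: (posnP v) => [v0|v0].
  apply: (star0 (Ordinal (isT : 1 < n))) => //.
  by rewrite !inE path_edgeE /= v0 orbT.
case: (eqVneq (v : nat) n.-1) => [vE|vE]; last first.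
  by apply: (star0 v); [lia|rewrite !inE eqxx].
have n2 : m.+2 < n by [].
apply: (star0 (Ordinal n2)); first by rewrite /=; lia.
by rewrite !inE path_edgeE /= vE eqxx orbT.
Qed.

End LongPaths.

(** * From projections to minors *)

Section PieceCohomology.
Import mathcomp.boot.fintype mathcomp.boot.finset GRing.Theory.
Local Open Scope group_scope.
Variable F : finFieldType.

Lemma mem_zip_behead (T : eqType) (x0 : T) (s : seq T) l :
  l \in zip s (behead s) <->
  exists2 i, i.+1 < size s & l = (nth x0 s i, nth x0 s i.+1).
Proof.
split=> [/(nthP (x0, x0)) [i]|[i is_s ->]].
  rewrite size_zip size_behead => isz; rewrite nth_zip_cond size_zip size_behead isz.
  by rewrite /= nth_behead => <-; exists i => //; lia.
apply/(nthP (x0, x0)); exists i.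
  by rewrite size_zip size_behead; lia.
by rewrite nth_zip_cond size_zip size_behead ifT /= ?nth_behead //; lia.
Qed.

Lemma mem_zip_rot (T : eqType) (x0 : T) (s : seq T) l :
  l \in zip s (rot 1 s) <->
  exists2 i, i < size s & l = (nth x0 s i, nth x0 s (if i.+1 == size s then 0 else i.+1)).
Proof.
have N i : i < size s -> nth x0 (rot 1 s) i =
    nth x0 s (if i.+1 == size s then 0 else i.+1).
  case: s => [//|x s] /= si; rewrite rot1_cons nth_rcons eqSS.
  case: eqP => [->|ne]; first by rewrite ltnn.
  by rewrite /= ifT //; lia.
split=> [/(nthP (x0, x0)) [i]|[i is_s ->]].
  rewrite size_zip size_rot minnn => isz; rewrite nth_zip ?size_rot // N // => <-.
  by exists i.
apply/(nthP (x0, x0)); exists i; first by rewrite size_zip size_rot minnn.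
by rewrite nth_zip ?size_rot // N.
Qed.

Section CohOnOfCoh.
Variables (n : nat) (e : rel 'I_n) (e_sym : symmetric e) (e_irrefl : irreflexive e).
Variables (G : groupType) (ps : seq G) (L : seq (G * G)) (succ : rel 'I_n).
Hypothesis size_ps : size ps = n.
Hypothesis LE : forall l, l \in L <->
  exists i j : 'I_n, succ i j /\ l = (nth 1 ps i, nth 1 ps j).
Hypothesis e_succ : forall i j, e i j = succ i j || succ j i.

Lemma coh_on_of_coh :
  coh F (pearl_at ps : SimpleGraph e_sym e_irrefl -> G) -> coh_on F ps L.
Proof.
move=> c; have inj := pi_inj c; case: c => c1 c2 c3.
have mem p : p \in ps -> exists i : 'I_n, p = nth 1 ps i.
  by move=> /(nthP 1) [i]; rewrite size_ps => ni <-; exists (Ordinal ni).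
have memN (i : 'I_n) : nth 1 ps i \in ps by rewrite mem_nth // size_ps.
split.
- move=> f; have [phi hphi phiE] := c1 (fun i => f (nth 1 ps (i : 'I_n))).
  by exists phi => // p /mem [i ->]; exact: (phiE i).
- by move=> phi hphi H; apply: c2 => // i; exact/H/memN.
- move=> phi psi hphi hpsi; rewrite c3 //; split=> H.
    move=> l /LE [i [j [ij ->]]] /=; apply: (H i j).
    by rewrite /edge /= e_succ ij.
  move=> i j; rewrite /edge /= e_succ => /orP [ij|ji].
    by apply: (H (nth 1 ps i, nth 1 ps j)); apply/LE; exists i, j.
  apply/esym/(H (nth 1 ps j, nth 1 ps i)); apply/LE; by exists j, i.
- move=> l /LE [i [j [ij ->]]] /=; split; try exact: memN.
  apply/eqP => /(inj i j) E.
  by have := e_irrefl i; rewrite e_succ {2}E ij.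
Qed.

End CohOnOfCoh.

Lemma coh_on_path n (ps : seq (raag (path_graph n))) : size ps = n ->
  coh F (pearl_at ps : path_graph n -> _) -> coh_on F ps (zip ps (behead ps)).
Proof.
move=> sz; apply: (coh_on_of_coh (succ := fun i j : 'I_n => j == i.+1 :> nat)) => //.
move=> l; rewrite (mem_zip_behead 1) sz; split=> [[i ni ->]|[i [j [/eqP ij ->]]]].
  by exists (Ordinal (ltnW ni)), (Ordinal ni); rewrite /= eqxx.
by exists i; rewrite -ij.
Qed.

Lemma coh_on_cycle n (ps : seq (raag (cycle_graph n))) : 2 < n -> size ps = n ->
  coh F (pearl_at ps : cycle_graph n -> _) -> coh_on F ps (zip ps (rot 1 ps)).
Proof.
move=> n2 sz; apply: (coh_on_of_coh (succ := fun i j : 'I_n =>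
  j == (if i.+1 == n then 0 else i.+1) :> nat)) => //.
  move=> l; rewrite (mem_zip_rot 1) sz; split=> [[i ni ->]|[i [j [/eqP ij ->]]]].
    have nj : (if i.+1 == n then 0 else i.+1) < n by case: ifP; lia.
    by exists (Ordinal ni), (Ordinal nj); rewrite /= eqxx.
  by exists i; rewrite -?ij.
move=> i j; rewrite -[cycle_edge i j]/(@edge (cycle_graph n) i j) cycle_edgeE //.
have := ltn_ord i; have := ltn_ord j.
by case: ifP => /eqP; case: ifP => /eqP; lia.
Qed.

Lemma coh_on_decoration s (ps : seq (raag (piece_graph s))) : decoration ps ->
  coh_on F ps (consecutive s ps) /\
  [/\ head 1 ps \in ps, last 1 ps \in ps & is_path s -> head 1 ps != last 1 ps].
Proof.
have ends (T : eqType) (x0 : T) (t : seq T) : 0 < size t -> head x0 t \in t /\ last x0 t \in t.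
  by case: t => //= x t _; rewrite inE eqxx mem_last.
case: s ps => [|n|n] ps.
- move=> H; have [p [E _]] := H; have c := coh_point F H.
  split; first by apply: coh_on_path c; rewrite E.
  by rewrite E /= !inE eqxx.
- case=> n2 H; have [sz _] := H.
  have c : coh F (pearl_at ps : path_graph n -> _).
    case: n ps n2 H {sz} => [|[|[|[|m]]]] ps // _ H; try exact: coh_path2.
    - exact: coh_path3.
    - exact: coh_long_path.
  split; first exact: coh_on_path.
  have [|? ?] := ends _ 1 ps; [by rewrite sz; lia|split=> // _].
  have n0 : 0 < n by lia.
  have n1 : n.-1 < n by lia.
  rewrite -nth0 -nth_last sz; apply/eqP => /(@pi_inj _ _ _ _ c (Ordinal n0) (Ordinal n1)).
  by move=> /(congr1 val) /=; lia.
- case=> n3 H; have [sz _] := H.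
  have c : coh F (pearl_at ps : cycle_graph n -> _).
    case: n ps n3 H {sz} => [|[|[|[|[|m]]]]] ps // _ H; try exact: coh_cycle3.
    - exact: coh_cycle4.
    - exact: coh_long_cycle.
  split; first exact: coh_on_cycle.
  by have [|? ?] := ends _ 1 ps; [rewrite sz; lia|split].
Qed.

Lemma coh_on_mem (G : groupType) (P P' : seq G) (L L' : seq (G * G)) :
  P =i P' -> L =i L' -> coh_on F P L -> coh_on F P' L'.
Proof.
move=> EP EL [c1 c2 c3 c4]; split.
- by move=> f; have [phi hphi H] := c1 f; exists phi => // p; rewrite -EP; exact: H.
- by move=> phi hphi H; apply: c2 => // p; rewrite EP; exact: H.
- move=> phi psi hphi hpsi; rewrite c3 //.
  by split=> H l; [rewrite -EL|rewrite EL]; exact: H.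
- by move=> l; rewrite -EL => /c4 [? ? ?]; rewrite -!EP.
Qed.

Lemma coh_on_gluing (G : groupType) (D : ear_list G) :
  iterated_gluing D -> coh_on F (pearls D) (links D).
Proof.
elim=> {G D} [s ps /coh_on_decoration [c _]|G D s ps R _ cG /coh_on_decoration [cH [hd lt hl]] att].
  by apply: coh_on_mem c => l; rewrite /pearls /links /= cats0.
rewrite pearls_rcons links_rcons pearls_map links_map /= consecutive_map.
(* The three ways of attaching a piece are lists [E] of zero, one or two identified pairs. *)
have amal (E : seq (raag (piece_graph s) * G)) :
    uniq (unzip1 E) -> uniq (unzip2 E) ->
    (forall e, e \in E -> e.1 \in ps /\ e.2 \in pearls D) ->
    R = [set r | exists2 e, e \in E & r = identify e.1 e.2]%classic ->
    coh_on F
      ([seq quot_pi R (fp_inl _ a) | a <- pearls D] ++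
       [seq quot_pi R (fp_inr _ b) | b <- ps])
      ([seq map_pair (fun a => quot_pi R (fp_inl _ a)) l | l <- links D] ++
       [seq map_pair (fun b => quot_pi R (fp_inr _ b)) l | l <- consecutive s ps]).
  by move=> u1 u2 EP ->; exact: coh_on_amalgam.
case: att => [R0|[q qP RE]|[sp [q1 [q2 [q1P q2P q12 RE]]]]].
- apply: (amal [::]) => //; rewrite R0; apply/seteqP; split=> // r /= [e].
  by rewrite in_nil.
- apply: (amal [:: (head 1 ps, q)]) => //.
    by move=> e; rewrite inE => /eqP ->.
  rewrite RE; apply/seteqP; split=> r /=.
    by move=> ->; exists (head 1 ps, q); rewrite ?inE.
  by case=> e; rewrite inE => /eqP -> ->.
- apply: (amal [:: (head 1 ps, q1); (last 1 ps, q2)]) => //=.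
  + by rewrite inE hl.
  + by rewrite inE andbT; apply/eqP.
  + by move=> e; rewrite !inE => /orP [] /eqP ->.
  rewrite RE; apply/seteqP; split=> r /=.
    by case=> ->; [exists (head 1 ps, q1)|exists (last 1 ps, q2)]; rewrite ?inE ?eqxx ?orbT.
  by case=> e; rewrite !inE => /orP [] /eqP -> ->; [left|right].
Qed.

Lemma coh_on_iso (G H : groupType) (f : {multiplicative G -> H}) P L : bijective f ->
  coh_on F P L -> coh_on F (map f P) (map (map_pair f) L).
Proof.
move=> fB; have [g [fK gK]] := mult_inverse fB.
move=> [c1 c2 c3 c4]; split.
- move=> m; have [phi hphi phiE] := c1 (m \o f); exists (phi \o g).
    exact: hom_comp.
  by move=> p /mapP [q qP ->]; rewrite /= fK phiE.
- move=> phi hphi H0 a; rewrite -[a]gK.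
  apply: (c2 (phi \o f) (hom_comp hphi f)) => p pP.
  by apply: H0; exact: map_f.
- move=> phi psi hphi hpsi.
  have E : cup_trivial phi psi <-> cup_trivial (phi \o f) (psi \o f).
    split; first exact: cup_trivial_comp.
    move=> /(cup_trivial_comp g) cup; apply: (cup_trivial_ext _ _ cup) => a /=.
      by rewrite gK.
    by rewrite gK.
  rewrite E c3; try exact: hom_comp.
  split=> HL l; first by move=> /mapP [l' l'L ->]; exact: HL.
  by move=> lL; apply: (HL (map_pair f l)); exact: map_f.
- move=> l /mapP [l' /c4 [l1 l2 l12] ->]; rewrite /= !map_f //; split=> //.
  by rewrite (inj_eq (can_inj fK)).
Qed.

Lemma coh_on_decomposition (X : simple_graph) (D : ear_list (raag X)) :
  loose_ear_decomposition D -> coh_on F (pearls D) (links D).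
Proof.
move=> [G [D0 [f [/coh_on_gluing c fB ->]]]].
by rewrite pearls_map links_map; exact: coh_on_iso.
Qed.

End PieceCohomology.

Section PearlGraph.
Import mathcomp.boot.fintype mathcomp.boot.finset GRing.Theory.
Local Open Scope group_scope.
Variables (G : groupType) (P : seq G) (L : seq (G * G)).

Definition pearl_edge : rel (seq_sub P) := fun u v => (u != v) &&
  (((val u, val v) \in L) || ((val v, val u) \in L)).

Fact pearl_edge_sym : symmetric pearl_edge.
Proof. by move=> u v; rewrite /pearl_edge eq_sym orbC. Qed.

Fact pearl_edge_irrefl : irreflexive pearl_edge.
Proof. by move=> u; rewrite /pearl_edge eqxx. Qed.

Definition pearl_graph := SimpleGraph pearl_edge_sym pearl_edge_irrefl.

Lemma coh_pearl_graph (F : fieldType) : coh_on F P L ->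
  coh F (fun z : pearl_graph => (val z : G)).
Proof.
move=> [c1 c2 c3 c4]; split.
- move=> f; have [phi hphi H] := c1 (fun p => if insub p is Some z then f z else 0%R).
  by exists phi => // z; rewrite H ?(valP z) // valK.
- move=> phi hphi H; apply: c2 => // p pP; exact: (H (SeqSub pP)).
- move=> phi psi hphi hpsi; rewrite c3 //; split=> H.
    by move=> u v /andP [_ /orP [/H //|/H /= ->]].
  move=> [p q] pqL; have [pP qP pq] := c4 _ pqL.
  apply: (H (SeqSub pP) (SeqSub qP)); rewrite /edge /= /pearl_edge /= pqL andbT.
  by rewrite -val_eqE.
Qed.

End PearlGraph.

Section FromProjectionsToMinors.
Import mathcomp.boot.fintype mathcomp.boot.finset GRing.Theory.
Local Open Scope group_scope.
Implicit Types X Y : simple_graph.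

(** The smallest finite field in which 2 is not zero. *)
Let F : finFieldType := 'F_3.

Fact F2 : (2%:R : F)%R != 0%R. Proof. by []. Qed.

Lemma raag_iso_minor X Y : group_iso (raag X) (raag Y) -> minor X Y /\ minor Y X.
Proof.
move=> [f fB]; have c := coh_iso fB (coh_raag F X); have c' := coh_raag F Y.
by split; [exact: coh_minor F2 c' c|exact: coh_minor F2 c c'].
Qed.

Lemma projection_minor X Y (Z : simple_graph) (r : raag X) (f : {multiplicative raag X -> raag Y})
    (pi : Z -> quotient_group [set r]%classic) : projection_along r f -> coh F pi ->
  minor Y Z /\ minor Z Y.
Proof.
move=> [phi [phiB _]] c; have c' := coh_iso phiB c; have cY := coh_raag F Y.
by split; [exact: coh_minor F2 c' cY|exact: coh_minor F2 cY c'].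
Qed.

(** The graph on the pearls is not given as [X], but both describe the cohomology of [raag X], and
    rigidity compares them. The operation takes place in the graph on the pearls. *)
Lemma pearl_deletion_minor X Y (f : {multiplicative raag X -> raag Y}) :
  pearl_deletion f -> minor Y X.
Proof.
move=> [D [/(coh_on_decomposition F)/coh_pearl_graph c [p pP pf]]].
have [YZ _] := projection_minor pf (coh_del c (SeqSub pP)).
apply: minor_trans YZ (minor_trans (minor_del _) _).
exact: coh_minor F2 (coh_raag F X) c.
Qed.

Lemma identification_minor X Y (f : {multiplicative raag X -> raag Y}) :
  identification_hom f -> minor Y X.
Proof.
move=> [D [/(coh_on_decomposition F) cD [p [q [pP qP pq pf]]]]].
have c := coh_pearl_graph cD; have [_ _ _ c4] := cD.
have npq : p != q.
  move: pq; rewrite adjacent_pearlsE => /orP [] /c4 [_ _] //=.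
  by rewrite eq_sym.
set Z := pearl_graph (pearls D) (links D) in c.
pose zp : Z := SeqSub pP; pose zq : Z := SeqSub qP.
have nzz : zp != zq by rewrite -val_eqE.
have zz : edge zp zq by rewrite /edge /= /pearl_edge nzz.
have [YZ _] := projection_minor pf (coh_contract c nzz).
apply: minor_trans YZ (minor_trans (minor_contract nzz zz) _).
exact: coh_minor F2 (coh_raag F X) c.
Qed.

Lemma abelianizing_minor X Y (f : {multiplicative raag X -> raag Y}) :
  abelianizing_hom f -> minor X Y.
Proof.
move=> [D [/(coh_on_decomposition F) cD [p [q [pP qP npq pq pf]]]]].
have c := coh_pearl_graph cD.
set Z := pearl_graph (pearls D) (links D) in c.
pose zp : Z := SeqSub pP; pose zq : Z := SeqSub qP.
have nzz : zp != zq by rewrite -val_eqE /=; apply/eqP.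
have [_ ZY] := projection_minor pf (coh_add c nzz).
apply: minor_trans (minor_trans (minor_add _ _) ZY).
exact: coh_minor F2 c (coh_raag F X).
Qed.

Lemma minor_chain (A : nat -> simple_graph) a : 0 < a ->
  (forall i, 0 < i < a -> minor (A i.+1) (A i)) -> minor (A a) (A 1%N).
Proof.
case: a => // a _; elim: a => [_|a IH H]; first exact: minor_refl.
apply: minor_trans (H a.+1 _) (IH _); first by rewrite !ltnS leqnn.
by move=> i /andP [i0 ia]; apply: H; rewrite i0 ltnW.
Qed.

Lemma minor_chain_up (A : nat -> simple_graph) a : 0 < a ->
  (forall i, 0 < i < a -> minor (A i) (A i.+1)) -> minor (A 1%N) (A a).
Proof.
case: a => // a _; elim: a => [_|a IH H]; first exact: minor_refl.
apply: minor_trans (IH _) (H a.+1 _); last by rewrite !ltnS leqnn.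
by move=> i /andP [i0 ia]; apply: H; rewrite i0 ltnW.
Qed.

End FromProjectionsToMinors.

(** * From minors to projections *)

Section StandardDecoration.
Import GRing.Theory.
Local Open Scope group_scope.

Lemma heis_expgz (h : heis int) k : (expgz h k).1.1 = (k * h.1.1)%R.
Proof.
have H n : (h ^+ n).1.1 = (n%:Z * h.1.1)%R.
  elim: n => [|n IH]; first by rewrite expg0 mul0r.
  have -> : (n.+1%:Z = 1 + n%:Z)%R by lia.
  by rewrite expgS heisM /heis_mul IH mulrDl mul1r.
case: k => n; first exact: H.
by rewrite [expgz _ _]/= heisV /heis_inv H NegzE mulNr.
Qed.

(** The first coordinate is an integral class. Its value 1 at [a] would be divisible by the
    exponent. *)
Lemma not_proper_multiple (G : groupType) (f : {multiplicative G -> heis int}) a :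
  (f a).1.1 = 1%R -> ~ proper_multiple a.
Proof.
move=> fa [u [k [k2 aE]]]; move: fa; rewrite aE multf_expgz heis_expgz => H.
have : (`|k| * `|(f u).1.1| = 1)%N by rewrite -abszM H.
by move/eqP; rewrite muln_eq1 => /andP [/eqP k1 _]; rewrite k1 in k2.
Qed.

Definition v0 : path_graph 2 := ord0.
Definition v1 : path_graph 2 := ord_max.

Lemma heis_fst_commute (a b : int) : commute ((a, 0, 0)%R : heis int) (b, 0, 0)%R.
Proof. by apply/heis_commute; rewrite /= !mulr0. Qed.

Lemma decoration_edge :
  @decoration (Path 2) [:: raag_gen v0; raag_gen v1].
Proof.
split=> //; split=> //=; split.
  have mC (x y : path_graph 2) : edge x y -> commute
      (((x == v0)%:Z, 0, 0)%R : heis int) ((y == v0)%:Z, 0, 0)%R.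
    by move=> _; exact: heis_fst_commute.
  apply: (not_proper_multiple (f := raag_lift mC)).
  by rewrite raag_liftE eqxx.
have mC (x y : path_graph 2) : edge x y -> commute
    (((x == v1)%:Z, 0, 0)%R : heis int) ((y == v1)%:Z, 0, 0)%R.
  by move=> _; exact: heis_fst_commute.
have [|f fE] := @quot_lift _ _ [set raag_gen v0]%classic (raag_lift mC).
  by move=> _ ->; rewrite raag_liftE.
apply: (not_proper_multiple (f := f)).
by rewrite fE raag_liftE eqxx.
Qed.

Lemma decoration_point :
  @decoration Point [:: raag_gen (ord0 : path_graph 1)].
Proof.
exists (raag_gen (ord0 : path_graph 1)); split=> //.
apply/seteqP; split=> // a _; elim: (raag_generated a) => {a} [_ [v ->]||x y _ ? _ ?|x _ ?].
- by rewrite (ord1 v); exact: gen_in.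
- exact: gen_one.
- exact: gen_mul.
- exact: gen_inv.
Qed.

End StandardDecoration.

(** * A loose ear decomposition whose pearls are the vertices *)

Section StandardDecomposition.
Import GRing.Theory.
Local Open Scope group_scope.
Variable X : simple_graph.

(* [G] has the presentation with generators [s] and commutators of [E]. *)
Definition presents (G : groupType) (s : seq X) (E : seq (X * X)) (m : X -> G) : Prop :=
  [/\ forall e, e \in E -> [/\ e.1 \in s, e.2 \in s & commute (m e.1) (m e.2)],
      forall a, gen [set x | exists2 v, v \in s & x = m v]%classic a
    & forall (H : groupType) (k : X -> H),
        (forall e, e \in E -> commute (k e.1) (k e.2)) ->
        exists f : {multiplicative G -> H}, forall v, v \in s -> f (m v) = k v].

(** Pearls and links are matched as sets, since gluing lists identified pearls repeatedly. *)
Definition realized (s : seq X) (E : seq (X * X)) : Prop :=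
  exists (G : groupType) (D : ear_list G) (m : X -> G),
    [/\ iterated_gluing D, presents s E m, pearls D =i map m s
      & links D =i map (map_pair m) E].

Lemma gluing_generated (G H : groupType) (R : set (free_product G H))
    (S : set (quotient_group R)) :
  (forall a, gen S (quot_pi R (fp_inl H a))) ->
  (forall b, gen S (quot_pi R (fp_inr G b))) -> forall q, gen S q.
Proof.
move=> Sl Sr q; have [x ->] := quot_pi_surj q; have [w ->] := quot_pi_surj x.
elim: (free_group_gen w) => {w} [_ [[v|v] ->]||a b _ Ea _ Eb|a _ Ea].
- exact: Sl.
- exact: Sr.
- rewrite !multf1; exact: gen_one.
- rewrite !gmulfM; exact: gen_mul.
- rewrite !multfV; exact: gen_inv.
Qed.

Lemma gen_image (G H : groupType) (f : {multiplicative G -> H}) (S : set G) (T : set H) :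
  (forall x, S x -> gen T (f x)) -> forall x, gen S x -> gen T (f x).
Proof.
move=> ST x; elim=> {x} [x /ST //||x y _ Ex _ Ey|x _ Ex].
- rewrite multf1; exact: gen_one.
- rewrite gmulfM; exact: gen_mul.
- rewrite multfV; exact: gen_inv.
Qed.

Lemma realized_vertex x : realized [:: x] [::].
Proof.
exists (raag (path_graph 1)), [:: (Point, [:: raag_gen (ord0 : path_graph 1)])].
exists (fun=> raag_gen (ord0 : path_graph 1)); split=> //.
  exact: (gluing_first decoration_point).
split=> // [a|H k _].
  apply: gen_mono (raag_generated a) => _ [v ->]; exists x; rewrite ?inE //.
  by rewrite (ord1 v).
have kC (u v : path_graph 1) : edge u v -> commute (k x) (k x).
  by move=> _; exact: commute_refl.
by exists (raag_lift kC) => v; rewrite inE => /eqP ->; rewrite raag_liftE.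
Qed.

Lemma realized_add_vertex s E y : y \notin s -> realized s E -> realized (y :: s) E.
Proof.
move=> ys [G [D [m [gD [mE mG mU] pD lD]]]].
pose H := raag (piece_graph Point); pose R : set (free_product G H) := set0.
pose p : H := raag_gen (ord0 : path_graph 1).
pose iG a := quot_pi R (fp_inl H a); pose iH b := quot_pi R (fp_inr G b).
pose m' v := if v == y then iH p else iG (m v).
have m's v : v \in s -> m' v = iG (m v).
  by rewrite /m'; case: eqP => // -> yin; rewrite yin in ys.
have m'y : m' y = iH p by rewrite /m' eqxx.
have glue := gluing_next gD decoration_point (Or31 _ _ (erefl R)).
exists (quotient_group R); eexists; exists m'; split; first exact: glue.
- split.
  + move=> e eE; have [e1 e2 e12] := mE e eE; rewrite !inE e1 e2 !orbT !m's //.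
    split=> //; exact: (gmulf_commute (quot_pi R) (gmulf_commute (@fp_inl G H) e12)).
  + apply: gluing_generated => a.
      apply: (gen_image (f := quot_pi R \o @fp_inl G H) _ (mG a)) => _ [v vs ->].
      by apply: gen_in; exists v; rewrite ?inE ?vs ?orbT ?m's.
    apply: (gen_image (f := quot_pi R \o @fp_inr G H) _ (raag_generated a)) => _ [v ->].
    by apply: gen_in; exists y; rewrite ?inE ?eqxx // /m' eqxx (ord1 v).
  + move=> K k kE; have [f fE] := mU K k kE.
    have kC (u v : path_graph 1) : edge u v -> commute (k y) (k y).
      by move=> _; exact: commute_refl.
    have [h [hl hr]] := free_product_lift f (raag_lift kC).
    have [//|g gE] := @quot_lift _ _ R h.
    exists g => v; rewrite inE => /orP [/eqP ->|vs].
      by rewrite /m' eqxx gE hr raag_liftE.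
    by rewrite m's // gE hl fE.
- move=> q; rewrite pearls_rcons pearls_map mem_cat /= !inE m'y orbC.
  congr (_ || _); have -> : map m' s = map iG (map m s).
    by rewrite -map_comp; apply/eq_in_map => v; exact: m's.
  by apply/mapP/mapP => -[z zD ->]; exists z; rewrite ?pD // -pD.
- move=> q; rewrite links_rcons links_map /= cats0.
  have -> : map (map_pair m') E = map (map_pair iG) (map (map_pair m) E).
    rewrite -map_comp; apply/eq_in_map => e eE; have [e1 e2 _] := mE e eE.
    by rewrite /map_pair /= !m's.
  by apply/mapP/mapP => -[z zD ->]; exists z; rewrite ?lD // -lD.
Qed.

Lemma presents_inj (G : groupType) s E (m : X -> G) u v : presents s E m -> u \in s -> v \in s ->
  u <> v -> m u <> m v.
Proof.
move=> [_ _ mU] us vs uv muv.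
have [|f fE] := mU (heis int) (fun x => ((x == u)%:Z, 0, 0)%R).
  by move=> e _; exact: heis_fst_commute.
have := fE v vs; rewrite -muv fE // eqxx.
by case: eqP => // vu; case: uv.
Qed.

(** A path on two vertices glued at both ends brings no new generator and only the commutator of its
    ends. [presents_inj] supplies the distinctness of the two pearls that the gluing demands. *)
Lemma realized_add_edge s E u v : u \in s -> v \in s -> u <> v ->
  realized s E -> realized s (rcons E (u, v)).
Proof.
move=> us vs uv [G [D [m [gD mP pD lD]]]].
have muv := presents_inj mP us vs uv; have [mE mG mU] := mP.
pose H := raag (piece_graph (Path 2)); pose p : H := raag_gen v0; pose q : H := raag_gen v1.
pose R : set (free_product G H) := [set identify p (m u); identify q (m v)]%classic.
have Rs : attaching_relators (pearls D) (Path 2) [:: p; q] R.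
  by constructor 3; split=> //; exists (m u), (m v); split=> //; rewrite pD map_f.
pose iG a := quot_pi R (fp_inl H a); pose iH b := quot_pi R (fp_inr G b).
have glue r a : R (identify r a) -> iH r = iG a.
  move=> Rra; apply/divg1_eq; rewrite /iH /iG -multfV -gmulfM.
  exact: quot_pi_rel.
have pu : iH p = iG (m u) by apply: glue; left.
have qv : iH q = iG (m v) by apply: glue; right.
exists (quotient_group R); eexists; exists (iG \o m); split.
- exact: (gluing_next gD decoration_edge Rs).
- split.
  + move=> e; rewrite mem_rcons inE => /orP [/eqP -> /=|eE].
      split=> //; rewrite -pu -qv.
      apply: (gmulf_commute (quot_pi R) (gmulf_commute (@fp_inr G H) _)).
      exact: raag_gen_comm.
    have [e1 e2 e12] := mE e eE; split=> //.
    exact: (gmulf_commute (quot_pi R) (gmulf_commute (@fp_inl G H) e12)).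
  + apply: gluing_generated => a.
      apply: (gen_image (f := quot_pi R \o @fp_inl G H) _ (mG a)) => _ [w ws ->].
      by apply: gen_in; exists w.
    apply: (gen_image (f := quot_pi R \o @fp_inr G H) _ (raag_generated a)) => _ [w ->].
    apply: gen_in; rewrite /= -/(iH (raag_gen w)).
    have [->|->] : w = v0 \/ w = v1.
      case: (eqVneq w v0) => [|wv]; [by left|right].
      by apply: val_inj; move: wv; rewrite -val_eqE /=; have := ltn_ord w; lia.
      by exists u => //; rewrite -/p pu.
    by exists v => //; rewrite -/q qv.
  + move=> K k kE; have [|f fE] := mU K k.
      by move=> e eE; apply: kE; rewrite mem_rcons inE eE orbT.
    have kuv : commute (k u) (k v) by apply: (kE (u, v)); rewrite mem_rcons inE eqxx.
    pose k' (w : path_graph 2) := if w == v0 then k u else k v.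
    have kC (w w' : path_graph 2) : edge w w' -> commute (k' w) (k' w').
      rewrite /k'; case: eqP => _; case: eqP => _ _ //; try exact: commute_refl.
    have [h [hl hr]] := free_product_lift f (raag_lift kC).
    have [|g gE] := @quot_lift _ _ R h.
      by move=> r [] ->; rewrite gmulfM multfV hl hr raag_liftE fE // mulgV.
    by exists g => w ws; rewrite /= gE hl fE.
- move=> z; rewrite pearls_rcons pearls_map mem_cat /= !inE.
  rewrite -/(iH p) -/(iH q) pu qv map_comp.
  have -> : (z \in [seq iG i | i <- [seq m i | i <- s]]) = (z \in map iG (pearls D)).
    by apply/mapP/mapP => -[y yD ->]; exists y; rewrite ?pD // -pD.
  apply/orP/idP => [[//|/orP [] /eqP ->]|]; last by left.
    by apply: map_f; rewrite pD map_f.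
  by apply: map_f; rewrite pD map_f.
- move=> z; rewrite links_rcons links_map mem_cat /= map_rcons mem_rcons !inE.
  rewrite -/(iH p) -/(iH q) pu qv orbC; congr (_ || _).
  have -> : map (map_pair (iG \o m)) E = map (map_pair iG) (map (map_pair m) E).
    by rewrite -map_comp.
  by apply/mapP/mapP => -[y yD ->]; exists y; rewrite ?lD // -lD.
Qed.

Lemma realized_vertices s : uniq s -> s != [::] -> realized s [::].
Proof.
elim: s => // x [|y s] IH /andP [xs us] _; first exact: realized_vertex.
by apply: realized_add_vertex => //; exact: IH.
Qed.

Lemma realized_edges s E : realized s [::] ->
  (forall e, e \in E -> [/\ e.1 \in s, e.2 \in s & e.1 <> e.2]) -> realized s E.
Proof.
move=> r0; elim/last_ind: E => [//|E [u v] IH] H.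
have [us vs uv] : [/\ u \in s, v \in s & u <> v].
  by apply: (H (u, v)); rewrite mem_rcons inE eqxx.
apply: realized_add_edge => //; apply: IH => e eE.
by apply: H; rewrite mem_rcons inE eE orbT.
Qed.

Theorem standard_decomposition (x0 : X) : exists D : ear_list (raag X),
  [/\ loose_ear_decomposition D, forall x, raag_gen x \in pearls D
    & forall x y, adjacent_pearls D (raag_gen x) (raag_gen y) = edge x y].
Proof.
(* Both orientations of an edge are listed, so each edge is glued twice; the second copy imposes a
   relation that already holds. *)
pose E := [seq e <- enum {: X * X} | edge e.1 e.2].
have rX : realized (enum X) E.
  apply: realized_edges.
    apply: realized_vertices; first exact: enum_uniq.
    have : x0 \in enum X by rewrite mem_enum.
    by case: (enum X).
  move=> [u v]; rewrite mem_filter /= !mem_enum => /andP [uv _]; split=> //.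
  by move=> E'; rewrite E' edge_irrefl in uv.
have [G [D [m [gD [mE mG mU] pD lD]]]] := rX.
have [|f fE] := mU (raag X) (@raag_gen X).
  by move=> e; rewrite mem_filter => /andP [/raag_gen_comm].
have mC x y : edge x y -> commute (m x) (m y).
  move=> xy; have xyE : (x, y) \in E by rewrite mem_filter mem_enum andbT.
  by have [_ _] := mE _ xyE.
have {}fE v : f (m v) = raag_gen v by apply: fE; rewrite mem_enum.
have fB : bijective f.
  exists (raag_lift mC) => a.
    apply: (gen_mult_eq (f := raag_lift mC \o f) (g := idfun) _ (mG a)).
    by move=> _ [v _ ->]; rewrite /= fE raag_liftE.
  apply: (@raag_ext _ _ (f \o raag_lift mC) idfun) => v.
  by rewrite /= raag_liftE fE.
have gI : injective (@raag_gen X) := pi_inj (coh_raag rat X).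
exists (map_ears f D); split.
- by exists G, D, f.
- by move=> x; rewrite pearls_map -fE map_f // pD map_f // mem_enum.
- have lE u v : ((raag_gen u, raag_gen v) \in links (map_ears f D)) = edge u v.
    rewrite links_map; apply/mapP/idP => [[l]|uv].
      rewrite lD => /mapP [e]; rewrite mem_filter => /andP [e12 _] -> [].
      by rewrite /= !fE => /gI -> /gI ->.
    exists (m u, m v); last by rewrite /map_pair /= !fE.
    rewrite lD; apply/mapP; exists (u, v) => //.
    by rewrite mem_filter mem_enum andbT.
  by move=> x y; rewrite adjacent_pearlsE !lE (edge_sym y) orbb.
Qed.

End StandardDecomposition.

Section Projections.
Local Open Scope group_scope.
Implicit Types X Y : simple_graph.

(** Bijectivity is checked on generators against an explicit inverse, without describing the kernel
    of [f]. *)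
Lemma projection_of_inverse X Y (r : raag X) (f : {multiplicative raag X -> raag Y})
    (g : {multiplicative raag Y -> quotient_group [set r]%classic}) :
  f r = 1 -> (forall x, g (f (raag_gen x)) = quot_pi [set r] (raag_gen x)) ->
  (forall y, exists2 a, g (raag_gen y) = quot_pi [set r] a & f a = raag_gen y) ->
  projection_along r f.
Proof.
move=> fr gf fg; have [|phi phiE] := @quot_lift _ _ [set r]%classic f.
  by move=> _ ->.
exists phi; split=> [|x]; last by rewrite phiE.
exists g => [q|y].
  have [a ->] := quot_pi_surj q; rewrite phiE.
  exact: (@raag_ext _ _ (g \o f) (quot_pi [set r]%classic) gf).
apply: (@raag_ext _ _ (phi \o g) idfun) => x /=.
by have [a -> fa] := fg x; rewrite phiE.
Qed.

Lemma del_hom_ex X (z : X) : exists f : {multiplicative raag X -> raag (del_graph z)},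
  pearl_deletion f.
Proof.
pose m (u : X) : raag (del_graph z) := if insub u is Some u' then raag_gen (u' : del_graph z) else 1.
have mC u w : edge u w -> commute (m u) (m w).
  rewrite /m => uw; case: insubP => [u' _ E|_]; last exact/commute_sym/commute1.
  case: insubP => [w' _ E'|_]; last exact: commute1.
  by apply: raag_gen_comm; rewrite /edge /= /del_edge E E'.
have [D [dD mD _]] := standard_decomposition z.
exists (raag_lift mC), D; split=> //; exists (raag_gen z) => //.
pose k (u : del_graph z) := quot_pi [set raag_gen z]%classic (raag_gen (val u)).
have kC u w : edge u w -> commute (k u) (k w).
  by move=> uw; apply: (gmulf_commute (quot_pi [set raag_gen z]%classic)); exact: raag_gen_comm.
apply: (projection_of_inverse (g := raag_lift kC)).
- by rewrite raag_liftE /m insubF ?eqxx.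
- move=> x; rewrite raag_liftE /m; case: insubP => [u _ E|].
    by rewrite raag_liftE /k E.
  by rewrite negbK => /eqP ->; rewrite multf1 quot_pi_rel.
- move=> y; rewrite raag_liftE; exists (raag_gen (val y)) => //.
  by rewrite raag_liftE /m valK.
Qed.

Definition merge X (z z' : X) (zz' : z != z') (u : X) : contract_graph z z' :=
  insubd (exist _ z zz' : contract_graph z z') u.

Lemma val_merge X (z z' : X) (zz' : z != z') u :
  val (merge zz' u) = if u == z' then z else u.
Proof. by rewrite val_insubd; case: eqP. Qed.

Lemma merge_val X (z z' : X) (zz' : z != z') (u : contract_graph z z') :
  merge zz' (val u) = u.
Proof. exact: valKd. Qed.

Lemma merge_edge X (z z' : X) (zz' : z != z') u w : edge u w ->
  merge zz' u = merge zz' w \/ edge (merge zz' u) (merge zz' w).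
Proof.
move=> uw; case: (eqVneq (merge zz' u) (merge zz' w)) => [|ne]; [by left|right].
rewrite /edge /= /contract_edge ne /= !val_merge.
case: (eqVneq u z') => [E|nu]; case: (eqVneq w z') => [E'|nw].
- by rewrite E E' edge_irrefl in uw.
- by rewrite eqxx -E uw !orbT.
- by rewrite E' in uw; rewrite eqxx (edge_sym z' u) uw !orbT.
- by rewrite uw.
Qed.

Lemma identification_hom_ex X (z z' : X) : edge z z' ->
  exists f : {multiplicative raag X -> raag (contract_graph z z')},
    identification_hom f.
Proof.
move=> ezz'; have zz' : z != z' by apply: contraTneq ezz' => ->; rewrite edge_irrefl.
pose m u := raag_gen (merge zz' u).
have mC u w : edge u w -> commute (m u) (m w).
  by case/(merge_edge zz') => [|/raag_gen_comm //]; rewrite /m => ->; exact: commute_refl.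
have [D [dD mD aD]] := standard_decomposition z.
exists (raag_lift mC), D; split=> //; exists (raag_gen z), (raag_gen z'); split=> //.
  by rewrite aD.
set r := raag_gen z * _.
have rE : quot_pi [set r]%classic (raag_gen z') = quot_pi [set r]%classic (raag_gen z).
  by apply/esym/divg1_eq; rewrite -multfV -gmulfM; exact: quot_pi_rel.
pose k (u : contract_graph z z') := quot_pi [set r]%classic (raag_gen (val u)).
have kC u w : edge u w -> commute (k u) (k w).
  have piC x y : edge x y -> commute (quot_pi [set r]%classic (raag_gen x))
      (quot_pi [set r]%classic (raag_gen y)).
    by move=> xy; apply: (gmulf_commute (quot_pi [set r]%classic)); exact: raag_gen_comm.
  case/andP=> _ /or3P [/piC //|/andP [/eqP uz /piC]|/andP [/eqP wz /piC]].
    by rewrite rE /k uz.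
  by rewrite rE /k wz => /commute_sym.
have mz : merge zz' z' = merge zz' z.
  by apply: val_inj; rewrite !val_merge eqxx (negbTE zz').
apply: (projection_of_inverse (g := raag_lift kC)).
- by rewrite gmulfM multfV !raag_liftE /m mz mulgV.
- move=> x; rewrite raag_liftE /m raag_liftE /k val_merge.
  by case: eqP => // ->; rewrite rE.
- move=> y; rewrite raag_liftE; exists (raag_gen (val y)) => //.
  by rewrite raag_liftE /m merge_val.
Qed.

Lemma abelianizing_hom_ex X (z z' : X) : z != z' -> ~~ edge z z' ->
  exists f : {multiplicative raag X -> raag (add_edge z z')}, abelianizing_hom f.
Proof.
move=> zz' nzz'; pose m (u : X) := raag_gen (u : add_edge z z').
have mC u w : edge u w -> commute (m u) (m w).
  by move=> uw; apply: raag_gen_comm; rewrite /edge /= /add_edge_rel uw.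
have [D [dD mD aD]] := standard_decomposition z.
exists (raag_lift mC), D; split=> //; exists (raag_gen z), (raag_gen z'); split=> //.
- by move/(pi_inj (coh_raag rat X))/eqP; rewrite (negbTE zz').
- by rewrite aD.
set r := [~ _, _].
pose k (u : add_edge z z') := quot_pi [set r]%classic (raag_gen (u : X)).
have kC u w : edge u w -> commute (k u) (k w).
  have czz' : commute (k z) (k z').
    by apply/commgP/eqP; rewrite /k -multfR; exact: quot_pi_rel.
  case/orP => [uw|/andP [_ /orP [] /andP [/eqP -> /eqP ->]]] //.
    by apply: (gmulf_commute (quot_pi [set r]%classic)); exact: raag_gen_comm.
apply: (projection_of_inverse (g := raag_lift kC)).
- rewrite multfR !raag_liftE; apply/eqP/commgP; apply: raag_gen_comm.
  by rewrite /edge /= /add_edge_rel zz' !eqxx orbT.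
- by move=> x; rewrite !raag_liftE.
- by move=> y; rewrite raag_liftE; exists (raag_gen (y : X)); rewrite ?raag_liftE.
Qed.

Lemma raag_iso_of_bijection X Y (s : X -> Y) : bijective s ->
  (forall x x', edge (s x) (s x') = edge x x') -> group_iso (raag X) (raag Y).
Proof.
move=> [t sK tK] sE.
have sC x x' : edge x x' -> commute (raag_gen (s x)) (raag_gen (s x')).
  by move=> xx'; apply: raag_gen_comm; rewrite sE.
have tC y y' : edge y y' -> commute (raag_gen (t y)) (raag_gen (t y')).
  by move=> yy'; apply: raag_gen_comm; rewrite -sE !tK.
exists (raag_lift sC); exists (raag_lift tC) => a.
  apply: (@raag_ext _ _ (raag_lift tC \o raag_lift sC) idfun) => x.
  by rewrite /= !raag_liftE sK.
apply: (@raag_ext _ _ (raag_lift sC \o raag_lift tC) idfun) => y.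
by rewrite /= !raag_liftE tK.
Qed.

End Projections.

Section Chains.
Local Open Scope group_scope.

Inductive chain (R : simple_graph -> simple_graph -> Prop) :
  simple_graph -> simple_graph -> Prop :=
| chain_refl X : chain R X X
| chain_step X Y Z : R X Y -> chain R Y Z -> chain R X Z.

Lemma chain_sequence R X Y : chain R X Y -> exists n (A : nat -> simple_graph),
  [/\ 1 <= n, A 1%N = X, A n = Y & forall i, 1 <= i < n -> R (A i) (A i.+1)].
Proof.
elim=> {X Y} [X|X Y Z XY _ [n [A [n1 A1 An AR]]]].
  by exists 1%N, (fun=> X); split=> // i; lia.
exists n.+1, (fun i => if i is j.+2 then A j.+1 else X); split=> //.
  by case: n n1 An {AR}.
move=> [|[|i]] //; first by rewrite A1.
by rewrite !ltnS => /andP [_ ni]; apply: AR.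
Qed.

Lemma chain_homs
    (P : forall X Y, {multiplicative raag X -> raag Y} -> Prop) X Y :
  chain (fun X Y => exists f, @P X Y f) X Y ->
  exists n (A : nat -> simple_graph) (f : forall i, {multiplicative raag (A i) -> raag (A i.+1)}),
    [/\ 1 <= n, forall i, 1 <= i < n -> P _ _ (f i), A 1%N = X & A n = Y].
Proof.
move=> /chain_sequence [n [A [n1 A1 An AR]]].
have H i : exists f : {multiplicative raag (A i) -> raag (A i.+1)}, 1 <= i < n -> P _ _ f.
  case: (boolP (1 <= i < n)) => [/AR [f Pf]|_]; first by exists f.
  (* The sequence of homomorphisms is indexed by all naturals; the trivial one fills the places
     outside the range. *)
  have oM : {morph (fun _ : raag (A i) => 1 : raag (A i.+1)) : x y / x * y}.
    by move=> x y; rewrite mulg1.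
  by exists (mk_mult oM).
exists n, A, (fun i => projT1 (cid (H i))); split=> // i.
by case: (cid (H i)).
Qed.

End Chains.

Section FromMinorsToProjections.
Implicit Types X Y L : simple_graph.

Let deletion X Y := exists f, @pearl_deletion X Y f.
Let identification X Y := exists f, @identification_hom X Y f.
Let abelianization X Y := exists f, @abelianizing_hom X Y f.

Lemma card_subgraph (T : finType) (z : T) : #|{: {x : T | x != z}}| < #|T|.
Proof.
have : 0 < #|T| by apply/card_gt0P; exists z.
rewrite card_sig (_ : #|_| = #|predC1 z|); last exact: eq_card.
by rewrite cardC1; case: #|T|.
Qed.

(** Vertices outside the domain of the partial map are deleted one at a time, until the map is
    total. *)
Lemma deletion_stage X L (f : X -> option L) : minor_map f ->
  exists X' (f' : X' -> L), chain deletion X X' /\ minor_map (Some \o f').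
Proof.
have [n] := ubnP #|X|; elim: n X f => // n IH X f nX [f1 f2 f3].
case: (pselect (exists z, f z = None)) => [[z fz]|nz]; last first.
  have H x : exists y, f x = Some y.
    by case E: (f x) => [y|]; [exists y|case: nz; exists x].
  exists X, (fun x => projT1 (cid (H x))); split; first exact: chain_refl.
  have -> : Some \o (fun x => projT1 (cid (H x))) = f.
    by apply/funext => x /=; case: (cid (H x)).
  by split.
have nz x y : f y = Some x -> y != z by apply: contra_eq_neq => ->; rewrite fz.
have [||X' [f' [c m]]] := IH (del_graph z) (fun u => f (val u)).
- exact: leq_trans (card_subgraph z) _.
- split.
  + by move=> x; have [y fy] := f1 x; exists (exist _ y (nz _ _ fy)).
  + move=> x u v fu fv P Pu PS.
    have [|s t fs ft st [s' s'E Ps']|v' v'E Pv'] :=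
        f2 x _ _ fu fv (fun y => exists2 y' : del_graph z, val y' = y & P y').
    * by exists u.
    * exists (exist _ t (nz _ _ ft)) => //.
      by apply: PS Ps'; rewrite ?s'E // /edge /= /del_edge s'E.
    by have <- : v' = v by apply: val_inj.
  + move=> x x' /f3 [y [y' [fy fy' yy']]].
    by exists (exist _ y (nz _ _ fy)), (exist _ y' (nz _ _ fy')).
exists X', f'; split=> //; apply: chain_step c; exact: del_hom_ex.
Qed.

Lemma identification_stage X L (f : X -> L) : minor_map (Some \o f) ->
  exists X' (f' : X' -> L), [/\ chain identification X X', injective f' &
    minor_map (Some \o f')].
Proof.
have [n] := ubnP #|X|; elim: n X f => // n IH X f nX [f1 f2 f3].
case: (pselect (injective f)) => [fi|nfi].
  by exists X, f; split=> //; exact: chain_refl.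
have [z [z' [zz' fzz']]] : exists z z', edge z z' /\ f z = f z'.
  (* Without an edge inside a fibre, the property of being equal to [y] would spread over the whole
     fibre of [y], which would then be a single vertex. *)
  apply: contrapT => H; apply: nfi => y y' fyy'; apply/esym.
  apply: (f2 (f y) y y' (erefl _) (congr1 Some (esym fyy')) (eq^~ y)) => //.
  move=> s t [fs] [ft] st sy; case: H; exists s, t; split=> //.
  by rewrite fs ft.
have nzz' : z != z' by apply: contraTneq zz' => ->; rewrite edge_irrefl.
pose g (u : contract_graph z z') := f (val u).
have gm u : g (merge nzz' u) = f u.
  by rewrite /g val_merge; case: eqP => // ->.
have [||X' [f' [c m i]]] := IH (contract_graph z z') g.
- exact: leq_trans (card_subgraph z') _.
- split.
  + by move=> x; have [y [fy]] := f1 x; exists (merge nzz' y); rewrite /= gm fy.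
  + move=> x u v [fu] [fv] P Pu PS; rewrite -(merge_val nzz' v).
    apply: (f2 x (val u) (val v) _ _ (fun y => P (merge nzz' y))).
    * by rewrite /= -fu.
    * by rewrite /= -fv.
    * by rewrite merge_val.
    move=> s t [fs] [ft] st; case: (merge_edge nzz' st) => [-> //|].
    by apply: PS; rewrite /= gm ?fs ?ft.
  + move=> x x' xx'; have [y [y' [[fy] [fy'] yy']]] := f3 _ _ xx'.
    exists (merge nzz' y), (merge nzz' y'); rewrite /= !gm fy fy'; split=> //.
    case: (merge_edge nzz' yy') => // /(congr1 g); rewrite !gm fy fy' => E.
    by rewrite E edge_irrefl in xx'.
exists X', f'; split=> //; apply: chain_step c; exact: identification_hom_ex.
Qed.

(** The sequence runs upwards from [L]: an edge of [X] missing in [L] is added at each step, so the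
    number of non-adjacent pairs decreases. *)
Lemma abelianization_stage X L (g : L -> X) : bijective g ->
  (forall x x', edge x x' -> edge (g x) (g x')) ->
  exists L', chain abelianization L L' /\ group_iso (raag X) (raag L').
Proof.
have [n] := ubnP #|[pred p : L * L | ~~ edge p.1 p.2]|.
elim: n L g => // n IH L g nL gB gE.
case: (pselect (exists x x', edge (g x) (g x') /\ ~~ edge x x')) => [[x [x' [gxx' nxx']]]|H].
  have xx' : x != x' by apply: contraTneq gxx' => ->; rewrite edge_irrefl.
  have [|||L' [c i]] := IH (add_edge x x') g.
  - rewrite ltnS in nL; apply: leq_trans nL; apply: proper_card; apply/properP; split.
      apply/fintype.subsetP => p; rewrite !inE; apply: contraNN => pE.
      by rewrite -[edge _ _]/(add_edge_rel x x' p.1 p.2) /add_edge_rel pE.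
    exists (x, x'); rewrite !inE //= /edge /= /add_edge_rel xx' !eqxx orbT.
    by [].
  - exact: gB.
  - move=> u w /orP [/gE //|/andP [_ /orP [] /andP [/eqP -> /eqP ->]]] //.
    by rewrite edge_sym.
  exists L'; split=> //; apply: chain_step c; exact: abelianizing_hom_ex.
exists L; split; first exact: chain_refl.
have [t gK tK] := gB; apply: (@raag_iso_of_bijection X L t); first by exists g.
move=> y y'; rewrite -{2}(tK y) -{2}(tK y'); apply/idP/idP => [/gE //|yy'].
by apply: contrapT => /negP nyy'; apply: H; exists (t y), (t y').
Qed.

Lemma group_iso_refl (G : groupType) : group_iso G G.
Proof.
by exists idfun; exists idfun.
Qed.

End FromMinorsToProjections.

Theorem theorem1p3 (Gam Lam : simple_graph) :
  minor Lam Gam <->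
  exists (a b c : nat) (A B C : nat -> simple_graph)
    (f : forall i, {multiplicative raag (A i) -> raag (A i.+1)})
    (g : forall j, {multiplicative raag (B j) -> raag (B j.+1)})
    (h : forall k, {multiplicative raag (C k) -> raag (C k.+1)}),
    [/\ [/\ 1 <= a, 1 <= b & 1 <= c],
        forall i, 1 <= i < a -> pearl_deletion (f i),
        forall j, 1 <= j < b -> identification_hom (g j),
        forall k, 1 <= k < c -> abelianizing_hom (h k)
      & [/\ group_iso (raag Gam) (raag (A 1)),
            group_iso (raag (A a)) (raag (B 1)),
            group_iso (raag (B b)) (raag (C c))
          & group_iso (raag (C 1)) (raag Lam)]].
Proof.
split=> [/minorP [m /deletion_stage [X1 [m1 [c1 /identification_stage [X2 [m2 [c2 m2i [s2 _ e2]]]]]]]]|].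
  (* After the contractions the minor map is bijective. Its inverse [t] sends edges of [Lam] to
     edges of [X2], which is what [abelianization_stage] starts from. *)
  have H x : exists y, m2 y = x by have [y [<-]] := s2 x; exists y.
  pose t x := projT1 (cid (H x)).
  have tK x : m2 (t x) = x by rewrite /t; case: cid.
  have Kt y : t (m2 y) = y by apply: m2i; rewrite tK.
  have [|x x' /e2 [y [y' [[<-] [<-] yy']]]|L' [c3 iso]] := @abelianization_stage X2 Lam t.
  - by exists m2.
  - by rewrite !Kt.
  have [a [A [f [a1 fP A1 Aa]]]] := chain_homs c1.
  have [b [B [g [b1 gP B1 Bb]]]] := chain_homs c2.
  have [c [C [h [C1 hP CL Cc]]]] := chain_homs c3.
  exists a, b, c, A, B, C, f, g, h; split=> //; rewrite A1 Aa B1 Bb Cc CL.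
  by split=> //; exact: group_iso_refl.
move=> [a [b [c [A [B [C [f [g [h [[a1 b1 c1] fP gP hP [i1 i2 i3 i4]]]]]]]]]]].
have mA := minor_chain a1 (fun i ia => pearl_deletion_minor (fP i ia)).
have mB := minor_chain b1 (fun i ib => identification_minor (gP i ib)).
have mC := minor_chain_up c1 (fun i ic => abelianizing_minor (hP i ic)).
apply: minor_trans (raag_iso_minor i4).2 _.
apply: minor_trans mC _; apply: minor_trans (raag_iso_minor i3).2 _.
apply: minor_trans mB _; apply: minor_trans (raag_iso_minor i2).2 _.
exact: minor_trans mA (raag_iso_minor i1).2.
Qed.
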